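(* Let $k\ge3$ be odd. The weighted number of zeros of $\mathbb{G}_k$ in $\overline{\mathcal F}$ equals $$N_\infty(\mathbb{G}_k)=\begin{cases}\lceil \frac k6\rceil & \text{if } k\equiv 3,5,11 \pmod{12},\\[2pt] \lfloor \frac k6\rfloor & \text{if } k\equiv 1,7,9 \pmod{12}.\end{cases}$$ All these zeros are located on the vertical boundaries $$\left\{\pm\tfrac12+it : t\ge\tfrac12\sqrt3\right\}\cup\{i\infty\}.$$
   Context: Let $\mathfrak{H}$ be the complex upper half plane, $\Gamma=\mathrm{SL}_2(\mathbb{Z})$, $q=e^{2\pi i\tau}$. For $k\ge1$, $$\mathbb{G}_k(\tau)=-\frac{B_k}{2k}+\sum_{m,r\ge1}m^{k-1}q^{mr},$$ where $B_k$ is the $k$th Bernoulli number (so the constant term is $0$ for odd $k\ge3$). Fundamental domain: $\overline{\mathcal F}=\{z\in\mathfrak{H}: |z|\ge1,\ -\frac12\le \mathrm{Re}(z)\le\frac12\}\cup\{i\infty\}$. Let $\rho=-\frac12+\frac{i}{2}\sqrt3$. Weights: $w(\tau)=\frac16$ for $\tau\in\{\rho,\rho+1\}$; $w(\tau)=\frac12$ for other points $\tau\neq i\infty$ of the boundary $\partial\overline{\mathcal F}$; $w(\tau)=1$ for interior points of $\overline{\mathcal F}$ and for $\tau=i\infty$. The weighted number of zeros in $\overline{\mathcal F}$ is $N_\infty(f)=\sum_{\tau\in\overline{\mathcal F}}w(\tau)\nu_\tau(f)$, where for $\tau\in\mathfrak{H}$, $\nu_\tau(f)$ is the usual order of vanishing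 of $f$ at $\tau$, and $\nu_{i\infty}(f)=\min\{n\ge0: a_n\ne0\}$ for $f=\sum_{n\ge0}a_nq^n\ne0$. *)

(* Defs.v *)
From Stdlib Require Import Reals Lra Lia List Arith ClassicalEpsilon.
From Coquelicot Require Import Coquelicot.

Open Scope R_scope.

(* bernoulli_upto n j is B_j for j <= n, computed from
   sum_{j <= n} binom(n+1, j) B_j = 0 for n >= 1; in particular B_1 = -1/2. *)
Fixpoint bernoulli_upto (n : nat) : nat -> R :=
  match n with
  | O => fun _ => 1
  | S m => fun j =>
      if (j <=? m)%nat then bernoulli_upto m j
      else - / INR (S (S m)) *
             sum_f_R0 (fun i => Binomial.C (S (S m)) i * bernoulli_upto m i) m
  end.

Definition bernoulli (n : nat) : R := bernoulli_upto n n.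

Lemma bernoulli_upto_le (m n : nat) :
  (m <= n)%nat -> bernoulli_upto n m = bernoulli m.
Proof.
intros H; induction H as [|n H IH]; [reflexivity|].
simpl; apply Nat.leb_le in H; rewrite H; exact IH.
Qed.

Lemma bernoulli_0 : bernoulli 0 = 1.
Proof. reflexivity. Qed.

Lemma bernoulli_rec (n : nat) :
  sum_f_R0 (fun j => Binomial.C (S (S n)) j * bernoulli j) (S n) = 0.
Proof.
rewrite tech5.
rewrite (sum_eq _ (fun i => Binomial.C (S (S n)) i * bernoulli_upto n i)).
2: { intros i Hi; now rewrite bernoulli_upto_le. }
unfold bernoulli at 1; cbn [bernoulli_upto].
replace (S n <=? n)%nat with false by (symmetry; apply Nat.leb_gt; lia).
replace (Binomial.C (S (S n)) (S n)) with (INR (S (S n))).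
- assert (INR (S (S n)) <> 0) by (apply not_0_INR; lia).
  field; assumption.
- unfold Binomial.C.
  replace (S (S n) - S n)%nat with 1%nat by lia.
  rewrite (fact_simpl (S n)), mult_INR; change (fact 1) with 1%nat.
  simpl (INR 1); field; apply INR_fact_neq_0.
Qed.

(* As with Series, the value is meaningful only for convergent series. *)
Definition CSeries (a : nat -> C) : C :=
  (Series (fun n => Re (a n)), Series (fun n => Im (a n))).

Lemma CSeries_unique (a : nat -> C) (l : C) : is_series a l -> CSeries a = l.
Proof.
intros H; destruct l as [x y]; unfold CSeries; f_equal; apply is_series_unique.
- assert (E : forall n, fst (sum_n a n) = sum_n (fun n => Re (a n)) n).
  { induction n as [|n IH]; [now rewrite !sum_O|].
    rewrite !sum_Sn, <- IH; reflexivity. }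
  apply (filterlim_ext (fun n => fst (sum_n a n))); [exact E|].
  apply (filterlim_comp _ _ _ (sum_n a) fst _ _ _ H).
  intros P [e He]; exists e; intros z [Hz _]; apply He, Hz.
- assert (E : forall n, snd (sum_n a n) = sum_n (fun n => Im (a n)) n).
  { induction n as [|n IH]; [now rewrite !sum_O|].
    rewrite !sum_Sn, <- IH; reflexivity. }
  apply (filterlim_ext (fun n => snd (sum_n a n))); [exact E|].
  apply (filterlim_comp _ _ _ (sum_n a) snd _ _ _ H).
  intros P [e He]; exists e; intros z [_ Hz]; apply He, Hz.
Qed.

Definition Cexp (z : C) : C := (exp (Re z) * cos (Im z), exp (Re z) * sin (Im z)).

Definition nome (tau : C) : C := Cexp (RtoC (2 * PI) * Ci * tau)%C.

(* The summation indices m, r >= 1 are shifted to start at 0. *)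
Definition eisenstein (k : nat) (tau : C) : C :=
  (RtoC (- (bernoulli k / (2 * INR k))) +
   CSeries (fun m => CSeries (fun r =>
     RtoC (INR (S m) ^ (k - 1)) * nome tau ^ (S m * S r))))%C.

Definition in_H (tau : C) : Prop := 0 < Im tau.

(* Points of the upper half plane together with the cusp at i*infinity. *)
Inductive xpoint : Type :=
| Fin (tau : C)
| Cusp.

Definition fund_fin (z : C) : Prop :=
  in_H z /\ 1 <= Cmod z /\ - (1 / 2) <= Re z <= 1 / 2.

Definition fund (p : xpoint) : Prop :=
  match p with Fin z => fund_fin z | Cusp => True end.

Definition rho : C := (- (1 / 2), sqrt 3 / 2).

(* The boundary is topological: fund_fin is closed, so its boundary points are
   its points that do not have a neighbourhood contained in it. *)
Definition weight (p : xpoint) : R :=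
  match p with
  | Cusp => 1
  | Fin z =>
      if excluded_middle_informative (z = rho \/ z = (rho + 1)%C) then 1 / 6
      else if excluded_middle_informative (locally z fund_fin) then 1
      else 1 / 2
  end.

Definition is_order_at (f : C -> C) (tau : C) (n : nat) : Prop :=
  exists g : C -> C,
    locally tau (fun z => ex_derive g z) /\
    g tau <> 0 /\
    locally tau (fun z => f z = ((z - tau) ^ n * g z)%C).

Definition is_q_expansion (f : C -> C) (a : nat -> C) : Prop :=
  forall tau : C, in_H tau -> is_pseries a (nome tau) (f tau).

Definition is_order_cusp (f : C -> C) (n : nat) : Prop :=
  exists a : nat -> C,
    is_q_expansion f a /\ a n <> 0 /\ forall m : nat, (m < n)%nat -> a m = 0.

Definition is_order (f : C -> C) (p : xpoint) (n : nat) : Prop :=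
  match p with
  | Fin tau => is_order_at f tau n
  | Cusp => is_order_cusp f n
  end.

(* is_weighted_zeros f x : N_oo(f) is well defined and equal to x.  The order
   nu p exists at every point p of the fundamental domain, and the support of
   the sum, enumerated by l, is finite. *)
Definition is_weighted_zeros (f : C -> C) (x : R) : Prop :=
  exists (nu : xpoint -> nat) (l : list xpoint),
    (forall p : xpoint, fund p -> is_order f p (nu p)) /\
    NoDup l /\
    (forall p : xpoint, In p l <-> fund p /\ nu p <> 0%nat) /\
    x = fold_right Rplus 0 (map (fun p => weight p * INR (nu p)) l).

Definition is_zero_of (f : C -> C) (p : xpoint) : Prop :=
  exists n : nat, is_order f p n /\ (0 < n)%nat.

Definition vertical_boundary (p : xpoint) : Prop :=
  match p with
  | Cusp => True
  | Fin z => (Re z = 1 / 2 \/ Re z = - (1 / 2)) /\ sqrt 3 / 2 <= Im z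
  end.

(* Main.v *)
(* For odd k the constant term vanishes, so with d = k - 1 the function is the q-series
   gs d q = sum_n sigma_d(n) q^n, and the lines Re tau = 1/2, Re tau = -1/2 are the negative q-axis,
   where the series is real. For 1 <= m <= M = floor(k/6) + 1 it takes a value of sign (-1)^m at a
   point -r_m of that axis: while 8 m^2 <= k the term m^d q^m dominates at |q| = e^(-d/m), and for
   larger m the Lipschitz formula sum_n n^d q^n = c sum_n (tau + n)^(-k) is dominated by two terms,
   whose sum is extremal at tau = -1/2 + (i/2) cot(m pi / k). This gives a zero in each of the M - 1 gaps.
   On the circle |q| = r_M the Lipschitz formula also shows that (tau / i)^k gs d q has positive real
   part, so gs d q / q has winding number M - 1 there: the zeros found are simple and, apart from q = 0,
   there are no others in the disc |q| <= r_M, which contains the image of the fundamental domain.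
   Only the last zero can lie below rho, and the sign of the series at rho decides whether it does.
   For k <= 7 the term q dominates on the whole fundamental domain. *)

Require Import Defs.
From Stdlib Require Import Reals ZArith Ranalysis5 List Psatz ClassicalEpsilon Permutation.
From Coquelicot Require Import Coquelicot.
Open Scope R_scope.

(** * Sums and limits of complex sequences *)

(** For odd k the series is not modular and no valence formula is available, so the winding number
    on a single circle does the counting. It has to be known only up to less than one turn, which a
    half plane condition provides. The circle must reach below rho, yet not far: with delta = M pi /
    k, the bound delta >= pi / 6 puts rho inside, while the errors contain powers of 1 / (2 cos
    delta) and ask for delta <= 0.74. This is what 13 M <= 3 k encodes; it holds for every odd k >=
    9 and fails for k = 7, hence the separate treatment of k <= 7. The divisor series is the sum
    over r >= 1 of [pl d (q ^ r)]; the Lipschitz formula is applied to r = 1, and the terms r >= 2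
    carry a factor 2^-d. The Lipschitz formula itself comes from the rational form of [pl d] and its
    distribution relation, not from Poisson summation. With tau = i s, moduli are compared through
    their squares, which are polynomials in the coordinates, so that the exponent of the estimates
    is h = (k - 1) / 2, and h >= 4 throughout the main case. *)

Fixpoint csum (a : nat -> C) (n : nat) : C :=
  match n with O => 0 | S m => (csum a m + a m)%C end.

Fixpoint rsum (a : nat -> R) (n : nat) : R :=
  match n with O => 0 | S m => rsum a m + a m end.

(** Convergence is phrased through the real sequence of distances, so that real squeeze arguments
    apply directly. *)
Definition Ccv (u : nat -> C) (l : C) : Prop :=
  is_lim_seq (fun n => Cmod (u n - l)) 0.

Lemma csum_ext (a b : nat -> C) (n : nat) :
  (forall i, (i < n)%nat -> a i = b i) -> csum a n = csum b n.
Proof.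
induction n as [|n IH]; intros H; [reflexivity|].
simpl; rewrite IH, H; auto.
Qed.

Lemma rsum_ext (a b : nat -> R) (n : nat) :
  (forall i, (i < n)%nat -> a i = b i) -> rsum a n = rsum b n.
Proof.
induction n as [|n IH]; intros H; [reflexivity|].
simpl; rewrite IH, H; auto.
Qed.

Lemma rsum_le (a b : nat -> R) (n : nat) :
  (forall i, (i < n)%nat -> a i <= b i) -> rsum a n <= rsum b n.
Proof.
induction n as [|n IH]; intros H; simpl; [lra|].
apply Rplus_le_compat; [apply IH|apply H]; auto.
Qed.

Lemma rsum_nonneg (a : nat -> R) (n : nat) :
  (forall i, (i < n)%nat -> 0 <= a i) -> 0 <= rsum a n.
Proof.
induction n as [|n IH]; intros H; simpl; [lra|].
apply Rplus_le_le_0_compat; [apply IH|apply H]; auto.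
Qed.

Lemma rsum_scal (c : R) (a : nat -> R) (n : nat) :
  rsum (fun i => c * a i) n = c * rsum a n.
Proof. induction n as [|n IH]; simpl; [ring|rewrite IH; ring]. Qed.

Lemma rsum_plus (a b : nat -> R) (n : nat) :
  rsum (fun i => a i + b i) n = rsum a n + rsum b n.
Proof. induction n as [|n IH]; simpl; [ring|rewrite IH; ring]. Qed.

Lemma rsum_shift (a : nat -> R) (n : nat) :
  rsum a (S n) = a 0%nat + rsum (fun i => a (S i)) n.
Proof.
induction n as [|n IH]; [simpl; ring|].
change (rsum a (S (S n))) with (rsum a (S n) + a (S n)).
rewrite IH; simpl; ring.
Qed.

Lemma csum_shift (a : nat -> C) (n : nat) :
  csum a (S n) = (a 0%nat + csum (fun i => a (S i)) n)%C.
Proof.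
induction n as [|n IH]; [simpl; ring|].
change (csum a (S (S n))) with (csum a (S n) + a (S n))%C.
rewrite IH; simpl; ring.
Qed.

Lemma csum_scal (c : C) (a : nat -> C) (n : nat) :
  csum (fun i => c * a i)%C n = (c * csum a n)%C.
Proof. induction n as [|n IH]; simpl; [ring|rewrite IH; ring]. Qed.

Lemma csum_plus (a b : nat -> C) (n : nat) :
  csum (fun i => a i + b i)%C n = (csum a n + csum b n)%C.
Proof. induction n as [|n IH]; simpl; [ring|rewrite IH; ring]. Qed.

Lemma csum_minus (a b : nat -> C) (n : nat) :
  csum (fun i => a i - b i)%C n = (csum a n - csum b n)%C.
Proof. induction n as [|n IH]; simpl; [ring|rewrite IH; ring]. Qed.

Lemma csum_0 (a : nat -> C) (n : nat) :
  (forall i, (i < n)%nat -> a i = 0) -> csum a n = 0.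
Proof.
induction n as [|n IH]; intros H; [reflexivity|].
simpl; rewrite IH, H; auto; ring.
Qed.

Lemma csum_swap (a : nat -> nat -> C) (m n : nat) :
  csum (fun i => csum (a i) n) m = csum (fun j => csum (fun i => a i j) m) n.
Proof.
induction m as [|m IH]; simpl.
- symmetry; apply csum_0; reflexivity.
- rewrite IH, <- csum_plus; reflexivity.
Qed.

Lemma csum_add (a : nat -> C) (m n : nat) :
  csum a (m + n) = (csum a m + csum (fun i => a (m + i)%nat) n)%C.
Proof.
induction n as [|n IH].
- rewrite Nat.add_0_r; simpl; ring.
- rewrite Nat.add_succ_r; simpl; rewrite IH; ring.
Qed.

Lemma rsum_add (a : nat -> R) (m n : nat) :
  rsum a (m + n) = rsum a m + rsum (fun i => a (m + i)%nat) n.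
Proof.
induction n as [|n IH].
- rewrite Nat.add_0_r; simpl; ring.
- rewrite Nat.add_succ_r; simpl; rewrite IH; ring.
Qed.

Lemma Cmod_csum (a : nat -> C) (n : nat) :
  Cmod (csum a n) <= rsum (fun i => Cmod (a i)) n.
Proof.
induction n as [|n IH]; simpl; [rewrite Cmod_0; lra|].
eapply Rle_trans; [apply Cmod_triangle|]; lra.
Qed.

Lemma Cmod_csum_le (a : nat -> C) (b : nat -> R) (n : nat) :
  (forall i, (i < n)%nat -> Cmod (a i) <= b i) -> Cmod (csum a n) <= rsum b n.
Proof.
intros H; eapply Rle_trans; [apply Cmod_csum|]; apply rsum_le, H.
Qed.

Lemma csum_RtoC (a : nat -> R) (n : nat) :
  csum (fun i => RtoC (a i)) n = RtoC (rsum a n).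
Proof. induction n as [|n IH]; simpl; [reflexivity|rewrite IH, RtoC_plus; reflexivity]. Qed.

Lemma Cmod_minus_sym (a b : C) : Cmod (a - b) = Cmod (b - a).
Proof. replace (a - b)%C with (- (b - a))%C by ring; apply Cmod_opp. Qed.

Lemma Cmod_triangle_rev (a b : C) : Cmod a - Cmod b <= Cmod (a + b).
Proof.
assert (H := Cmod_triangle (a + b) (- b)); rewrite Cmod_opp in H.
replace (a + b + - b)%C with a in H by ring; lra.
Qed.

Lemma Cmod_minus_triangle (a b c : C) :
  Cmod (a - c) <= Cmod (a - b) + Cmod (b - c).
Proof.
replace (a - c)%C with ((a - b) + (b - c))%C by ring; apply Cmod_triangle.
Qed.

Lemma im_le_Cmod (z : C) : Rabs (Im z) <= Cmod z.
Proof.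
eapply Rle_trans; [|apply Rmax_Cmod]; apply Rmax_r.
Qed.

Lemma squeeze_0 (u v : nat -> R) :
  (forall n, 0 <= u n <= v n) -> is_lim_seq v 0 -> is_lim_seq u 0.
Proof.
intros H Hv; apply (is_lim_seq_le_le (fun _ => 0) u v); auto.
apply is_lim_seq_const.
Qed.

Lemma Ccv_squeeze (u : nat -> C) (l : C) (v : nat -> R) :
  (forall n, Cmod (u n - l) <= v n) -> is_lim_seq v 0 -> Ccv u l.
Proof.
intros H Hv; apply (squeeze_0 _ v); auto.
intros n; split; [apply Cmod_ge_0|apply H].
Qed.

Lemma lim0_plus (u v : nat -> R) :
  is_lim_seq u 0 -> is_lim_seq v 0 -> is_lim_seq (fun n => u n + v n) 0.
Proof.
intros Hu Hv; replace (Finite 0) with (Finite (0 + 0)) by (f_equal; ring).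
apply (is_lim_seq_plus' _ _ _ _ Hu Hv).
Qed.

Lemma lim0_scal (c : R) (u : nat -> R) :
  is_lim_seq u 0 -> is_lim_seq (fun n => c * u n) 0.
Proof.
intros Hu; replace (Finite 0) with (Rbar_mult c 0) by (simpl; f_equal; ring).
apply is_lim_seq_scal_l, Hu.
Qed.

Lemma Ccv_ext (u v : nat -> C) (l : C) :
  (forall n, u n = v n) -> Ccv u l -> Ccv v l.
Proof.
intros E H; eapply is_lim_seq_ext; [|exact H]; intros n; simpl; now rewrite E.
Qed.

Lemma Ccv_const (l : C) : Ccv (fun _ => l) l.
Proof.
apply (Ccv_squeeze _ _ (fun _ => 0)); [|apply is_lim_seq_const].
intros _; replace (l - l)%C with (RtoC 0) by ring; rewrite Cmod_0; lra.
Qed.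

Lemma Ccv_plus (u v : nat -> C) (l m : C) :
  Ccv u l -> Ccv v m -> Ccv (fun n => u n + v n)%C (l + m).
Proof.
intros Hu Hv; eapply Ccv_squeeze; [|exact (lim0_plus _ _ Hu Hv)].
intros n; simpl; replace (u n + v n - (l + m))%C with ((u n - l) + (v n - m))%C by ring.
apply Cmod_triangle.
Qed.

Lemma Ccv_scal (c : C) (u : nat -> C) (l : C) :
  Ccv u l -> Ccv (fun n => c * u n)%C (c * l).
Proof.
intros Hu; eapply Ccv_squeeze; [|exact (lim0_scal (Cmod c) _ Hu)].
intros n; simpl; replace (c * u n - c * l)%C with (c * (u n - l))%C by ring.
rewrite Cmod_mult; lra.
Qed.

Lemma Ccv_minus (u v : nat -> C) (l m : C) :
  Ccv u l -> Ccv v m -> Ccv (fun n => u n - v n)%C (l - m).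
Proof.
intros Hu Hv; eapply Ccv_squeeze; [|exact (lim0_plus _ _ Hu Hv)].
intros n; simpl; replace (u n - v n - (l - m))%C with ((u n - l) + - (v n - m))%C by ring.
eapply Rle_trans; [apply Cmod_triangle|rewrite Cmod_opp; lra].
Qed.

Lemma Ccv_subseq (u : nat -> C) (l : C) (phi : nat -> nat) :
  (forall n, (n <= phi n)%nat) -> Ccv u l -> Ccv (fun n => u (phi n)) l.
Proof.
intros Hphi Hu.
apply (is_lim_seq_subseq (fun n => Cmod (u n - l)) 0 phi); [|exact Hu].
intros P [N HN]; exists N; intros n Hn; apply HN; specialize (Hphi n); lia.
Qed.

Lemma Ccv_shift (u : nat -> C) (l : C) : Ccv (fun n => u (S n)) l <-> Ccv u l.
Proof.
unfold Ccv; split; intros H.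
- apply (is_lim_seq_incr_1 (fun n => Cmod (u n - l))), H.
- apply (is_lim_seq_incr_1 (fun n => Cmod (u n - l))), H.
Qed.

(* Only an eventual bound is assumed, as the estimates for the Lipschitz sums start once the main terms are included. *)
Lemma Ccv_bound (u : nat -> C) (l A : C) (B : R) (N : nat) :
  Ccv u l -> (forall n, (N <= n)%nat -> Cmod (u n - A) <= B) -> Cmod (l - A) <= B.
Proof.
intros Hu H.
assert (Hl : is_lim_seq (fun n => B + Cmod (u (N + n)%nat - l)) B).
{ replace (Finite B) with (Finite (B + 0)) by (f_equal; ring).
  apply is_lim_seq_plus'; [apply is_lim_seq_const|].
  refine (Ccv_subseq u l (fun n => N + n)%nat _ Hu); intros; lia. }
apply (is_lim_seq_le (fun _ => Cmod (l - A)) _ (Cmod (l - A)) B) in Hl;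
  [exact Hl| |apply is_lim_seq_const].
intros n.
eapply Rle_trans; [apply (Cmod_minus_triangle _ (u (N + n)%nat))|].
rewrite (Cmod_minus_sym l); specialize (H (N + n)%nat ltac:(lia)); lra.
Qed.

Lemma Ccv_unique (u : nat -> C) (l m : C) : Ccv u l -> Ccv u m -> l = m.
Proof.
intros Hl Hm; apply Ceq_minus, Cmod_eq_0, Rle_antisym; [|apply Cmod_ge_0].
assert (H := Ccv_minus _ _ _ _ Hl Hm).
replace (l - m)%C with (l - m - 0)%C by ring.
apply (Ccv_bound _ _ _ _ 0 H); intros n _.
replace (u n - u n - 0)%C with (RtoC 0) by ring; rewrite Cmod_0; lra.
Qed.

Lemma sum_n_csum (a : nat -> C) (n : nat) :
  @sum_n C_AbelianMonoid a n = csum a (S n).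
Proof.
induction n as [|n IH]; [rewrite sum_O; simpl; ring|].
rewrite sum_Sn, IH; reflexivity.
Qed.

Lemma sum_n_rsum (a : nat -> R) (n : nat) : sum_n a n = rsum a (S n).
Proof.
induction n as [|n IH]; [rewrite sum_O; simpl; ring|].
rewrite sum_Sn, IH; reflexivity.
Qed.

(** Series converge along the neighbourhood filter of a uniform structure, which has to be exchanged
    with the balls of [Cmod] in both directions. *)
Lemma is_series_Ccv (a : nat -> C) (l : C) :
  @is_series C_AbsRing C_NormedModule a l <-> Ccv (csum a) l.
Proof.
rewrite <- Ccv_shift; unfold is_series.
split; intros H.
- intros P [e He].
  assert (H' : locally l (fun z => Cmod (z - l) < e)).
  { apply (locally_le_locally_norm l); exists e; intros y Hy; exact Hy. }
  specialize (H _ H'); destruct H as [N HN]; exists N; intros n Hn.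
  apply He; specialize (HN n Hn); rewrite sum_n_csum in HN.
  change (Rabs (Cmod (csum a (S n) - l) - 0) < e).
  rewrite Rminus_0_r, Rabs_pos_eq; [exact HN|apply Cmod_ge_0].
- intros P HP; apply (locally_norm_le_locally l) in HP; destruct HP as [e He].
  assert (H' : locally 0 (fun y => Rabs (y - 0) < e)) by (exists e; intros y Hy; exact Hy).
  specialize (H _ H'); destruct H as [N HN]; exists N; intros n Hn.
  apply He; specialize (HN n Hn); simpl in HN.
  rewrite Rminus_0_r, Rabs_pos_eq in HN; [|apply Cmod_ge_0].
  rewrite sum_n_csum; exact HN.
Qed.

Lemma CSeries_Ccv (a : nat -> C) (l : C) : Ccv (csum a) l -> CSeries a = l.
Proof. intros H; apply CSeries_unique, is_series_Ccv, H. Qed.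

(** Weierstrass comparison: the value [CSeries], which is meaningful only for convergent series, is
    obtained together with its convergence and a bound. *)
Lemma Ccv_dominated (a : nat -> C) (b : nat -> R) (B : R) :
  (forall n, Cmod (a n) <= b n) -> (forall n, rsum b n <= B) ->
  Ccv (csum a) (CSeries a) /\ Cmod (CSeries a) <= B.
Proof.
intros Hab HB.
assert (Hb : ex_series b).
{ assert (Hc : ex_finite_lim_seq (sum_n b)).
  { apply (ex_finite_lim_seq_incr _ B); intros n; rewrite !sum_n_rsum; [|apply HB].
    simpl; specialize (Hab (S n)); assert (H := Cmod_ge_0 (a (S n))); lra. }
  destruct Hc as [l Hl]; exists l; exact Hl. }
assert (Ha : @ex_series C_AbsRing C_NormedModule a).
{ apply (@ex_series_le C_AbsRing C_CompleteNormedModule a b); [exact Hab|exact Hb]. }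
destruct Ha as [l Hl]; apply is_series_Ccv in Hl.
rewrite (CSeries_Ccv _ _ Hl); split; [exact Hl|].
replace l with (l - 0)%C by ring.
apply (Ccv_bound _ _ _ _ 0 Hl); intros n _.
replace (csum a n - 0)%C with (csum a n) by ring.
eapply Rle_trans; [apply Cmod_csum_le; intros; apply Hab|apply HB].
Qed.

Lemma rsum_geom (x : R) (n : nat) : 0 <= x < 1 -> rsum (fun i => x ^ i) n <= / (1 - x).
Proof.
intros Hx.
assert (E : rsum (fun i => x ^ i) n = (1 - x ^ n) / (1 - x)).
{ induction n as [|n IH]; simpl; [field; lra|rewrite IH; field; lra]. }
rewrite E; unfold Rdiv; rewrite <- (Rmult_1_l (/ (1 - x))) at 2.
apply Rmult_le_compat_r; [left; apply Rinv_0_lt_compat; lra|].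
assert (0 <= x ^ n) by (apply pow_le; lra); lra.
Qed.

Lemma pow_lim0 (x : R) : 0 <= x < 1 -> is_lim_seq (fun n => x ^ n) 0.
Proof. intros Hx; apply is_lim_seq_geom; rewrite Rabs_pos_eq; lra. Qed.

(* From x <= exp x applied to x = eps n, so that only the crude constant eps^(-d) is lost. *)
Lemma poly_le_geom (d : nat) (r : R) : 1 < r ->
  exists K, 0 < K /\ forall n, INR n ^ d <= K * r ^ n.
Proof.
intros Hr; destruct d as [|d].
{ exists 1; split; [lra|]; intros n; simpl; rewrite Rmult_1_l; apply pow_R1_Rle; lra. }
set (e := ln r / INR (S d)).
assert (Hd : 0 < INR (S d)) by (apply lt_0_INR; lia).
assert (He : 0 < e).
{ apply Rdiv_lt_0_compat; auto; rewrite <- ln_1; apply ln_increasing; lra. }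
exists ((/ e) ^ S d); split; [apply pow_lt, Rinv_0_lt_compat, He|].
intros n.
replace (r ^ n) with (exp (e * INR n) ^ S d).
{ rewrite <- Rpow_mult_distr; apply pow_incr; split; [apply pos_INR|].
  assert (H := exp_ineq1_le (e * INR n)).
  apply Rmult_le_reg_l with e; auto; rewrite <- Rmult_assoc, Rinv_r, Rmult_1_l; lra. }
rewrite <- Rpower_pow by apply exp_pos; rewrite <- (Rpower_pow n) by lra.
unfold Rpower; rewrite ln_exp; f_equal; unfold e; field; lra.
Qed.

(** * Power series on discs *)

Definition PS (a : nat -> C) (q : C) : C := CSeries (fun n => a n * q ^ n)%C.

(** This growth condition gives convergence for |q| < 1 / r with an explicit bound, and it is stable
    under shifts and under division by a linear factor. *)
Definition geo (K r : R) (a : nat -> C) : Prop := forall n, Cmod (a n) <= K * r ^ n.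

Lemma geo_pos (K r : R) (a : nat -> C) : geo K r a -> 0 <= K.
Proof.
intros H; specialize (H 0%nat); simpl in H; assert (H0 := Cmod_ge_0 (a 0%nat)); lra.
Qed.

Lemma PS_Ccv (K r : R) (a : nat -> C) (q : C) :
  geo K r a -> 0 < r -> r * Cmod q < 1 ->
  Ccv (csum (fun n => a n * q ^ n)%C) (PS a q) /\ Cmod (PS a q) <= K / (1 - r * Cmod q).
Proof.
intros Ha Hr Hq; assert (HK := geo_pos _ _ _ Ha).
assert (Hq0 := Cmod_ge_0 q).
apply (Ccv_dominated _ (fun n => K * (r * Cmod q) ^ n)).
- intros n; rewrite Cmod_mult, Cmod_pow, Rpow_mult_distr, <- Rmult_assoc.
  apply Rmult_le_compat_r; [apply pow_le; auto|apply Ha].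
- intros n; rewrite rsum_scal; apply Rmult_le_compat_l; auto.
  apply rsum_geom; split; auto; apply Rmult_le_pos; lra.
Qed.

Lemma PS_unique (a : nat -> C) (q l : C) :
  Ccv (csum (fun n => a n * q ^ n)%C) l -> PS a q = l.
Proof. apply CSeries_Ccv. Qed.

Lemma geo_tail (K r : R) (a : nat -> C) (m : nat) :
  geo K r a -> 0 < r -> geo (K * r ^ m) r (fun j => a (m + j)%nat).
Proof. intros Ha Hr n; rewrite Rmult_assoc, <- pow_add; apply Ha. Qed.

Lemma PS_0 (a : nat -> C) : PS a 0 = a 0%nat.
Proof.
apply PS_unique; apply Ccv_shift; eapply Ccv_ext; [|apply Ccv_const].
intros n; symmetry; simpl; induction n as [|n IH]; simpl; [ring|rewrite IH; ring].
Qed.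

Lemma PS_head (K r : R) (a : nat -> C) (q : C) :
  geo K r a -> 0 < r -> r * Cmod q < 1 ->
  PS a q = (a 0%nat + q * PS (fun j => a (S j)) q)%C.
Proof.
intros Ha Hr Hq; apply PS_unique, Ccv_shift.
destruct (PS_Ccv _ _ _ _ (geo_tail _ _ _ 1 Ha Hr) Hr Hq) as [H _].
eapply Ccv_ext; [|exact (Ccv_plus _ _ _ _ (Ccv_const (a 0%nat)) (Ccv_scal q _ _ H))].
intros n; simpl; rewrite <- csum_scal.
change (csum (fun n0 : nat => a n0 * q ^ n0) n + a n * q ^ n)%C with
  (csum (fun n0 : nat => a n0 * q ^ n0) (S n))%C.
rewrite csum_shift; f_equal; [simpl; ring|].
apply csum_ext; intros i _; simpl; ring.
Qed.

(** The coefficients of the divided difference of [PS a] at [g]: the n-th one is the sum of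
    a_(n+1+j) g^j over j. *)
Definition quot (a : nat -> C) (g : C) (n : nat) : C := PS (fun j => a (S n + j)%nat) g.

Lemma geo_quot (K r : R) (a : nat -> C) (g : C) :
  geo K r a -> 0 < r -> r * Cmod g < 1 ->
  geo (K * (r / (1 - r * Cmod g))) r (quot a g).
Proof.
intros Ha Hr Hg n.
destruct (PS_Ccv _ _ _ _ (geo_tail _ _ _ (S n) Ha Hr) Hr Hg) as [_ H].
unfold quot; eapply Rle_trans; [exact H|].
right; simpl; field; lra.
Qed.

(** Horner's recursion b_n = a_(n+1) + g b_(n+1) telescopes the product of q - g with the partial
    sums of b_n q^n; the boundary term tends to 0. *)
Lemma PS_factor (K r : R) (a : nat -> C) (g q : C) :
  geo K r a -> 0 < r -> r * Cmod g < 1 -> r * Cmod q < 1 ->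
  PS a q = (PS a g + (q - g) * PS (quot a g) q)%C.
Proof.
intros Ha Hr Hg Hq.
assert (Hb := geo_quot _ _ _ _ Ha Hr Hg).
destruct (PS_Ccv _ _ _ _ Ha Hr Hq) as [H1 _].
destruct (PS_Ccv _ _ _ _ Hb Hr Hq) as [H2 _].
set (b := quot a g) in *.
assert (E0 : PS a g = (a 0%nat + g * b 0%nat)%C) by exact (PS_head _ _ _ _ Ha Hr Hg).
assert (Eb : forall n, b n = (a (S n) + g * b (S n))%C).
{ intros n; unfold b, quot.
  rewrite (PS_head _ _ _ _ (geo_tail _ _ _ (S n) Ha Hr) Hr Hg).
  rewrite Nat.add_0_r; do 2 f_equal; unfold PS; f_equal.
  apply FunctionalExtensionality.functional_extensionality; intros j.
  do 2 f_equal; lia. }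
(* The two matches on [n] only correct the empty sum at n = 0, where [a 0] and [b 0] have not yet
   entered. *)
assert (Et : forall n, ((q - g) * csum (fun n => b n * q ^ n) n =
    csum (fun n => a n * q ^ n) n - a 0%nat - g * b 0%nat + (a 0%nat + g * b 0%nat) * (if n then 1 else 0)
     + (if n then 0 else b (pred n) * q ^ n))%C).
{ induction n as [|n IH]; [simpl; ring|].
  simpl csum; rewrite Cmult_plus_distr_l, IH; destruct n as [|n].
  - simpl; ring.
  - simpl pred; rewrite (Eb n); simpl; ring. }
assert (H3 := Ccv_scal (q - g) _ _ H2).
assert (H4 : Ccv (fun n => (q - g) * csum (fun n => b n * q ^ n) n)%C (PS a q - PS a g)).
{ apply Ccv_shift.
  apply Ccv_shift in H1.
  eapply Ccv_ext; [intros n; symmetry; apply Et|].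
  replace (PS a q - PS a g)%C with (PS a q - PS a g + 0)%C by ring.
  apply Ccv_plus.
  - eapply Ccv_ext; [|exact (Ccv_minus _ _ _ _ H1 (Ccv_const (PS a g)))].
    intros n; rewrite E0; simpl; ring.
  - apply (Ccv_squeeze _ _ (fun n => K * (r / (1 - r * Cmod g)) * Cmod q * (r * Cmod q) ^ n)).
    + intros n; simpl pred.
      replace (b n * q ^ S n - 0)%C with (b n * q ^ S n)%C by ring.
      rewrite Cmod_mult, Cmod_pow, Rpow_mult_distr; simpl.
      assert (H := Hb n); fold b in H.
      assert (0 <= Cmod q * Cmod q ^ n)
        by (apply Rmult_le_pos; [|apply pow_le]; apply Cmod_ge_0).
      replace (K * (r / (1 - r * Cmod g)) * Cmod q * (r ^ n * Cmod q ^ n)) with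
       (K * (r / (1 - r * Cmod g)) * r ^ n * (Cmod q * Cmod q ^ n)) by ring.
      apply Rmult_le_compat_r; auto.
    + apply lim0_scal, pow_lim0; split; auto.
      apply Rmult_le_pos; [lra|apply Cmod_ge_0]. }
rewrite <- (Ccv_unique _ _ _ H4 H3); ring.
Qed.

(** The divided difference is bounded on the disc of radius [s], which makes the constant uniform in
    both points. *)
Lemma PS_lip (K r s : R) (a : nat -> C) (g q : C) :
  geo K r a -> 0 < r -> r * s < 1 -> Cmod g <= s -> Cmod q <= s ->
  Cmod (PS a q - PS a g) <= K * r / (1 - r * s) ^ 2 * Cmod (q - g).
Proof.
intros Ha Hr Hs Hg Hq; assert (HK := geo_pos _ _ _ Ha).
assert (Hg' : r * Cmod g <= r * s) by (apply Rmult_le_compat_l; lra).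
assert (Hq' : r * Cmod q <= r * s) by (apply Rmult_le_compat_l; lra).
rewrite (PS_factor _ _ _ g q Ha Hr); try lra.
replace (PS a g + (q - g) * PS (quot a g) q - PS a g)%C with
  (PS (quot a g) q * (q - g))%C by ring.
rewrite Cmod_mult; apply Rmult_le_compat_r; [apply Cmod_ge_0|].
destruct (PS_Ccv _ _ _ q (geo_quot _ _ _ g Ha Hr ltac:(lra)) Hr ltac:(lra)) as [_ H].
eapply Rle_trans; [exact H|].
unfold Rdiv; simpl; rewrite Rmult_1_r, Rinv_mult, <- !Rmult_assoc.
assert (0 <= K * r) by (apply Rmult_le_pos; lra).
apply Rmult_le_compat; try (apply Rinv_le_contravar; lra);
  try (left; apply Rinv_0_lt_compat; lra).
- apply Rmult_le_pos; auto; left; apply Rinv_0_lt_compat; lra.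
- apply Rmult_le_compat_l; auto; apply Rinv_le_contravar; lra.
Qed.

Lemma C_derive_of_factor (f h : C -> C) (z : C) (L e : R) : 0 < e -> 0 <= L ->
  (forall w, Cmod (w - z) < e -> f w = (f z + (w - z) * h w)%C) ->
  (forall w, Cmod (w - z) < e -> Cmod (h w - h z) <= L * Cmod (w - z)) ->
  @is_derive C_AbsRing C_NormedModule f z (h z).
Proof.
intros He HL Hf Hh; split; [apply is_linear_scal_l|].
intros x Hx.
(* The derivative is required at every limit of the neighbourhood filter of [z], and [z] is the only
   one. *)
assert (Ex : z = x) by (apply (is_filter_lim_locally_unique (K := C_AbsRing) (V := AbsRing_NormedModule C_AbsRing)); exact Hx).
subst x; intros eps.
assert (Hd : 0 < Rmin e (eps / (L + 1))).
{ apply Rmin_glb_lt; auto; apply Rdiv_lt_0_compat; [apply eps|lra]. }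
exists (mkposreal _ Hd); intros w Hw.
change (Cmod (w - z) < Rmin e (eps / (L + 1))) in Hw.
assert (H1 := Rmin_l e (eps / (L + 1))); assert (H2 := Rmin_r e (eps / (L + 1))).
change (Cmod (f w - f z - (w - z) * h z) <= eps * Cmod (w - z)).
rewrite Hf by lra.
replace (f z + (w - z) * h w - f z - (w - z) * h z)%C with
  ((h w - h z) * (w - z))%C by ring.
rewrite Cmod_mult; apply Rmult_le_compat_r; [apply Cmod_ge_0|].
eapply Rle_trans; [apply Hh; lra|].
apply Rle_trans with ((L + 1) * Cmod (w - z)).
{ apply Rmult_le_compat_r; [apply Cmod_ge_0|lra]. }
apply Rle_trans with ((L + 1) * (eps / (L + 1))); [apply Rmult_le_compat_l; lra|].
right; field; lra.
Qed.

Lemma PS_is_derive (K r : R) (a : nat -> C) (z : C) :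
  geo K r a -> 0 < r -> r * Cmod z < 1 ->
  @is_derive C_AbsRing C_NormedModule (PS a) z (PS (quot a z) z).
Proof.
intros Ha Hr Hz.
(* The midpoint between |z| and the radius 1 / r leaves room for a disc around [z]. *)
set (s := (Cmod z + / r) / 2).
assert (Hzr : Cmod z < / r).
{ apply Rmult_lt_reg_l with r; auto; rewrite Rinv_r; lra. }
assert (Hs : r * s < 1).
{ unfold s; apply Rmult_lt_reg_l with (/ r); [apply Rinv_0_lt_compat; lra|].
  rewrite <- Rmult_assoc, Rinv_l, Rmult_1_r by lra; lra. }
assert (Hw : forall w, Cmod (w - z) < s - Cmod z -> Cmod w <= s).
{ intros w H; replace w with ((w - z) + z)%C by ring.
  eapply Rle_trans; [apply Cmod_triangle|lra]. }
assert (Hb := geo_quot _ _ _ _ Ha Hr Hz).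
apply (C_derive_of_factor (PS a) (PS (quot a z)) z
  (K * (r / (1 - r * Cmod z)) * r / (1 - r * s) ^ 2) (s - Cmod z)).
- unfold s; lra.
- assert (0 <= K * (r / (1 - r * Cmod z))) by apply (geo_pos _ _ _ Hb).
  apply Rmult_le_pos; [apply Rmult_le_pos; lra|].
  left; apply Rinv_0_lt_compat, pow_lt; lra.
- intros w H; specialize (Hw w H); apply (PS_factor K r); auto.
  apply Rle_lt_trans with (r * s); auto; apply Rmult_le_compat_l; lra.
- intros w H; specialize (Hw w H).
  apply PS_lip; auto; unfold s; lra.
Qed.

Lemma PS_conj (a : nat -> R) (q : C) :
  PS (fun n => RtoC (a n)) (Cconj q) = Cconj (PS (fun n => RtoC (a n)) q).
Proof.
assert (E : forall n, (RtoC (a n) * Cconj q ^ n = Cconj (RtoC (a n) * q ^ n))%C).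
{ intros n; rewrite Cmult_conj, Cpow_conj; f_equal.
  unfold Cconj, RtoC; simpl; f_equal; ring. }
apply injective_projections.
- change (Series (fun n => Re (RtoC (a n) * Cconj q ^ n)%C) =
    Series (fun n => Re (RtoC (a n) * q ^ n)%C)).
  apply Series_ext; intros n; rewrite E; apply re_conj.
- change (Series (fun n => Im (RtoC (a n) * Cconj q ^ n)%C) =
    - Series (fun n => Im (RtoC (a n) * q ^ n)%C)).
  rewrite <- Series_opp; apply Series_ext; intros n; rewrite E; apply im_conj.
Qed.

Lemma PS_real (a : nat -> R) (x : R) : Im (PS (fun n => RtoC (a n)) x) = 0.
Proof.
assert (H := PS_conj a (RtoC x)).
replace (Cconj x) with (RtoC x) in H by (unfold Cconj, RtoC; simpl; f_equal; ring).
assert (H' := f_equal Im H); rewrite im_conj in H'; lra.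
Qed.

(** * Lifts and winding numbers *)

Lemma RtoC_neq (r : R) : r <> 0 -> RtoC r <> 0.
Proof. intros H E; apply H; injection E; auto. Qed.

Definition cis (x : R) : C := (cos x, sin x).

Lemma cis_plus (x y : R) : cis (x + y) = (cis x * cis y)%C.
Proof.
unfold cis, Cmult; simpl; rewrite cos_plus, sin_plus; f_equal; ring.
Qed.

Lemma cis_0 : cis 0 = 1.
Proof. unfold cis; rewrite cos_0, sin_0; reflexivity. Qed.

Lemma cis_opp (x : R) : cis (- x) = Cconj (cis x).
Proof. unfold cis, Cconj; simpl; rewrite cos_neg, sin_neg; reflexivity. Qed.

Lemma Cmod_cis (x : R) : Cmod (cis x) = 1.
Proof.
unfold cis, Cmod; simpl; assert (H := sin2_cos2 x); unfold Rsqr in H.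
replace (cos x * (cos x * 1) + sin x * (sin x * 1)) with 1 by lra; apply sqrt_1.
Qed.

Lemma cis_nz (x : R) : cis x <> 0.
Proof. apply Cmod_gt_0; rewrite Cmod_cis; lra. Qed.

Lemma cis_pow (x : R) (n : nat) : (cis x ^ n)%C = cis (INR n * x).
Proof.
induction n as [|n IH].
- simpl INR; rewrite Rmult_0_l, cis_0; reflexivity.
- rewrite Cpow_S, IH, S_INR, <- cis_plus; f_equal; ring.
Qed.

Lemma cis_2PI (x : R) (n : nat) : cis (x + 2 * INR n * PI) = cis x.
Proof. unfold cis; rewrite cos_period, sin_period; reflexivity. Qed.

Lemma cis_PI : cis PI = (- (1))%C.
Proof. unfold cis; rewrite cos_PI, sin_PI; unfold Copp, RtoC; simpl; f_equal; lra. Qed.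

Lemma cis_lip (x y : R) : Cmod (cis x - cis y) <= 2 * Rabs (x - y).
Proof.
assert (Hc : forall f f' : R -> R, (forall z, derivable_pt_lim f z (f' z)) ->
  (forall z, Rabs (f' z) <= 1) -> Rabs (f x - f y) <= Rabs (x - y)).
{ intros f f' Hd Hb.
  assert (H := MVT_gen f y x f').
  destruct H as [c [_ Hc]].
  - intros z _; apply is_derive_Reals, Hd.
  - intros z _; apply derivable_continuous_pt; exists (f' z); apply Hd.
  - rewrite Hc, Rabs_mult; apply Rle_trans with (1 * Rabs (x - y)); [|lra].
    apply Rmult_le_compat_r; [apply Rabs_pos|apply Hb]. }
replace (cis x - cis y)%C with (RtoC (cos x - cos y) + Ci * RtoC (sin x - sin y))%C.
2: { apply injective_projections; simpl; ring. }
eapply Rle_trans; [apply Cmod_triangle|].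
rewrite Cmod_mult, Cmod_Ci, !Cmod_R, Rmult_1_l.
assert (H1 := Hc cos (fun z => - sin z) derivable_pt_lim_cos).
assert (H2 := Hc sin cos derivable_pt_lim_sin).
assert (H3 : forall z, Rabs (- sin z) <= 1).
{ intros z; rewrite Rabs_Ropp; apply Rabs_le, SIN_bound. }
assert (H4 : forall z, Rabs (cos z) <= 1) by (intros z; apply Rabs_le, COS_bound).
specialize (H1 H3); specialize (H2 H4); lra.
Qed.

Lemma Cmod_scal_cis (r t : R) : 0 <= r -> Cmod (r * cis t) = r.
Proof. intros Hr; rewrite Cmod_mult, Cmod_R, Cmod_cis, Rabs_pos_eq by auto; ring. Qed.

(** This continuous branch of the argument on the right half plane supplies the lifts in
    [winds_near] and [gs1_lift]. *)
Lemma polar_of_Re_pos (z : C) : 0 < Re z -> z = (Cmod z * cis (atan (Im z / Re z)))%C.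
Proof.
intros Hz; destruct z as [x y]; unfold Re, Im in *; simpl in *.
set (m := Cmod (x, y)).
assert (Hm : 0 < m).
{ apply Cmod_gt_0; intros E; injection E; intros; subst; lra. }
assert (Hm2 : m * m = x * x + y * y).
{ unfold m; assert (H := Cmod2_alt (x, y)); unfold Re, Im in H; simpl in H; lra. }
assert (E : sqrt (1 + (y / x)²) = m / x).
{ replace (1 + (y / x)²) with ((m / x) * (m / x)).
  - apply sqrt_square; apply Rlt_le, Rdiv_lt_0_compat; auto.
  - unfold Rsqr; replace (m / x * (m / x)) with (m * m / (x * x)) by (field; lra).
    rewrite Hm2; field; lra. }
unfold cis; rewrite cos_atan, sin_atan, E.
unfold Cmult, RtoC; simpl; f_equal; field; lra.
Qed.

Lemma polar (z : C) : exists t, z = (Cmod z * cis t)%C.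
Proof.
assert (Hopp : forall z, (exists t, (- z)%C = (Cmod (- z) * cis t)%C) ->
  exists t, z = (Cmod z * cis t)%C).
{ intros w [t Ht]; exists (t + PI); rewrite cis_plus, cis_PI.
  rewrite Cmod_opp in Ht.
  transitivity (- (- w))%C; [ring|rewrite Ht at 1; ring]. }
destruct (Rtotal_order (Re z) 0) as [H|[H|H]].
- apply Hopp; eexists; apply polar_of_Re_pos; rewrite re_opp; lra.
- assert (Him : forall w, Re w = 0 -> 0 <= Im w -> exists t, w = (Cmod w * cis t)%C).
  { intros [x y] Hx Hy; unfold Re, Im in *; simpl in *; subst x; exists (PI / 2).
    unfold cis; rewrite cos_PI2, sin_PI2.
    assert (E : Cmod (0, y) = y).
    { unfold Cmod; simpl; rewrite Rmult_0_l, Rplus_0_l, Rmult_1_r; apply sqrt_square, Hy. }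
    rewrite E; unfold Cmult, RtoC; simpl; f_equal; ring. }
  destruct (Rle_lt_dec 0 (Im z)) as [Hi|Hi]; [apply Him; auto|].
  apply Hopp, Him; [rewrite re_opp; lra|rewrite im_opp; lra].
- eexists; apply polar_of_Re_pos, H.
Qed.

Definition fcont (f : R -> C) (x : R) : Prop :=
  continuity_pt (fun y => Re (f y)) x /\ continuity_pt (fun y => Im (f y)) x.

Lemma fcont_lip (f : R -> C) (x L : R) :
  0 <= L -> (forall y, Cmod (f y - f x) <= L * Rabs (y - x)) -> fcont f x.
Proof.
intros HL H.
assert (G : forall p : C -> R, (forall z w, Rabs (p z - p w) <= Cmod (z - w)) ->
  continuity_pt (fun y => p (f y)) x).
{ intros p Hp e He; exists (e / (L + 1)); split.
  - apply Rdiv_lt_0_compat; lra.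
  - intros y [_ Hy]; simpl in *; unfold Rdist in *.
    eapply Rle_lt_trans; [apply Hp|].
    eapply Rle_lt_trans; [apply H|].
    apply Rle_lt_trans with ((L + 1) * Rabs (y - x)).
    + apply Rmult_le_compat_r; [apply Rabs_pos|lra].
    + replace e with ((L + 1) * (e / (L + 1))) by (field; lra).
      apply Rmult_lt_compat_l; lra. }
split; apply G; intros z w.
- replace (Re z - Re w) with (Re (z - w)) by (unfold Cminus; rewrite re_plus, re_opp; ring).
  apply re_le_Cmod.
- replace (Im z - Im w) with (Im (z - w)) by (unfold Cminus; rewrite im_plus, im_opp; ring).
  apply im_le_Cmod.
Qed.

Lemma fcont_mult (f g : R -> C) (x : R) :
  fcont f x -> fcont g x -> fcont (fun y => f y * g y)%C x.
Proof.
intros [F1 F2] [G1 G2]; split.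
- apply (continuity_pt_ext (fun y => Re (f y) * Re (g y) - Im (f y) * Im (g y))).
  { intros y; now rewrite re_mult. }
  apply continuity_pt_minus; apply continuity_pt_mult; auto.
- apply (continuity_pt_ext (fun y => Re (f y) * Im (g y) + Im (f y) * Re (g y))).
  { intros y; now rewrite im_mult. }
  apply continuity_pt_plus; apply continuity_pt_mult; auto.
Qed.

Lemma fcont_conj (f : R -> C) (x : R) : fcont f x -> fcont (fun y => Cconj (f y)) x.
Proof.
intros [F1 F2]; split.
- apply (continuity_pt_ext (fun y => Re (f y))); auto; intros y; now rewrite re_conj.
- apply (continuity_pt_ext (fun y => - Im (f y))); [intros y; now rewrite im_conj|].
  apply continuity_pt_opp, F2.
Qed.

Lemma fcont_atan (f : R -> C) (x : R) : fcont f x -> 0 < Re (f x) ->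
  continuity_pt (fun y => atan (Im (f y) / Re (f y))) x.
Proof.
intros [F1 F2] H; apply (continuity_pt_comp (fun y => Im (f y) / Re (f y)) atan).
- apply continuity_pt_div; auto; lra.
- apply derivable_continuous_pt, derivable_pt_atan.
Qed.

(** At a zero of [f] the polar equation says nothing about [al], whence the nonvanishing hypothesis
    of [winds_unique]. *)
Definition lifts (f : R -> C) (a b : R) (al : R -> R) : Prop :=
  forall x, a <= x <= b -> continuity_pt al x /\ f x = (Cmod (f x) * cis (al x))%C.

Definition winds (f : R -> C) (a b : R) (n : R) : Prop :=
  exists al, lifts f a b al /\ al b - al a = 2 * PI * n.

Lemma cis_1_inv (x : R) : cis x = 1 -> cos x = 1 /\ sin x = 0.
Proof. intros H; injection H; auto. Qed.

Lemma lift_of_1_const (d : R -> R) (a b : R) : a <= b ->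
  (forall x, a <= x <= b -> continuity_pt d x /\ cis (d x) = 1) -> ~ d a < d b.
Proof.
intros Hab H Hlt.
(* By the intermediate value theorem [d] would take the value d a + y; since 0 < y <= pi, where cos
   is already below 1, this contradicts e^(i d) = 1. *)
set (y := Rmin PI ((d b - d a) / 2)).
assert (HPI := PI_RGT_0).
assert (Hy0 : 0 < y) by (apply Rmin_glb_lt; lra).
assert (Hy1 : y <= PI) by apply Rmin_l.
assert (Hy2 : y <= (d b - d a) / 2) by apply Rmin_r.
destruct (Req_dec a b) as [E|E]; [subst; lra|].
destruct (IVT_interv (fun x => d x - (d a + y)) a b) as [c [Hc Ec]]; try lra.
- intros z Hz; apply continuity_pt_minus; [apply H, Hz|].
  apply continuity_pt_const; intros u v; reflexivity.
- destruct (H c Hc) as [_ H1]; destruct (H a ltac:(lra)) as [_ H2].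
  replace (d c) with (d a + y) in H1 by lra.
  rewrite cis_plus, H2, Cmult_1_l in H1; apply cis_1_inv in H1.
  assert (H3 := cos_decreasing_1 0 y); rewrite cos_0 in H3; lra.
Qed.

(** The difference of two lifts is continuous with values in the multiples of 2 pi, so it can
    neither increase nor decrease. *)
Lemma winds_unique (f : R -> C) (a b : R) (al be : R -> R) : a <= b ->
  (forall x, a <= x <= b -> f x <> 0) -> lifts f a b al -> lifts f a b be ->
  al b - al a = be b - be a.
Proof.
intros Hab Hf Ha Hb.
assert (G : forall al be, lifts f a b al -> lifts f a b be ->
  ~ al b - al a > be b - be a).
{ clear al be Ha Hb; intros al be Ha Hb Hgt.
  apply (lift_of_1_const (fun x => al x - be x) a b Hab); [|lra].
  intros x Hx; destruct (Ha x Hx) as [C1 E1]; destruct (Hb x Hx) as [C2 E2]; split.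
  - apply continuity_pt_minus; auto.
  - specialize (Hf x Hx); apply Cmod_gt_0 in Hf.
    assert (E : cis (al x) = cis (be x)).
    { assert (Hz : RtoC (Cmod (f x)) <> 0) by (apply RtoC_neq; lra).
      transitivity (f x / Cmod (f x))%C; [rewrite E1 at 1|rewrite E2 at 1];
      field_simplify; auto. }
    unfold Rminus; rewrite cis_plus, E, <- cis_plus, Rplus_opp_r; apply cis_0. }
assert (G1 := G al be Ha Hb); assert (G2 := G be al Hb Ha); lra.
Qed.

(** * Zeros of a power series in a disc *)

Lemma winds_mult (f g : R -> C) (a b m n : R) :
  winds f a b m -> winds g a b n -> winds (fun x => f x * g x)%C a b (m + n).
Proof.
intros [al [Ha Ea]] [be [Hb Eb]]; exists (fun x => al x + be x); split; [|lra].
intros x Hx; destruct (Ha x Hx) as [C1 E1]; destruct (Hb x Hx) as [C2 E2]; split.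
- apply continuity_pt_plus; auto.
- rewrite E1 at 1; rewrite E2 at 1; rewrite cis_plus, Cmod_mult, RtoC_mult; ring.
Qed.

Lemma winds_ext (f g : R -> C) (a b n : R) :
  (forall x, f x = g x) -> winds f a b n -> winds g a b n.
Proof.
intros E [al [Ha Ea]]; exists al; split; auto.
intros x Hx; destruct (Ha x Hx); rewrite <- E; auto.
Qed.

Lemma winds_const (c : C) (a b : R) : winds (fun _ => c) a b 0.
Proof.
destruct (polar c) as [t Ht]; exists (fun _ => t); split; [|lra].
intros x _; split; auto; apply continuity_pt_const; intros u v; reflexivity.
Qed.

Lemma Re_mult_conj_pos (w z : C) : Cmod (w - z) < Cmod z -> 0 < Re (w * Cconj z).
Proof.
intros H.
assert (Hz := Cmod_ge_0 (w - z)).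
assert (E : Re (w * Cconj z) = Cmod z ^ 2 + Re ((w - z) * Cconj z)).
{ rewrite Cmod2_alt; destruct w as [a b], z as [c d]; simpl; ring. }
assert (Hb := re_le_Cmod ((w - z) * Cconj z)).
rewrite Cmod_mult, Cmod_conj in Hb; apply Rabs_le_between in Hb.
rewrite E; nra.
Qed.

(** Rouché's argument for closed paths: f / g stays in the right half plane, so its principal
    argument is a continuous correction with equal values at both ends. *)
Lemma winds_near (f g : R -> C) (a b n : R) :
  (forall x, a <= x <= b -> fcont f x /\ fcont g x /\ Cmod (f x - g x) < Cmod (g x)) ->
  f a = f b -> g a = g b -> winds g a b n -> winds f a b n.
Proof.
intros H Ef Eg [al [Ha Ea]].
set (h := fun x => (f x * Cconj (g x))%C).
exists (fun x => al x + atan (Im (h x) / Re (h x))); split.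
- intros x Hx; destruct (H x Hx) as [Cf [Cg Hfg]]; destruct (Ha x Hx) as [Ca Eax].
  assert (Hh := Re_mult_conj_pos _ _ Hfg); fold (h x) in Hh.
  split.
  + apply continuity_pt_plus; auto; apply fcont_atan; auto.
    apply fcont_mult; auto; apply fcont_conj; auto.
  + rewrite cis_plus.
    assert (Hp := polar_of_Re_pos _ Hh).
    set (c := cis (atan (Im (h x) / Re (h x)))) in *.
    unfold h in Hp; rewrite Cmod_mult, Cmod_conj, RtoC_mult in Hp.
    assert (Hg : Cmod (g x) <> 0) by (assert (H0 := Cmod_ge_0 (f x - g x)); lra).
    assert (Hg' := RtoC_neq _ Hg).
    rewrite Eax in Hp at 1.
    rewrite Cmult_conj in Hp.
    replace (Cconj (Cmod (g x))) with (RtoC (Cmod (g x))) in Hp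
      by (unfold Cconj, RtoC; simpl; f_equal; ring).
    assert (E1 : (Cconj (cis (al x)) * cis (al x) = 1)%C).
    { rewrite <- cis_opp, <- cis_plus, Rplus_opp_l; apply cis_0. }
    transitivity (f x * (Cconj (cis (al x)) * cis (al x)))%C; [rewrite E1; ring|].
    transitivity ((f x * (Cmod (g x) * Cconj (cis (al x)))) / Cmod (g x) * cis (al x))%C.
    { field; auto. }
    rewrite Hp; field; auto.
- assert (E : h a = h b) by (unfold h; rewrite Ef, Eg; reflexivity).
  rewrite E; lra.
Qed.

(** The parameter [x] is Re tau: the circle is the image of a horizontal segment -1/2 <= Re tau <=
    1/2, and its ends meet on the negative axis. *)
Definition circ (r x : R) : C := (r * cis (2 * PI * x))%C.

Lemma Cmod_circ (r x : R) : 0 <= r -> Cmod (circ r x) = r.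
Proof. apply Cmod_scal_cis. Qed.

Lemma circ_ends (r : R) : circ r (- (1 / 2)) = circ r (1 / 2).
Proof.
unfold circ; replace (2 * PI * - (1 / 2)) with (- PI) by lra.
replace (2 * PI * (1 / 2)) with PI by lra.
rewrite cis_opp, cis_PI; f_equal; unfold Cconj, Copp, RtoC; simpl; f_equal; ring.
Qed.

Lemma circ_lip (r s R0 x y : R) : 0 <= r <= R0 -> 0 <= s <= R0 ->
  Cmod (circ r x - circ s y) <= Rabs (r - s) + 4 * PI * R0 * Rabs (x - y).
Proof.
intros Hr Hs; unfold circ.
replace (r * cis (2 * PI * x) - s * cis (2 * PI * y))%C with
  (RtoC (r - s) * cis (2 * PI * x) + s * (cis (2 * PI * x) - cis (2 * PI * y)))%C
  by (rewrite RtoC_minus; ring).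
eapply Rle_trans; [apply Cmod_triangle|].
rewrite !Cmod_mult, !Cmod_R, Cmod_cis, Rmult_1_r, (Rabs_pos_eq s) by lra.
apply Rplus_le_compat_l.
assert (H := cis_lip (2 * PI * x) (2 * PI * y)).
assert (HPI := PI_RGT_0).
replace (2 * PI * x - 2 * PI * y) with ((2 * PI) * (x - y)) in H by ring.
rewrite Rabs_mult, (Rabs_pos_eq (2 * PI)) in H by lra.
assert (Hc := Cmod_ge_0 (cis (2 * PI * x) - cis (2 * PI * y))).
apply Rle_trans with (R0 * (2 * (2 * PI * Rabs (x - y)))); [|lra].
apply Rmult_le_compat; lra.
Qed.

Lemma circ_cont (r x : R) : 0 <= r -> fcont (circ r) x.
Proof.
intros Hr; assert (HPI := PI_RGT_0); apply (fcont_lip _ _ (4 * PI * r)).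
- apply Rmult_le_pos; lra.
- intros y; assert (H := circ_lip r r r y x).
  rewrite Rminus_diag, Rabs_R0 in H; lra.
Qed.

Lemma winds_circ (r : R) : 0 < r -> winds (circ r) (- (1 / 2)) (1 / 2) 1.
Proof.
intros Hr; exists (fun x => 2 * PI * x); split; [|field].
intros x _; split.
- apply continuity_pt_mult; [apply continuity_pt_const; intros u v; reflexivity|].
  apply derivable_continuous_pt, derivable_pt_id.
- rewrite Cmod_circ by lra; reflexivity.
Qed.

Lemma fcont_minus_const (f : R -> C) (c : C) (x : R) :
  fcont f x -> fcont (fun y => f y - c)%C x.
Proof.
intros [F1 F2]; split.
- apply (continuity_pt_ext (fun y => Re (f y) - Re c)).
  { intros y; unfold Cminus; rewrite re_plus, re_opp; ring. }
  apply continuity_pt_minus; auto; apply continuity_pt_const; intros u v; reflexivity.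
- apply (continuity_pt_ext (fun y => Im (f y) - Im c)).
  { intros y; unfold Cminus; rewrite im_plus, im_opp; ring. }
  apply continuity_pt_minus; auto; apply continuity_pt_const; intros u v; reflexivity.
Qed.

Lemma winds_linear (r : R) (g : C) : Cmod g < r ->
  winds (fun x => circ r x - g)%C (- (1 / 2)) (1 / 2) 1.
Proof.
intros Hg; assert (H0 := Cmod_ge_0 g).
apply (winds_near _ (circ r)); [| | |apply winds_circ; lra].
- intros x _; assert (Hc := circ_cont r x ltac:(lra)); repeat split; auto.
  + apply fcont_minus_const, Hc.
  + apply fcont_minus_const, Hc.
  + apply Hc.
  + apply Hc.
  + replace (circ r x - g - circ r x)%C with (- g)%C by ring.
    rewrite Cmod_opp, Cmod_circ; lra.
- rewrite circ_ends; reflexivity.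
- apply circ_ends.
Qed.

Lemma PS_circ_lip (K rho R0 : R) (a : nat -> C) :
  geo K rho a -> 0 < rho -> 0 < R0 -> rho * R0 < 1 ->
  exists L, 0 < L /\ forall r s x y, 0 <= r <= R0 -> 0 <= s <= R0 ->
    Cmod (PS a (circ r x) - PS a (circ s y)) <= L * (Rabs (r - s) + Rabs (x - y)).
Proof.
intros Ha Hrho HR H1; assert (HPI := PI_RGT_0); assert (HK := geo_pos _ _ _ Ha).
set (L0 := K * rho / (1 - rho * R0) ^ 2).
assert (HL0 : 0 <= L0).
{ apply Rmult_le_pos; [apply Rmult_le_pos; lra|]; left; apply Rinv_0_lt_compat, pow_lt; lra. }
exists (L0 * (1 + 4 * PI * R0) + 1).
assert (H4 : 0 <= 4 * PI * R0) by (apply Rmult_le_pos; lra).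
split; [assert (0 <= L0 * (1 + 4 * PI * R0)) by (apply Rmult_le_pos; lra); lra|].
intros r s x y Hr Hs.
assert (Hl := PS_lip K rho R0 a (circ s y) (circ r x) Ha Hrho H1).
rewrite !Cmod_circ in Hl by lra; specialize (Hl ltac:(lra) ltac:(lra)).
assert (Hc := circ_lip r s R0 x y Hr Hs).
assert (P1 := Rabs_pos (r - s)); assert (P2 := Rabs_pos (x - y)).
fold L0 in Hl; eapply Rle_trans; [exact Hl|].
apply Rle_trans with (L0 * (Rabs (r - s) + 4 * PI * R0 * Rabs (x - y))).
{ apply Rmult_le_compat_l; auto. }
apply Rle_trans with (L0 * ((1 + 4 * PI * R0) * (Rabs (r - s) + Rabs (x - y)))).
{ apply Rmult_le_compat_l; auto.
  assert (0 <= 4 * PI * R0 * Rabs (r - s)) by (apply Rmult_le_pos; auto); lra. }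
lra.
Qed.

Lemma PS_circ_cont (K rho r x : R) (a : nat -> C) :
  geo K rho a -> 0 < rho -> 0 < r -> rho * r < 1 -> fcont (fun y => PS a (circ r y)) x.
Proof.
intros Ha Hrho Hr H1; destruct (PS_circ_lip K rho r a Ha Hrho Hr H1) as [L [HL H]].
apply (fcont_lip _ _ L); [lra|]; intros y; specialize (H r r y x ltac:(lra) ltac:(lra)).
rewrite Rminus_diag, Rabs_R0 in H; lra.
Qed.

(** Positive minimum on a compact rectangle, by covering: cells of size |value| / (4 L) let the
    modulus drop by at most one half. *)
Lemma PS_lower_bound (K rho R0 : R) (a : nat -> C) :
  geo K rho a -> 0 < rho -> 0 < R0 -> rho * R0 < 1 ->
  (forall q, Cmod q <= R0 -> PS a q <> 0) ->
  exists m, 0 < m /\ forall r x, 0 <= r <= R0 -> - (1 / 2) <= x <= 1 / 2 ->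
    m <= Cmod (PS a (circ r x)).
Proof.
intros Ha Hrho HR H1 Hnz.
destruct (PS_circ_lip K rho R0 a Ha Hrho HR H1) as [L [HL HLip]].
set (F := fun r x => Cmod (PS a (circ r x))).
assert (HF : forall r x, 0 <= r <= R0 -> 0 < F r x).
{ intros r x Hr; apply Cmod_gt_0, Hnz; rewrite Cmod_circ; lra. }
(* The default 1 is never met on the rectangle, where [F] is positive. *)
set (d := fun r x => match Rlt_dec 0 (F r x / (4 * L)) with
  | left H => mkposreal _ H | right _ => mkposreal 1 Rlt_0_1 end).
destruct (compactness_value_2d 0 R0 (- (1 / 2)) (1 / 2) d) as [e He].
exists (2 * L * e); split; [apply Rmult_lt_0_compat; [lra|apply e]|].
intros r x Hr Hx; apply Rnot_lt_le; intros Hlt.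
apply (He r x Hr Hx); intros [u [v [Hu [Hv [H2 [H3 H4]]]]]].
assert (Hd : pos (d u v) = F u v / (4 * L)).
{ unfold d; destruct (Rlt_dec 0 (F u v / (4 * L))) as [|n]; [reflexivity|].
  exfalso; apply n, Rdiv_lt_0_compat; [apply HF, Hu|lra]. }
rewrite Hd in *.
assert (H5 := HLip u r v x Hu Hr).
rewrite (Rabs_minus_sym u), (Rabs_minus_sym v) in H5.
assert (H6 : L * (Rabs (r - u) + Rabs (x - v)) <= F u v / 2).
{ apply Rle_trans with (L * (F u v / (4 * L) + F u v / (4 * L))).
  - apply Rmult_le_compat_l; lra.
  - right; field; lra. }
assert (H7 := Cmod_triangle_rev (PS a (circ u v)) (- (PS a (circ u v) - PS a (circ r x)))).
rewrite Cmod_opp in H7.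
replace (PS a (circ u v) + - (PS a (circ u v) - PS a (circ r x)))%C with
  (PS a (circ r x)) in H7 by ring.
fold (F u v) in H7.
assert (H8 : 2 * L * e <= F u v / 2).
{ apply Rle_trans with (2 * L * (F u v / (4 * L))).
  - apply Rmult_le_compat_l; lra.
  - right; field; lra. }
lra.
Qed.

(* Homotopy in the radius: on circles of nearby radii the values differ by less than their modulus. *)
Lemma winds_PS_nonvanishing (K rho R0 : R) (a : nat -> C) :
  geo K rho a -> 0 < rho -> 0 < R0 -> rho * R0 < 1 ->
  (forall q, Cmod q <= R0 -> PS a q <> 0) ->
  winds (fun x => PS a (circ R0 x)) (- (1 / 2)) (1 / 2) 0.
Proof.
intros Ha Hrho HR H1 Hnz.
destruct (PS_circ_lip K rho R0 a Ha Hrho HR H1) as [L [HL HLip]].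
destruct (PS_lower_bound K rho R0 a Ha Hrho HR H1 Hnz) as [m [Hm Hlow]].
(* With [n] equal steps from radius 0 to [R0], each step moves the values by at most L R0 / n < m,
   hence by less than their modulus. *)
destruct (archimed_cor1 (m / (L * R0))) as [n [Hn Hn0]].
{ apply Rdiv_lt_0_compat; auto; apply Rmult_lt_0_compat; auto. }
assert (HnR : 0 < INR n) by (apply lt_0_INR; lia).
assert (Hstep : L * (R0 * / INR n) < m).
{ apply Rmult_lt_reg_r with (/ (L * R0)).
  - apply Rinv_0_lt_compat, Rmult_lt_0_compat; auto.
  - replace (L * (R0 * / INR n) * / (L * R0)) with (/ INR n) by (field; lra); exact Hn. }
assert (Hcont : forall r, 0 <= r <= R0 -> forall x, fcont (fun y => PS a (circ r y)) x).
{ intros r Hr x; apply (fcont_lip _ _ L); [lra|]; intros y.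
  specialize (HLip r r y x Hr Hr); rewrite Rminus_diag, Rabs_R0 in HLip; lra. }
set (r := fun i : nat => R0 * (INR i * / INR n)).
assert (Hr : forall i, (i <= n)%nat -> 0 <= r i <= R0).
{ intros i Hi; unfold r; assert (Hi' := le_INR _ _ Hi); assert (H0 := pos_INR i).
  assert (Hinv : 0 < / INR n) by (apply Rinv_0_lt_compat; auto).
  assert (H3 : 0 <= INR i * / INR n) by (apply Rmult_le_pos; lra).
  assert (H4 : INR i * / INR n <= INR n * / INR n) by (apply Rmult_le_compat_r; lra).
  rewrite Rinv_r in H4 by lra; split; [apply Rmult_le_pos; lra|].
  rewrite <- (Rmult_1_r R0) at 2; apply Rmult_le_compat_l; lra. }
assert (G : forall i, (i <= n)%nat ->
  winds (fun x => PS a (circ (r i) x)) (- (1 / 2)) (1 / 2) 0).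
{ induction i as [|i IH]; intros Hi.
  - apply (winds_ext (fun _ => PS a 0)); [|apply winds_const].
    intros x; unfold r, circ; simpl INR.
    rewrite Rmult_0_l, Rmult_0_r, Cmult_0_l; reflexivity.
  - apply (winds_near _ (fun x => PS a (circ (r i) x))); [| | |apply IH; lia].
    + intros x Hx.
      assert (Hi1 := Hr i ltac:(lia)); assert (Hi2 := Hr (S i) Hi).
      split; [apply Hcont, Hi2|]; split; [apply Hcont, Hi1|].
      eapply Rle_lt_trans; [apply HLip; auto|].
      eapply Rlt_le_trans; [|apply Hlow; auto].
      rewrite Rminus_diag, Rabs_R0, Rplus_0_r.
      replace (r (S i) - r i) with (R0 * / INR n) by (unfold r; rewrite S_INR; ring).
      rewrite Rabs_pos_eq; auto.
      apply Rmult_le_pos; [lra|left; apply Rinv_0_lt_compat; auto].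
    + rewrite circ_ends; reflexivity.
    + rewrite circ_ends; reflexivity. }
specialize (G n (Nat.le_refl n)).
unfold r in G; rewrite Rinv_r, Rmult_1_r in G by lra; exact G.
Qed.

Fixpoint lin_prod (l : list C) (q : C) : C :=
  match l with nil => 1 | g :: l' => (q - g) * lin_prod l' q end%C.

Lemma lin_prod_nz (l : list C) (q : C) : ~ In q l -> lin_prod l q <> 0.
Proof.
induction l as [|g l IH]; simpl; intros H.
- apply C1_nz.
- apply Cmult_neq_0; [|apply IH; tauto].
  intros E; apply H; left; symmetry; apply Ceq_minus, E.
Qed.

(* Each division by q - g multiplies the coefficient bound by at most rho/(1 - rho R0) < 1/R0, while
   |a_0| <= R0^n |b_0|; hence at most finitely many divisions are possible. *)
Lemma PS_factor_zeros (K rho R0 : R) (a : nat -> C) :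
  geo K rho a -> 0 < rho -> 0 < R0 -> 2 * rho * R0 < 1 -> a 0%nat <> 0 ->
  exists l b K', geo K' rho b /\ (forall g, In g l -> Cmod g <= R0) /\
    (forall q, rho * Cmod q < 1 -> PS a q = (lin_prod l q * PS b q)%C) /\
    (forall q, Cmod q <= R0 -> PS b q <> 0).
Proof.
intros Ha Hrho HR H1 Ha0; assert (HK := geo_pos _ _ _ Ha).
assert (HrR : 0 < rho * R0) by (apply Rmult_lt_0_compat; auto).
set (c := rho / (1 - rho * R0)).
assert (Hc : 0 < c) by (apply Rdiv_lt_0_compat; lra).
set (P := fun n l b => length l = n /\ geo (K * c ^ n) rho b /\
  (forall g, In g l -> Cmod g <= R0) /\
  (forall q, rho * Cmod q < 1 -> PS a q = (lin_prod l q * PS b q)%C)).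
assert (Hb : forall n l b, P n l b -> Cmod (a 0%nat) <= K * (c * R0) ^ n).
{ intros n l b [Hl [Hg [Hin HP]]].
  assert (H0 : rho * Cmod 0 < 1) by (rewrite Cmod_0; lra).
  specialize (HP 0 H0); rewrite !PS_0 in HP; rewrite HP, Cmod_mult.
  assert (Hlp : forall l, (forall g, In g l -> Cmod g <= R0) ->
    Cmod (lin_prod l 0) <= R0 ^ length l).
  { clear; induction l as [|g l IH]; intros H; simpl; [rewrite Cmod_1; lra|].
    rewrite Cmod_mult; apply Rmult_le_compat; try apply Cmod_ge_0.
    - replace (0 - g)%C with (- g)%C by ring; rewrite Cmod_opp; apply H; left; auto.
    - apply IH; intros; apply H; right; auto. }
  specialize (Hlp l Hin); rewrite Hl in Hlp.
  specialize (Hg 0%nat); simpl in Hg; rewrite Rmult_1_r in Hg.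
  rewrite Rpow_mult_distr.
  replace (K * (c ^ n * R0 ^ n)) with (R0 ^ n * (K * c ^ n)) by ring.
  apply Rmult_le_compat; auto; apply Cmod_ge_0. }
assert (Hext : forall n l b, P n l b -> (forall q, Cmod q <= R0 -> PS b q <> 0) \/
  exists l' b', P (S n) l' b').
{ intros n l b [Hl [Hg [Hin HP]]].
  destruct (classic (exists g, Cmod g <= R0 /\ PS b g = 0)) as [[g [Hg1 Hg2]]|Hno].
  2: { left; intros q Hq E; apply Hno; exists q; auto. }
  right; exists (g :: l), (quot b g).
  assert (Hrg : rho * Cmod g <= rho * R0) by (apply Rmult_le_compat_l; lra).
  repeat split.
  - simpl; auto.
  - intros i; eapply Rle_trans; [apply (geo_quot _ _ _ g Hg Hrho); lra|].
    apply Rmult_le_compat_r; [apply pow_le; lra|].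
    simpl; replace (K * (c * c ^ n)) with (K * c ^ n * c) by ring.
    apply Rmult_le_compat_l; [apply Rmult_le_pos; auto; apply pow_le; lra|].
    unfold c, Rdiv; apply Rmult_le_compat_l; [lra|apply Rinv_le_contravar; lra].
  - intros g' [<-|H]; auto.
  - intros q Hq; rewrite (HP q Hq); simpl.
    rewrite (PS_factor _ _ b g q Hg Hrho ltac:(lra) Hq), Hg2; ring. }
assert (Hth : 0 <= c * R0 < 1).
{ split; [apply Rmult_le_pos; lra|].
  unfold c; apply Rmult_lt_reg_r with (1 - rho * R0); [lra|].
  replace (rho / (1 - rho * R0) * R0 * (1 - rho * R0)) with (rho * R0) by (field; lra); lra. }
destruct (lim0_scal K _ (pow_lim0 _ Hth) (fun y => y < Cmod (a 0%nat))) as [N HN].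
{ exists (mkposreal _ (proj1 (Cmod_gt_0 _) Ha0)); intros y Hy.
  change (Rabs (y - 0) < Cmod (a 0%nat)) in Hy; apply Rabs_lt_between in Hy; lra. }
(* The fuel [m] counts the divisions still possible: after [N] of them the bound on |a_0| is
   contradicted. *)
assert (Hfuel : forall m n l b, (N <= n + m)%nat -> P n l b -> exists l' b' n',
  P n' l' b' /\ (forall q, Cmod q <= R0 -> PS b' q <> 0)).
{ induction m as [|m IH]; intros n l b Hnm HP.
  - exfalso; specialize (Hb _ _ _ HP); specialize (HN n ltac:(lia)); lra.
  - destruct (Hext _ _ _ HP) as [H|[l' [b' H]]]; [exists l, b, n; auto|].
    apply (IH (S n) l' b'); [lia|exact H]. }
destruct (Hfuel N 0%nat nil a) as [l [b [n [[_ [Hg [Hin HP]]] Hnz]]]]; [lia| |].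
- repeat split; simpl; try tauto.
  + rewrite Rmult_1_r; exact Ha.
  + intros q _; ring.
- exists l, b, (K * c ^ n); auto.
Qed.

Lemma lin_prod_winds (l : list C) (r : R) : (forall g, In g l -> Cmod g < r) ->
  winds (fun x => lin_prod l (circ r x)) (- (1 / 2)) (1 / 2) (INR (length l)).
Proof.
induction l as [|g l IH]; intros H.
- exact (winds_const 1 _ _).
- change (length (g :: l)) with (S (length l)).
  rewrite S_INR, Rplus_comm; simpl lin_prod; apply winds_mult.
  + apply winds_linear, H; left; auto.
  + apply IH; intros; apply H; right; auto.
Qed.

(** An argument principle without integrals: after all zeros are divided out, the linear factors
    wind once each and the nonvanishing rest does not wind. Integrality then allows an error of less
    than one turn in the total argument. *)
Lemma zero_count (K rho R0 : R) (a : nat -> C) (al : R -> R) (W : nat) :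
  geo K rho a -> 0 < rho -> 0 < R0 -> 2 * rho * R0 < 1 -> a 0%nat <> 0 ->
  (forall x, - (1 / 2) <= x <= 1 / 2 -> PS a (circ R0 x) <> 0) ->
  lifts (fun x => PS a (circ R0 x)) (- (1 / 2)) (1 / 2) al ->
  Rabs (al (1 / 2) - al (- (1 / 2)) - 2 * PI * INR W) < 2 * PI ->
  exists l b K', length l = W /\ geo K' rho b /\ (forall g, In g l -> Cmod g < R0) /\
    (forall q, rho * Cmod q < 1 -> PS a q = (lin_prod l q * PS b q)%C) /\
    (forall q, Cmod q <= R0 -> PS b q <> 0).
Proof.
intros Ha Hrho HR H1 Ha0 Hcirc Hal HW; assert (HPI := PI_RGT_0).
assert (HrR : 0 < rho * R0) by (apply Rmult_lt_0_compat; auto).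
destruct (PS_factor_zeros K rho R0 a Ha Hrho HR H1 Ha0) as [l [b [K' [Hb [Hin [HP Hnz]]]]]].
(* The factorization covers the closed disc; a zero on its boundary would contradict [Hcirc] once
   its angle is reduced to the parameter interval. *)
assert (Hin' : forall g, In g l -> Cmod g < R0).
{ intros g Hg; destruct (Rle_lt_or_eq_dec _ _ (Hin g Hg)) as [H|H]; auto; exfalso.
  destruct (polar g) as [t Ht].
  assert (Hx : exists x, - (1 / 2) <= x <= 1 / 2 /\ cis (2 * PI * x) = cis t).
  { clear - HPI.
    (* The subtracted integer is the nearest one to t / (2 pi), up to ties. *)
    set (z := t / (2 * PI) - IZR (up (t / (2 * PI) - 1 / 2))).
    destruct (archimed (t / (2 * PI) - 1 / 2)) as [A1 A2].
    assert (Hper : forall n : Z, cis (t - 2 * PI * IZR n) = cis t).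
    { intros n; destruct (Z.le_decidable 0 n) as [Hn|Hn].
      - rewrite <- (Z2Nat.id n Hn), <- INR_IZR_INZ.
        rewrite <- (cis_2PI _ (Z.to_nat n)); f_equal; ring.
      - rewrite <- (cis_2PI t (Z.to_nat (- n))); f_equal.
        rewrite INR_IZR_INZ, Z2Nat.id, opp_IZR by lia; ring. }
    exists z; split; [unfold z; lra|].
    rewrite <- (Hper (up (t / (2 * PI) - 1 / 2))); f_equal; unfold z; field; lra. }
  destruct Hx as [x [Hx Ex]]; apply (Hcirc x Hx).
  assert (Eg : circ R0 x = g) by (unfold circ; rewrite Ex, <- H; symmetry; exact Ht).
  rewrite Eg, HP by (rewrite H; lra).
  assert (Hz : lin_prod l g = 0).
  { clear - Hg; induction l as [|h l IH]; [destruct Hg|]; simpl.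
    destruct Hg as [->|Hg]; [|rewrite IH by auto]; ring. }
  rewrite Hz; ring. }
exists l, b, K'; repeat split; auto.
assert (Hw : winds (fun x => PS a (circ R0 x)) (- (1 / 2)) (1 / 2) (INR (length l) + 0)).
{ apply (winds_ext (fun x => lin_prod l (circ R0 x) * PS b (circ R0 x))%C).
  - intros x; symmetry; apply HP; rewrite Cmod_circ; lra.
  - apply winds_mult; [apply lin_prod_winds; auto|].
    apply (winds_PS_nonvanishing K' rho); auto; try lra. }
destruct Hw as [be [Hbe Ebe]].
assert (Hle : - (1 / 2) <= 1 / 2) by lra.
assert (E := winds_unique _ _ _ al be Hle Hcirc Hal Hbe).
rewrite Rplus_0_r in Ebe; rewrite E, Ebe in HW.
replace (2 * PI * INR (length l) - 2 * PI * INR W) with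
  ((2 * PI) * (INR (length l) - INR W)) in HW by ring.
rewrite Rabs_mult, (Rabs_pos_eq (2 * PI)) in HW by lra.
assert (H2 : Rabs (INR (length l) - INR W) < 1).
{ apply Rmult_lt_reg_l with (2 * PI); lra. }
rewrite !INR_IZR_INZ, <- minus_IZR in H2; apply Rabs_lt_between in H2.
destruct H2 as [H2 H3]; change (- (1)) with (IZR (-1)) in H2; apply lt_IZR in H2.
change 1 with (IZR 1) in H3; apply lt_IZR in H3; lia.
Qed.

(** * The polylogarithms of negative integer order *)

(* Li_{-d} *)
Definition pl (d : nat) (q : C) : C := PS (fun m => RtoC (INR m ^ d)) q.

Lemma radius_exists (x : R) : 0 <= x < 1 -> exists r, 1 < r /\ r * x < 1.
Proof.
(* The reciprocal of the midpoint of [x] and 1. *)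
intros Hx; exists (2 / (1 + x)); split.
- apply Rmult_lt_reg_r with (1 + x); [lra|]; field_simplify; lra.
- replace (2 / (1 + x) * x) with (2 * x / (1 + x)) by (field; lra).
  apply Rmult_lt_reg_r with (1 + x); [lra|]; field_simplify; lra.
Qed.

Lemma nat_pow_geo (d : nat) (r : R) : 1 < r ->
  exists K, geo K r (fun m => RtoC (INR m ^ d)).
Proof.
intros Hr; destruct (poly_le_geom d r Hr) as [K [_ HK]]; exists K.
intros m; rewrite Cmod_R, Rabs_pos_eq; [apply HK|apply pow_le, pos_INR].
Qed.

Lemma pl_Ccv (d : nat) (q : C) : Cmod q < 1 ->
  Ccv (csum (fun m => RtoC (INR m ^ d) * q ^ m)%C) (pl d q).
Proof.
intros Hq; destruct (radius_exists (Cmod q)) as [r [Hr Hrq]].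
{ split; auto; apply Cmod_ge_0. }
destruct (nat_pow_geo d r Hr) as [K HK].
apply (PS_Ccv K r _ q HK); lra.
Qed.

(* multichoose j m = binom(m + j, j), the coefficients of (1 - q)^-(j+1) *)
Fixpoint multichoose (j m : nat) : R :=
  match j with
  | O => 1
  | S i => (fix T m := match m with O => 1 | S p => T p + multichoose i (S p) end) m
  end.

Lemma multichoose_SS (j m : nat) :
  multichoose (S j) (S m) = multichoose (S j) m + multichoose j (S m).
Proof. reflexivity. Qed.

Lemma multichoose_0_r (j : nat) : multichoose j 0 = 1.
Proof. destruct j; reflexivity. Qed.

(** The two absorption identities are proved together: at each [j] the second gives the first by
    induction on [m], and both at [j] give the second at [S j]. *)
Lemma multichoose_absorb (j : nat) :
  (forall m, INR (S j) * multichoose (S j) m = INR (S (m + j)) * multichoose j m) /\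
  (forall m, INR (S m) * multichoose j (S m) = INR (S (m + j)) * multichoose j m).
Proof.
assert (HQ : forall j,
  (forall m, INR (S m) * multichoose j (S m) = INR (S (m + j)) * multichoose j m) ->
  forall m, INR (S j) * multichoose (S j) m = INR (S (m + j)) * multichoose j m).
{ clear j; intros j HR; induction m as [|m IH].
  - rewrite !multichoose_0_r; reflexivity.
  - rewrite multichoose_SS, Rmult_plus_distr_l, IH, <- (HR m).
    simpl plus; rewrite !S_INR, plus_INR, ?S_INR; ring. }
induction j as [|j [IQ IR]].
- split; [apply HQ|]; intros m; simpl multichoose; rewrite Nat.add_0_r; ring.
- assert (HR : forall m, INR (S m) * multichoose (S j) (S m) = INR (S (m + S j)) * multichoose (S j) m).
  { intros m; rewrite multichoose_SS, Rmult_plus_distr_l, IR, <- IQ.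
    replace (m + S j)%nat with (S (m + j)) by lia; rewrite !S_INR, plus_INR, ?S_INR; ring. }
  split; auto.
Qed.

Lemma multichoose_bound (j m : nat) : 0 <= multichoose j m <= INR (S m) ^ j.
Proof.
revert m; induction j as [|j IH]; intros m; [simpl; lra|].
induction m as [|m IHm].
- rewrite multichoose_0_r; simpl INR; rewrite pow1; lra.
- rewrite multichoose_SS; specialize (IH (S m)).
  assert (H : INR (S m) ^ S j <= INR (S m) * INR (S (S m)) ^ j).
  { change (INR (S m) ^ S j) with (INR (S m) * INR (S m) ^ j).
    apply Rmult_le_compat_l; [apply pos_INR|].
    apply pow_incr; split; [apply pos_INR|apply le_INR; lia]. }
  split; [lra|].
  replace (INR (S (S m)) ^ S j) with (INR (S m) * INR (S (S m)) ^ j + INR (S (S m)) ^ j)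
    by (rewrite (S_INR (S m)), <- tech_pow_Rmult; ring).
  lra.
Qed.

Lemma multichoose_geo (j : nat) (r : R) : 1 < r ->
  exists K, geo K r (fun m => RtoC (multichoose j m)).
Proof.
intros Hr; destruct (poly_le_geom j r Hr) as [K [HK0 HK]]; exists (K * r).
intros m; destruct (multichoose_bound j m) as [H1 H2].
rewrite Cmod_R, Rabs_pos_eq by auto.
rewrite Rmult_assoc; eapply Rle_trans; [exact H2|apply (HK (S m))].
Qed.

Lemma PS_ext (a b : nat -> C) (q : C) : (forall n, a n = b n) -> PS a q = PS b q.
Proof.
intros E; unfold PS; f_equal; apply FunctionalExtensionality.functional_extensionality.
intros n; now rewrite E.
Qed.

Lemma PS_plus (K1 K2 r : R) (a b : nat -> C) (q : C) :
  geo K1 r a -> geo K2 r b -> 0 < r -> r * Cmod q < 1 ->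
  PS (fun n => a n + b n)%C q = (PS a q + PS b q)%C.
Proof.
intros Ha Hb Hr Hq; apply PS_unique.
destruct (PS_Ccv _ _ _ _ Ha Hr Hq) as [H1 _]; destruct (PS_Ccv _ _ _ _ Hb Hr Hq) as [H2 _].
eapply Ccv_ext; [|exact (Ccv_plus _ _ _ _ H1 H2)].
intros n; simpl; rewrite <- csum_plus; apply csum_ext; intros; ring.
Qed.

(** Pascal's rule for the coefficients says that multiplication by 1 - q lowers [j] by one in the
    generating function. *)
Lemma multichoose_series (j : nat) (q : C) : Cmod q < 1 ->
  PS (fun m => RtoC (multichoose j m)) q = (/ (1 - q) ^ S j)%C.
Proof.
intros Hq.
assert (Hq1 : (1 - q)%C <> 0).
{ intros E; apply Ceq_minus in E; rewrite <- E, Cmod_1 in Hq; lra. }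
destruct (radius_exists (Cmod q)) as [r [Hr Hrq]].
{ split; auto; apply Cmod_ge_0. }
assert (Hr0 : 0 < r) by lra.
assert (G : forall j, exists K, geo K r (fun m => RtoC (multichoose j m))).
{ intros i; apply multichoose_geo, Hr. }
induction j as [|j IH].
- destruct (G 0%nat) as [K HK].
  assert (E := PS_head _ _ _ _ HK Hr0 Hrq); simpl multichoose in *.
  set (x := PS _ q) in *.
  assert (Hx : x = (((1 - q) * x) / (1 - q))%C) by (field; auto).
  assert (Ex : ((1 - q) * x = 1)%C) by (transitivity (x - q * x)%C; [ring|rewrite E at 1; simpl; ring]).
  rewrite Hx, Ex; simpl; field; auto.
- destruct (G j) as [K HK]; destruct (G (S j)) as [K' HK'].
  assert (Eh : forall i K, geo K r (fun m => RtoC (multichoose i m)) ->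
    PS (fun m => RtoC (multichoose i m)) q = (1 + q * PS (fun m => RtoC (multichoose i (S m))) q)%C).
  { intros i K0 HK0; rewrite <- (multichoose_0_r i); exact (PS_head _ _ _ _ HK0 Hr0 Hrq). }
  assert (E := Eh j K HK); assert (E' := Eh (S j) K' HK').
  assert (E2 : PS (fun m => RtoC (multichoose (S j) (S m))) q =
    (PS (fun m => RtoC (multichoose (S j) m)) q + PS (fun m => RtoC (multichoose j (S m))) q)%C).
  { refine (eq_trans _ (PS_plus _ _ r _ _ q HK' (geo_tail _ _ _ 1 HK Hr0) Hr0 Hrq)).
    apply PS_ext; intros m; rewrite multichoose_SS, RtoC_plus; reflexivity. }
  rewrite E2 in E'.
  set (x := PS (fun m => RtoC (multichoose (S j) m)) q) in *.
  set (y := PS (fun m => RtoC (multichoose j (S m))) q) in *.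
  assert (Ex : ((1 - q) * x = 1 + q * y)%C).
  { transitivity (x - q * x)%C; [ring|rewrite E' at 1; ring]. }
  rewrite <- E, IH in Ex.
  replace x with (((1 - q) * x) / (1 - q))%C by (field; auto).
  rewrite Ex, (Cpow_S _ (S j)); field; split; auto; apply Cpow_nz; auto.
Qed.

(** Absorption gives m binom(m+j, j) = (j+1) binom(m+j+1, j+1) - (j+1) binom(m+j, j), so one more
    factor m turns c_j into j c_(j-1) - (j+1) c_j and the top coefficient d! into (d+1)!. *)
Lemma nat_pow_multichoose (d : nat) : exists c : nat -> R,
  c d = INR (fact d) /\ (forall j, (d < j)%nat -> c j = 0) /\
  forall m, INR m ^ d = rsum (fun j => c j * multichoose j m) (S d).
Proof.
induction d as [|d [c [Hd [H0 Hc]]]].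
- exists (fun j => match j with O => 1 | _ => 0 end); repeat split.
  + intros [|j] Hj; [lia|reflexivity].
  + intros m; simpl; ring.
- exists (fun j => (match j with O => 0 | S i => INR (S i) * c i end) - INR (S j) * c j).
  split; [|split].
  + rewrite (H0 (S d)), Hd by lia; rewrite fact_simpl, mult_INR; ring.
  + intros [|j] Hj; [lia|]; rewrite !H0 by lia; ring.
  + intros m; symmetry.
    rewrite (rsum_ext _ (fun j => (match j with O => 0 | S i => INR (S i) * c i end) * multichoose j m
      + (- 1) * (INR (S j) * c j * multichoose j m))) by (intros; ring).
    rewrite rsum_plus, rsum_scal.
    rewrite (rsum_shift (fun j => match j with O => 0 | S i => INR (S i) * c i end * multichoose j m)).
    assert (Elast : rsum (fun i => INR (S i) * c i * multichoose i m) (S (S d)) =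
      rsum (fun i => INR (S i) * c i * multichoose i m) (S d)).
    { change (rsum (fun i => INR (S i) * c i * multichoose i m) (S (S d))) with
       (rsum (fun i => INR (S i) * c i * multichoose i m) (S d) + INR (S (S d)) * c (S d) * multichoose (S d) m).
      rewrite (H0 (S d)) by lia; ring. }
    rewrite Elast, Rmult_0_l, Rplus_0_l, <- rsum_scal, <- rsum_plus.
    change (INR m ^ S d) with (INR m * INR m ^ d); rewrite Hc, <- rsum_scal.
    apply rsum_ext; intros i _.
    destruct (multichoose_absorb i) as [A _]; specialize (A m).
    transitivity (c i * (INR (S i) * multichoose (S i) m) - INR (S i) * c i * multichoose i m); [ring|].
    rewrite A, !S_INR, plus_INR; ring.
Qed.

(** A polynomial in 1 / (1 - q) of degree d + 1; its top coefficient d! fixes the behaviour at the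
    pole q = 1. *)
Lemma pl_rational (d : nat) : exists c : nat -> R, c d = INR (fact d) /\
  forall q, Cmod q < 1 -> pl d q = csum (fun j => c j / (1 - q) ^ S j)%C (S d).
Proof.
destruct (nat_pow_multichoose d) as [c [Hd [_ Hc]]]; exists c; split; auto.
intros q Hq.
destruct (radius_exists (Cmod q)) as [r [Hr Hrq]].
{ split; auto; apply Cmod_ge_0. }
apply PS_unique.
eapply Ccv_ext.
- intros n; symmetry.
  rewrite (csum_ext _ (fun m => csum (fun j => c j * (multichoose j m * q ^ m)) (S d))%C).
  + rewrite csum_swap; apply csum_ext; intros j _; apply csum_scal.
  + intros m _; rewrite Hc, <- csum_RtoC, Cmult_comm, <- csum_scal; apply csum_ext.
    intros j _; rewrite RtoC_mult; ring.
- generalize (S d); intros D; induction D as [|D IH]; [exact (Ccv_const 0)|].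
  simpl; apply Ccv_plus; auto; unfold Cdiv; apply Ccv_scal.
  change ((1 - q) * (1 - q) ^ D)%C with ((1 - q) ^ S D)%C.
  rewrite <- multichoose_series by auto.
  destruct (multichoose_geo D r Hr) as [K HK]; apply (PS_Ccv K r); auto; lra.
Qed.

(** * Roots of unity and the distribution relation *)

Lemma csum_multiples (f : nat -> C) (N M : nat) :
  (forall m, ~ Nat.divide (S N) m -> f m = 0) ->
  csum f (S N * M) = csum (fun i => f (S N * i)%nat) M.
Proof.
intros Hf; induction M as [|M IH]; [rewrite Nat.mul_0_r; reflexivity|].
rewrite Nat.mul_succ_r, csum_add, IH, csum_shift, Nat.add_0_r.
rewrite (csum_0 (fun i => f (S N * M + S i)%nat)); [simpl; ring|].
intros i Hi; apply Hf; intros [z Hz].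
assert (z = M \/ z < M \/ M < z)%nat as [H|[H|H]] by lia; nia.
Qed.

Lemma root_of_unity_sum (N m : nat) :
  csum (fun j => cis (2 * PI / INR (S N)) ^ (j * m))%C (S N) =
  if excluded_middle_informative (Nat.divide (S N) m) then RtoC (INR (S N)) else RtoC 0.
Proof.
assert (HPI := PI_RGT_0).
assert (HN : 0 < INR (S N)) by (apply lt_0_INR; lia).
set (w := cis (2 * PI / INR (S N) * INR m)).
assert (Ew : forall j, (cis (2 * PI / INR (S N)) ^ (j * m) = w ^ j)%C).
{ intros j; rewrite Nat.mul_comm, Cpow_mult_r; f_equal; rewrite cis_pow; unfold w; f_equal; ring. }
rewrite (csum_ext _ (fun j => w ^ j)%C) by (intros; apply Ew).
destruct (excluded_middle_informative (Nat.divide (S N) m)) as [[z Hz]|Hn].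
- assert (E : w = 1).
  { unfold w; rewrite Hz, mult_INR.
    replace (2 * PI / INR (S N) * (INR z * INR (S N))) with (0 + 2 * INR z * PI) by (field; lra).
    rewrite cis_2PI; apply cis_0. }
  rewrite E; clear; induction (S N) as [|n IH]; [reflexivity|].
  simpl csum; rewrite IH, Cpow_1_l, S_INR, RtoC_plus; reflexivity.
(* Reduce [m] to its remainder 0 < r <= N modulo N + 1: the sine of pi r / (N + 1) is positive, so
   the cosine of twice that angle is not 1. *)
- assert (Hw : w <> 1).
  { intros E; apply cis_1_inv in E; destruct E as [E1 E2].
    assert (Hm := Nat.div_mod_eq m (S N)).
    set (r := (m mod S N)%nat) in *; set (z := (m / S N)%nat) in *.
    assert (Hr : (r < S N)%nat) by (apply Nat.mod_upper_bound; lia).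
    assert (Hr0 : (0 < r)%nat).
    { destruct r; [exfalso; apply Hn; exists z; lia|lia]. }
    assert (Er : cis (2 * (PI * (INR r / INR (S N)))) = 1).
    { rewrite <- (cis_2PI _ z); transitivity w; [|unfold w, cis; rewrite E1, E2; reflexivity].
      unfold w; f_equal; rewrite Hm, plus_INR, mult_INR; field; lra. }
    apply cis_1_inv in Er; destruct Er as [Er _]; rewrite cos_2a_sin in Er.
    assert (Hs : 0 < sin (PI * (INR r / INR (S N)))).
    { assert (H1 : 0 < INR r) by (apply lt_0_INR; lia).
      assert (H2 := lt_INR _ _ Hr).
      assert (H3 : 0 < INR r / INR (S N)) by (apply Rdiv_lt_0_compat; auto).
      assert (H4 : INR r / INR (S N) < 1).
      { apply Rmult_lt_reg_r with (INR (S N)); auto; field_simplify; lra. }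
      apply sin_gt_0; [apply Rmult_lt_0_compat; auto|].
      rewrite <- (Rmult_1_r PI) at 2; apply Rmult_lt_compat_l; auto. }
    nra. }
  assert (Ewn : (w ^ S N = 1)%C).
  { unfold w; rewrite cis_pow.
    replace (INR (S N) * (2 * PI / INR (S N) * INR m)) with (0 + 2 * INR m * PI) by (field; lra).
    rewrite cis_2PI; apply cis_0. }
  assert (G : forall n, ((w - 1) * csum (fun j => w ^ j) n = w ^ n - 1)%C).
  { induction n as [|n IH]; [simpl; ring|].
    simpl csum; rewrite Cmult_plus_distr_l, IH; simpl; ring. }
  assert (Hw' : (w - 1)%C <> 0) by (intros E; apply Hw, Ceq_minus, E).
  transitivity ((w - 1) * csum (fun j => w ^ j) (S N) / (w - 1))%C; [field; auto|].
  rewrite G, Ewn; field; auto.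
Qed.

(** Summing over the rotations by roots of unity keeps only the exponents divisible by N + 1, each
    with multiplicity N + 1; the other d powers of N + 1 come from the coefficients. *)
Lemma pl_distribution (d N : nat) (X : C) : Cmod X < 1 ->
  csum (fun j => pl d (cis (2 * PI / INR (S N)) ^ j * X)%C) (S N) =
  (RtoC (INR (S N) ^ S d) * pl d (X ^ S N))%C.
Proof.
intros HX; set (z := cis (2 * PI / INR (S N))).
assert (Hz : forall j, Cmod (z ^ j * X) < 1).
{ intros j; rewrite Cmod_mult, Cmod_pow; unfold z; rewrite Cmod_cis, pow1; lra. }
assert (HXN : Cmod (X ^ S N) < 1).
{ rewrite Cmod_pow; simpl; assert (H := Cmod_ge_0 X).
  assert (Cmod X ^ N <= 1) by (rewrite <- (pow1 N); apply pow_incr; lra).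
  assert (0 <= Cmod X ^ N) by (apply pow_le; lra); nra. }
(* Partial sums are cut at multiples of [S N], so that a cut of the series in [X] is a cut of the
   series in [X ^ S N]. *)
assert (H1 : Ccv (fun M => csum (fun j => csum (fun m => RtoC (INR m ^ d) * (z ^ j * X) ^ m)%C (S N * M)) (S N))
  (csum (fun j => pl d (z ^ j * X)%C) (S N))).
{ generalize (S N) at 2 3; intros D; induction D as [|D IH]; [exact (Ccv_const 0)|].
  simpl csum; apply Ccv_plus; auto.
  apply (Ccv_subseq (csum (fun m => RtoC (INR m ^ d) * (z ^ D * X) ^ m)%C) _ (fun M => (S N * M)%nat)).
  - intros n; nia.
  - apply pl_Ccv, Hz. }
assert (H2 := Ccv_scal (RtoC (INR (S N) ^ S d)) _ _ (pl_Ccv d _ HXN)).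
refine (Ccv_unique _ _ _ H1 (Ccv_ext _ _ _ _ H2)).
intros M; rewrite <- csum_scal, csum_swap.
rewrite (csum_ext (fun j => csum _ (S N)) (fun m => RtoC (INR m ^ d) * X ^ m *
  (if excluded_middle_informative (Nat.divide (S N) m) then RtoC (INR (S N)) else 0))%C).
2: { intros m _; rewrite <- root_of_unity_sum, <- csum_scal; apply csum_ext; intros j _.
     fold z; rewrite Cpow_mult_l, Cpow_mult_r; ring. }
rewrite csum_multiples.
- apply csum_ext; intros i _.
  destruct (excluded_middle_informative (Nat.divide (S N) (S N * i))) as [H|H].
  + rewrite Cpow_mult_r, mult_INR, Rpow_mult_distr; rewrite <- (tech_pow_Rmult (INR (S N)) d), !RtoC_mult; ring.
  + exfalso; apply H; exists i; lia.
- intros m Hm; destruct (excluded_middle_informative (Nat.divide (S N) m)); [tauto|ring].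
Qed.

(** * The exponential near 0 and the pole of the polylogarithm at q = 1 *)

Lemma Cexp_cis (z : C) : Cexp z = (RtoC (exp (Re z)) * cis (Im z))%C.
Proof. apply injective_projections; simpl; ring. Qed.

Lemma Cexp_plus (z w : C) : Cexp (z + w) = (Cexp z * Cexp w)%C.
Proof.
rewrite !Cexp_cis, re_plus, im_plus, exp_plus, RtoC_mult, cis_plus; ring.
Qed.

Lemma Cmod_Cexp (z : C) : Cmod (Cexp z) = exp (Re z).
Proof. rewrite Cexp_cis; apply Cmod_scal_cis; left; apply exp_pos. Qed.

Lemma Cexp_0 : Cexp 0 = 1.
Proof. rewrite Cexp_cis; simpl; rewrite exp_0, cis_0; ring. Qed.

Lemma Cexp_pow (z : C) (n : nat) : (Cexp z ^ n = Cexp (RtoC (INR n) * z))%C.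
Proof.
induction n as [|n IH].
- simpl; rewrite Cmult_0_l, Cexp_0; reflexivity.
- rewrite Cpow_S, IH, <- Cexp_plus, S_INR, RtoC_plus; f_equal; ring.
Qed.

Lemma exp_neg_le (a : R) : 0 <= a -> exp (- a) <= / (1 + a).
Proof.
intros Ha; rewrite exp_Ropp; apply Rinv_le_contravar; [lra|apply exp_ineq1_le].
Qed.

Lemma one_minus_cos (b : R) : 1 - cos b = 2 * (sin (b / 2)) ^ 2.
Proof.
replace b with (2 * (b / 2)) at 1 by field; rewrite cos_2a_sin; ring.
Qed.

Lemma sin_cubic_lower (b : R) : 0 <= b <= PI -> b - b ^ 3 / 6 <= sin b.
Proof.
intros Hb; destruct (pre_sin_bound b 0) as [H _]; try lra.
{ assert (H4 := PI_4); lra. }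
unfold sin_approx, sin_term in H; simpl in H; eapply Rle_trans; [|exact H].
right; field.
Qed.

Lemma sin_le_id (b : R) : 0 <= b -> sin b <= b.
Proof.
intros Hb; destruct (Req_dec b 0) as [->|H]; [rewrite sin_0; lra|].
left; apply sin_lt_x; lra.
Qed.

(** With w = a + i b, both parts of |1 - e^(-w)|^2 = (1 - e^(-a))^2 + 2 e^(-a) (1 - cos b) are
    bounded below by squares; |b| <= pi keeps away from the other zeros 2 pi i n. *)
Lemma one_minus_Cexp_lower (w : C) : 0 < Re w <= 1 -> Rabs (Im w) <= PI ->
  Cmod w / 6 <= Cmod (1 - Cexp (- w)).
Proof.
intros Hw Hi; destruct w as [a b]; unfold Re, Im in Hw, Hi; simpl in Hw, Hi.
assert (Hb0 := Rabs_pos b).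
assert (HPI := PI_4).
assert (Hcos : b ^ 2 / 18 <= 1 - cos b).
{ rewrite one_minus_cos.
  replace (b ^ 2) with (Rabs b ^ 2) by (now rewrite pow2_abs).
  replace (sin (b / 2) ^ 2) with (sin (Rabs b / 2) ^ 2).
  2: { unfold Rabs; destruct (Rcase_abs b); auto.
       replace (- b / 2) with (- (b / 2)) by field; rewrite sin_neg; ring. }
  set (c := Rabs b / 2) in *.
  assert (Hc := sin_cubic_lower c ltac:(unfold c; lra)).
  assert (Hc0 : 0 <= c <= 2) by (unfold c; lra).
  assert (Hc2 : c / 3 <= sin c).
  { eapply Rle_trans; [|exact Hc].
    assert (c * c <= 4) by nra. simpl; nra. }
  replace (Rabs b) with (2 * c) by (unfold c; field); nra. }
assert (He1 : exp (- a) <= 1 - a / 2).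
{ eapply Rle_trans; [apply exp_neg_le; lra|].
  apply Rmult_le_reg_r with (1 + a); [lra|rewrite Rinv_l by lra; nra]. }
assert (He2 : / 3 <= exp (- a)).
{ rewrite exp_Ropp; apply Rinv_le_contravar; [apply exp_pos|].
  apply Rle_trans with (exp 1); [|apply exp_le_3].
  destruct (Req_dec a 1) as [->|]; [lra|left; apply exp_increasing; lra]. }
set (e := exp (- a)) in *.
set (z := (1 - Cexp (- (a, b)))%C).
assert (Hz : Cmod z ^ 2 = (1 - e) ^ 2 + 2 * e * (1 - cos b)).
{ rewrite Cmod2_alt; unfold z, Cexp, Cminus; rewrite re_plus, im_plus.
  simpl; rewrite cos_neg, sin_neg; fold e.
  assert (H := sin2_cos2 b); unfold Rsqr in H.
  replace ((1 + - (e * cos b)) * ((1 + - (e * cos b)) * 1) +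
    (0 + - (e * - sin b)) * ((0 + - (e * - sin b)) * 1)) with
    (1 - 2 * e * cos b + e * e * (sin b * sin b + cos b * cos b)) by ring.
  rewrite H; ring. }
assert (Hm : Cmod (a, b) ^ 2 = a ^ 2 + b ^ 2) by apply Cmod2_alt.
apply Rsqr_incr_0_var; [|apply Cmod_ge_0]; unfold Rsqr.
replace (Cmod z * Cmod z) with (Cmod z ^ 2) by ring.
replace (Cmod (a, b) / 6 * (Cmod (a, b) / 6)) with (Cmod (a, b) ^ 2 / 36) by field.
rewrite Hz, Hm; nra.
Qed.

Lemma one_minus_Cexp_upper (w : C) : 0 < Re w <= 1 -> Rabs (Im w) <= PI ->
  Cmod (1 - Cexp (- w) - w) <= 4 * Cmod w ^ 2.
Proof.
intros Hw Hi; destruct w as [a b]; unfold Re, Im in Hw, Hi; simpl in Hw, Hi.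
assert (Hb0 := Rabs_pos b); assert (HPI := PI_4).
assert (He1 : exp (- a) <= 1 - a + a ^ 2).
{ eapply Rle_trans; [apply exp_neg_le; lra|].
  apply Rmult_le_reg_r with (1 + a); [lra|rewrite Rinv_l by lra].
  assert (0 < a ^ 3) by (apply pow_lt; lra); nra. }
assert (He2 : 1 - a <= exp (- a)) by (assert (H := exp_ineq1_le (- a)); lra).
assert (Hcos : 0 <= 1 - cos b <= b ^ 2 / 2).
{ split; [assert (H := COS_bound b); lra|].
  rewrite one_minus_cos.
  assert (Hs : Rabs (sin (b / 2)) <= Rabs (b / 2)).
  { unfold Rabs at 2; destruct (Rcase_abs (b / 2)).
    - rewrite <- Rabs_Ropp, <- sin_neg; rewrite Rabs_pos_eq; [apply sin_le_id; lra|].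
      apply sin_ge_0; [lra|]; unfold Rabs in Hi; destruct (Rcase_abs b); lra.
    - rewrite Rabs_pos_eq; [apply sin_le_id; lra|].
      apply sin_ge_0; [lra|]; unfold Rabs in Hi; destruct (Rcase_abs b); lra. }
  apply pow_maj_Rabs with (n := 2%nat) in Hs.
  replace (Rabs (b / 2) ^ 2) with ((b / 2) ^ 2) in Hs
    by (now rewrite pow2_abs).
  simpl in *; lra. }
assert (Hsin : Rabs (sin b - b) <= b ^ 2).
{ assert (G : forall c, 0 <= c <= PI -> Rabs (sin c - c) <= c ^ 2).
  { intros c Hc; assert (H1 := sin_cubic_lower c Hc); assert (H2 := sin_le_id c (proj1 Hc)).
    rewrite Rabs_left1 by lra.
    assert (c ^ 3 <= 4 * c ^ 2) by (simpl; nra); nra. }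
  unfold Rabs in Hi; destruct (Rcase_abs b) as [Hb|Hb].
  - specialize (G (- b) ltac:(lra)); rewrite sin_neg in G.
    replace (- sin b - - b) with (- (sin b - b)) in G by ring.
    rewrite Rabs_Ropp in G; eapply Rle_trans; [exact G|right; ring].
  - apply G; lra. }
set (e := exp (- a)) in *.
assert (Hm : Cmod (a, b) ^ 2 = a ^ 2 + b ^ 2) by apply Cmod2_alt.
set (z := (1 - Cexp (- (a, b)) - (a, b))%C).
assert (Ez : z = (RtoC (1 - a - e * cos b) + Ci * RtoC (e * (sin b - b) + (e - 1) * b))%C).
{ apply injective_projections; simpl; rewrite ?cos_neg, ?sin_neg; fold e; ring. }
rewrite Ez; eapply Rle_trans; [apply Cmod_triangle|].
rewrite Cmod_mult, Cmod_Ci, !Cmod_R, Rmult_1_l.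
assert (He0 : 0 < e) by apply exp_pos.
assert (H1 : Rabs (1 - a - e * cos b) <= a ^ 2 + b ^ 2).
{ replace (1 - a - e * cos b) with ((1 - a - e) + e * (1 - cos b)) by ring.
  assert (He3 : e <= 1) by nra.
  assert (Hec : 0 <= e * (1 - cos b) <= 1 - cos b) by (split; nra).
  assert (Hb2 := pow2_ge_0 b); apply Rabs_le; lra. }
assert (H2 : Rabs (e * (sin b - b) + (e - 1) * b) <= b ^ 2 + (a ^ 2 + b ^ 2)).
{ eapply Rle_trans; [apply Rabs_triang|].
  rewrite !Rabs_mult, (Rabs_pos_eq e), (Rabs_left1 (e - 1)) by (unfold e in *; nra).
  assert (Hq : Rabs b * Rabs b = b ^ 2).
  { rewrite <- Rabs_mult, Rabs_pos_eq; [ring|nra]. }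
  assert (Hp := Rabs_pos (sin b - b)).
  assert (He3 : e <= 1) by nra.
  apply Rplus_le_compat; [eapply Rle_trans; [|exact Hsin]; nra|].
  apply Rle_trans with (a * Rabs b); [apply Rmult_le_compat_r; lra|].
  rewrite <- Hq; nra. }
rewrite Hm; nra.
Qed.

Lemma Cpow_diff (x y : C) (m : R) (n : nat) : Cmod x <= m -> Cmod y <= m ->
  Cmod (x ^ S n - y ^ S n) <= INR (S n) * m ^ n * Cmod (x - y).
Proof.
intros Hx Hy; assert (Hm : 0 <= m) by (assert (H := Cmod_ge_0 x); lra).
assert (Hxy := Cmod_ge_0 (x - y)).
induction n as [|n IH].
- simpl; rewrite !Cmult_1_r; lra.
- replace (x ^ S (S n) - y ^ S (S n))%C with (x * (x ^ S n - y ^ S n) + y ^ S n * (x - y))%C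
    by (simpl; ring).
  eapply Rle_trans; [apply Cmod_triangle|]; rewrite !Cmod_mult, Cmod_pow.
  assert (H1 : Cmod y ^ S n <= m ^ S n) by (apply pow_incr; split; auto; apply Cmod_ge_0).
  rewrite (S_INR (S n)).
  apply Rle_trans with (m * (INR (S n) * m ^ n * Cmod (x - y)) + m ^ S n * Cmod (x - y)).
  + apply Rplus_le_compat; [|apply Rmult_le_compat_r; auto].
    apply Rmult_le_compat; auto; apply Cmod_ge_0.
  + right; simpl pow; ring.
Qed.

(** The lower terms of [pl_rational] are of order |w|^-d already; in the top one, 1 / (1 - e^(-w))
    may be replaced by 1 / w because their difference is bounded. *)
Lemma pl_near_0 (d : nat) : exists B, 0 <= B /\ forall w, 0 < Re w <= 1 -> Rabs (Im w) <= PI ->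
  Cmod (pl d (Cexp (- w)) - RtoC (INR (fact d)) / w ^ S d) <= B / Cmod w ^ d.
Proof.
destruct (pl_rational d) as [c [Hd Hc]].
assert (G : forall D, (D <= d)%nat -> exists B, 0 <= B /\
  forall w, 0 < Re w <= 1 -> Rabs (Im w) <= PI ->
  Cmod (csum (fun j => c j / (1 - Cexp (- w)) ^ S j)%C D) <= B / Cmod w ^ d).
{ induction D as [|D IH]; intros HD.
  - exists 0; split; [lra|]; intros w _ _; simpl; rewrite Cmod_0; unfold Rdiv; lra.
  - destruct IH as [B [HB IH]]; [lia|].
    (* The 6 comes from [one_minus_Cexp_lower]; since |w| <= 1 + pi < 5, a lower power of 1 / |w| is
       raised to |w|^-d by factors 5. *)
    exists (B + Rabs (c D) * 6 ^ S D * 5 ^ (d - S D)); split.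
    { assert (0 < 6 ^ S D) by (apply pow_lt; lra).
      assert (0 < 5 ^ (d - S D)) by (apply pow_lt; lra).
      assert (0 <= Rabs (c D)) by apply Rabs_pos.
      assert (0 <= Rabs (c D) * 6 ^ S D * 5 ^ (d - S D)); [|lra].
      apply Rmult_le_pos; [apply Rmult_le_pos|]; lra. }
    intros w Hw Hi; simpl csum.
    eapply Rle_trans; [apply Cmod_triangle|].
    unfold Rdiv; rewrite Rmult_plus_distr_r; apply Rplus_le_compat; [apply IH; auto|].
    assert (Hl := one_minus_Cexp_lower w Hw Hi).
    assert (Hw0 : 0 < Cmod w).
    { apply Cmod_gt_0; intros E; rewrite E in Hw; simpl in Hw; lra. }
    set (u := (1 - Cexp (- w))%C) in *.
    assert (Hu : u <> 0) by (apply Cmod_gt_0; lra).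
    change (u * u ^ D)%C with (u ^ S D)%C.
    rewrite Cmod_div by (apply Cpow_nz; auto).
    rewrite Cmod_R, Cmod_pow; unfold Rdiv.
    rewrite !Rmult_assoc; apply Rmult_le_compat_l; [apply Rabs_pos|].
    assert (Hw5 : Cmod w <= 5).
    { replace w with (RtoC (Re w) + Ci * RtoC (Im w))%C
        by (destruct w; apply injective_projections; simpl; ring).
      eapply Rle_trans; [apply Cmod_triangle|].
      rewrite Cmod_mult, Cmod_Ci, !Cmod_R, (Rabs_pos_eq (Re w)) by lra.
      assert (HPI := PI_4); lra. }
    assert (Hpow : Cmod w ^ d = Cmod w ^ S D * Cmod w ^ (d - S D)).
    { rewrite <- pow_add; f_equal; lia. }
    apply Rle_trans with (/ (Cmod w / 6) ^ S D).
    { apply Rinv_le_contravar; [apply pow_lt; lra|apply pow_incr; lra]. }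
    rewrite Hpow; unfold Rdiv; rewrite Rpow_mult_distr, !Rinv_mult, pow_inv, Rinv_inv.
    assert (H0 : 0 < / Cmod w ^ S D) by (apply Rinv_0_lt_compat, pow_lt; auto).
    assert (H4 : 0 < 6 ^ S D) by (apply pow_lt; lra).
    assert (Hz : 0 < Cmod w ^ (d - S D)) by (apply pow_lt; lra).
    assert (H5 : 1 <= 5 ^ (d - S D) * / Cmod w ^ (d - S D)).
    { apply Rmult_le_reg_r with (Cmod w ^ (d - S D)); auto.
      rewrite Rmult_assoc, Rinv_l by lra; rewrite Rmult_1_l, Rmult_1_r.
      apply pow_incr; lra. }
    replace (6 ^ S D * (5 ^ (d - S D) * (/ Cmod w ^ S D * / Cmod w ^ (d - S D)))) with
      ((/ Cmod w ^ S D * 6 ^ S D) * (5 ^ (d - S D) * / Cmod w ^ (d - S D))) by ring.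
    rewrite <- (Rmult_1_r (/ Cmod w ^ S D * 6 ^ S D)) at 1.
    apply Rmult_le_compat_l; [apply Rmult_le_pos; lra|exact H5]. }
destruct (G d (Nat.le_refl d)) as [B [HB HG]].
exists (B + INR (fact d) * (INR (S d) * 6 ^ d * 24)); split.
{ assert (0 <= INR (fact d) * (INR (S d) * 6 ^ d * 24)); [|lra].
  assert (0 < 6 ^ d) by (apply pow_lt; lra).
  apply Rmult_le_pos; [apply pos_INR|]; apply Rmult_le_pos; [|lra].
  apply Rmult_le_pos; [apply pos_INR|lra]. }
intros w Hw Hi.
assert (Hq : Cmod (Cexp (- w)) < 1).
{ rewrite Cmod_Cexp, re_opp, <- exp_0; apply exp_increasing; lra. }
rewrite (Hc _ Hq); simpl csum; rewrite Hd.
assert (Hl := one_minus_Cexp_lower w Hw Hi).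
assert (Hup := one_minus_Cexp_upper w Hw Hi).
assert (Hw0 : 0 < Cmod w).
{ apply Cmod_gt_0; intros E; rewrite E in Hw; simpl in Hw; lra. }
specialize (HG w Hw Hi).
set (u := (1 - Cexp (- w))%C) in *.
set (s := csum _ d) in *.
assert (Hu : u <> 0) by (apply Cmod_gt_0; lra).
assert (Hwn : w <> 0) by (apply Cmod_gt_0; lra).
change (u * u ^ d)%C with (u ^ S d)%C; change (w * w ^ d)%C with (w ^ S d)%C.
replace (s + INR (fact d) / u ^ S d - INR (fact d) / w ^ S d)%C with
  (s + INR (fact d) * ((/ u) ^ S d - (/ w) ^ S d))%C.
2: { rewrite !Cpow_inv by auto; unfold Cdiv, Cminus; ring. }
eapply Rle_trans; [apply Cmod_triangle|].
unfold Rdiv; rewrite Rmult_plus_distr_r; apply Rplus_le_compat; [exact HG|].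
rewrite Cmod_mult, Cmod_R, (Rabs_pos_eq (INR (fact d))) by apply pos_INR.
rewrite Rmult_assoc; apply Rmult_le_compat_l; [apply pos_INR|].
assert (Hiu : Cmod (/ u) <= 6 / Cmod w).
{ rewrite Cmod_inv by auto; replace (6 / Cmod w) with (/ (Cmod w / 6)) by (field; lra).
  apply Rinv_le_contravar; lra. }
assert (Hiw : Cmod (/ w) <= 6 / Cmod w).
{ rewrite Cmod_inv by auto; unfold Rdiv.
  assert (0 < / Cmod w) by (apply Rinv_0_lt_compat; lra); lra. }
eapply Rle_trans; [apply (Cpow_diff _ _ _ _ Hiu Hiw)|].
(* 24 = 4 * 6, from |u - w| <= 4 |w|^2 and |1 / u| <= 6 / |w|. *)
assert (Hdiff : Cmod (/ u - / w) <= 24).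
{ replace (/ u - / w)%C with (- ((u - w) * (/ u * / w)))%C by (field; auto).
  rewrite Cmod_opp, !Cmod_mult, (Cmod_inv w) by auto.
  apply Rle_trans with (4 * Cmod w ^ 2 * (6 / Cmod w * / Cmod w)); [|right; field; lra].
  assert (0 < / Cmod w) by (apply Rinv_0_lt_compat; lra).
  apply Rmult_le_compat; auto; try apply Cmod_ge_0.
  - apply Rmult_le_pos; [apply Cmod_ge_0|lra].
  - apply Rmult_le_compat_r; lra. }
assert (0 < 6 ^ d) by (apply pow_lt; lra).
assert (0 < / Cmod w ^ d) by (apply Rinv_0_lt_compat, pow_lt; lra).
unfold Rdiv; rewrite Rpow_mult_distr, pow_inv.
replace (INR (S d) * 6 ^ d * 24 * / Cmod w ^ d) with (INR (S d) * (6 ^ d * / Cmod w ^ d) * 24) by ring.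
apply Rmult_le_compat_l; auto.
apply Rmult_le_pos; [apply pos_INR|apply Rmult_le_pos; lra].
Qed.

(** * The Lipschitz formula *)

(* The partial sums of the Lipschitz formula at tau = i s. *)
Definition lipsum (k : nat) (s : C) (L : nat) : C :=
  (/ s ^ k + csum (fun i => / (s + Ci * RtoC (INR (S i))) ^ k
                          + / (s - Ci * RtoC (INR (S i))) ^ k) L)%C.

(** The constant of the Lipschitz formula is real and positive because the variable s of tau = i s
    absorbs the powers of i. *)
Definition lipconst (d : nat) : R := INR (fact d) / (2 * PI) ^ S d.

Lemma lipconst_pos (d : nat) : 0 < lipconst d.
Proof.
apply Rdiv_lt_0_compat; [apply INR_fact_lt_0|apply pow_lt; assert (H := PI_RGT_0); lra].
Qed.

Lemma csum_symmetric (f : R -> C) (L : nat) :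
  csum (fun j => f (INR L - INR j)%R) (S (2 * L)) =
  (f 0 + csum (fun i => f (INR (S i)) + f (- INR (S i))%R) L)%C.
Proof.
induction L as [|L IH].
- simpl; rewrite Rminus_diag; ring.
- replace (S (2 * S L)) with (S (S (S (2 * L)))) by lia.
  rewrite csum_shift.
  change (csum (fun i => f (INR (S L) - INR (S i))%R) (S (S (2 * L)))) with
    (csum (fun i => f (INR (S L) - INR (S i))%R) (S (2 * L)) + f (INR (S L) - INR (S (S (2 * L))))%R)%C.
  rewrite (csum_ext _ (fun j => f (INR L - INR j)%R)).
  2: { intros i _; f_equal; rewrite !S_INR; ring. }
  rewrite IH; cbn [csum].
  replace (INR (S L) - INR 0) with (INR (S L)) by (simpl INR; ring).
  replace (INR (S L) - INR (S (S (2 * L)))) with (- INR (S L)).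
  2: { rewrite !S_INR, mult_INR; simpl INR; ring. }
  ring.
Qed.

Lemma rsum_inv_sqr (n : nat) : rsum (fun i => / INR (S i) ^ 2) n <= 2.
Proof.
assert (H : rsum (fun i => / INR (S i) ^ 2) (S n) <= 2 - / INR (S n)).
{ induction n as [|n IH]; [simpl; lra|].
  change (rsum (fun i => / INR (S i) ^ 2) (S (S n))) with
    (rsum (fun i => / INR (S i) ^ 2) (S n) + / INR (S (S n)) ^ 2).
  assert (H : / INR (S (S n)) ^ 2 <= / INR (S n) - / INR (S (S n))); [|lra].
  assert (Hn : 0 < INR (S n)) by (apply lt_0_INR; lia).
  rewrite (S_INR (S n)); set (x := INR (S n)) in *.
  replace (/ x - / (x + 1)) with (/ (x * (x + 1))) by (field; lra).
  apply Rinv_le_contravar; nra. }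
cbn [rsum] in H.
assert (0 < / (INR (S n) ^ 2)) by (apply Rinv_0_lt_compat, pow_lt, lt_0_INR; lia).
assert (0 < / INR (S n)) by (apply Rinv_0_lt_compat, lt_0_INR; lia).
lra.
Qed.

Lemma Ccv_squeeze_ev (u : nat -> C) (l : C) (v : nat -> R) (N : nat) :
  (forall n, (N <= n)%nat -> Cmod (u n - l) <= v n) -> is_lim_seq v 0 -> Ccv u l.
Proof.
intros H Hv.
apply (is_lim_seq_le_le_loc (fun _ => 0) _ v); [|apply is_lim_seq_const|exact Hv].
exists N; intros n Hn; split; [apply Cmod_ge_0|apply H, Hn].
Qed.

Lemma inv_nat_lim (K : R) : is_lim_seq (fun L => K * / INR (S (2 * L))) 0.
Proof.
apply lim0_scal.
apply (squeeze_0 _ (fun n => / INR (S n))).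
- intros n; split; [left; apply Rinv_0_lt_compat, lt_0_INR; lia|].
  apply Rinv_le_contravar; [apply lt_0_INR; lia|apply le_INR; lia].
- apply (is_lim_seq_incr_1 (fun n => / INR n)).
  replace (Finite 0) with (Rbar_inv p_infty) by reflexivity.
  apply is_lim_seq_inv; [apply is_lim_seq_INR|discriminate].
Qed.

(* Distribution relation of order 2L+1: each of its terms is close to its principal part at q = 1. *)
Theorem lipschitz_formula (d : nat) (s : C) : (2 <= d)%nat -> 0 < Re s -> Rabs (Im s) <= 1 / 2 ->
  Ccv (fun L => RtoC (lipconst d) * lipsum (S d) s L)%C (pl d (Cexp (- (RtoC (2 * PI) * s)))).
Proof.
intros Hd Hs Hi; assert (HPI := PI_RGT_0).
destruct (pl_near_0 d) as [B [HB Hnear]].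
set (sg := Re s) in *.
set (y := fun r : R => (s + Ci * RtoC r)%C).
assert (Rey : forall r, Re (y r) = sg).
{ intros r; unfold y, sg; destruct s; simpl; ring. }
assert (Imy : forall r, Im (y r) = Im s + r).
{ intros r; unfold y; destruct s; simpl; ring. }
assert (Hy : forall r, sg <= Cmod (y r)).
{ intros r; rewrite <- (Rey r); eapply Rle_trans; [apply Rle_abs|apply re_le_Cmod]. }
(* Two lower bounds for |s + i r| are used: Re s for all r, and |r| / 2 for |r| >= 1, the latter
   because |Im s| <= 1/2. *)
assert (Hy0 : forall r, y r <> 0) by (intros r; apply Cmod_gt_0; specialize (Hy r); lra).
assert (Hy2 : forall r, 1 <= Rabs r -> Rabs r / 2 <= Cmod (y r)).
{ intros r Hr; eapply Rle_trans; [|apply im_le_Cmod]; rewrite Imy.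
  assert (H := Rabs_triang_inv r (- Im s)); rewrite Rabs_Ropp in H.
  replace (r - - Im s) with (Im s + r) in H by ring; lra. }
set (e := 2 * PI * sg).
(* N must be large enough for 2 pi Re s / N <= 1, the range of [pl_near_0]. *)
assert (HN0 : exists N0 : nat, e <= INR N0).
{ destruct (archimed e) as [H _]; exists (Z.to_nat (up e)).
  rewrite INR_IZR_INZ, Z2Nat.id; [lra|].
  apply le_IZR; assert (0 < e) by (unfold e; apply Rmult_lt_0_compat; lra); lra. }
destruct HN0 as [N0 HN0].
set (K := B * (/ sg ^ d + 16 * / sg ^ (d - 2))).
apply (Ccv_squeeze_ev _ _ (fun L => K * / INR (S (2 * L))) N0); [|apply inv_nat_lim].
intros L HL.
set (N := INR (S (2 * L))).
assert (HNe : N = 2 * INR L + 1) by (unfold N; rewrite S_INR, mult_INR; simpl INR; ring).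
assert (HN : 0 < N) by (apply lt_0_INR; lia).
(* For |r| <= L these points satisfy |Im w| <= pi, since |Im s| + L <= N / 2. *)
set (w := fun r : R => (RtoC (2 * PI / N) * y r)%C).
assert (HwRe : forall r, 0 < Re (w r) <= 1).
{ intros r; unfold w; rewrite re_scal_l, Rey; split.
  - apply Rmult_lt_0_compat; auto; apply Rdiv_lt_0_compat; lra.
  - replace (2 * PI / N * sg) with (e / N) by (unfold e; field; lra).
    apply Rmult_le_reg_r with N; auto; field_simplify; [|lra].
    apply Rle_trans with (INR N0); auto; rewrite HNe; apply le_INR in HL.
    assert (H := pos_INR L); lra. }
assert (Hwmod : forall r, Cmod (w r) = 2 * PI / N * Cmod (y r)).
{ intros r; unfold w; rewrite Cmod_mult, Cmod_R, Rabs_pos_eq; auto.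
  left; apply Rdiv_lt_0_compat; lra. }
set (f := fun r : R => (RtoC (/ N ^ S d) * pl d (Cexp (- w r)) - RtoC (lipconst d) / y r ^ S d)%C).
assert (Hf : forall r, Rabs r <= INR L -> Cmod (f r) <= B * / N * / Cmod (y r) ^ d).
{ intros r Hr.
  assert (Hwi : Rabs (Im (w r)) <= PI).
  { unfold w; rewrite im_scal_l, Imy, Rabs_mult, Rabs_pos_eq by (left; apply Rdiv_lt_0_compat; lra).
    assert (H := Rabs_triang (Im s) r).
    apply Rle_trans with (2 * PI / N * (N / 2)); [|right; field; lra].
    apply Rmult_le_compat_l; [left; apply Rdiv_lt_0_compat; lra|lra]. }
  assert (H := Hnear (w r) (HwRe r) Hwi).
  assert (Ef : f r = (RtoC (/ N ^ S d) * (pl d (Cexp (- w r)) - RtoC (INR (fact d)) / w r ^ S d))%C).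
  { unfold f, Cminus; rewrite Cmult_plus_distr_l; f_equal.
    unfold w, lipconst.
    assert (HNS : N ^ S d <> 0) by (apply pow_nonzero; lra).
    assert (HPS : (2 * PI) ^ S d <> 0) by (apply pow_nonzero; lra).
    assert (HNC := RtoC_neq _ HNS); assert (HPC := RtoC_neq _ HPS).
    assert (HyS := Cpow_nz _ (S d) (Hy0 r)).
    assert (E2 : (2 * PI / N) ^ S d = (2 * PI) ^ S d * / N ^ S d).
    { unfold Rdiv; rewrite (Rpow_mult_distr (2 * PI)), pow_inv; reflexivity. }
    rewrite Cpow_mult_l, <- RtoC_pow, E2; unfold Rdiv.
    set (P := (2 * PI) ^ S d) in *; set (Q := N ^ S d) in *; set (Y := (y r ^ S d)%C) in *.
    rewrite !RtoC_mult, !RtoC_inv by auto.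
    field; repeat split; auto. }
  rewrite Ef, Cmod_mult, Cmod_R, Rabs_pos_eq by (left; apply Rinv_0_lt_compat, pow_lt; auto).
  apply Rle_trans with (/ N ^ S d * (B / Cmod (w r) ^ d)).
  { apply Rmult_le_compat_l; auto; left; apply Rinv_0_lt_compat, pow_lt; auto. }
  assert (HyC : 0 < Cmod (y r)) by (specialize (Hy r); lra).
  rewrite Hwmod; unfold Rdiv; rewrite (Rpow_mult_distr (2 * PI * / N)), (Rpow_mult_distr (2 * PI)), pow_inv.
  assert (HyS : 0 < Cmod (y r) ^ d) by (apply pow_lt; auto).
  assert (HNS : 0 < N ^ d) by (apply pow_lt; auto).
  assert (HPS : 1 <= (2 * PI) ^ d) by (apply pow_R1_Rle; assert (H4 := PI2_3_2); lra).
  rewrite <- (tech_pow_Rmult N d).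
  replace (/ (N * N ^ d) * (B * / ((2 * PI) ^ d * / N ^ d * Cmod (y r) ^ d))) with
    (B * / N * / Cmod (y r) ^ d * / (2 * PI) ^ d) by (field; repeat split; lra).
  rewrite <- (Rmult_1_r (B * / N * / Cmod (y r) ^ d)) at 2.
  apply Rmult_le_compat_l.
  - assert (0 < / N) by (apply Rinv_0_lt_compat; auto).
    assert (0 < / Cmod (y r) ^ d) by (apply Rinv_0_lt_compat; auto).
    apply Rmult_le_pos; [apply Rmult_le_pos|]; lra.
  - rewrite <- Rinv_1; apply Rinv_le_contravar; lra. }
(* Distribution relation at X = e^(-w(L)): the rotated points are e^(-w(L - j)), and X^N is the nome
   because N w(L) = 2 pi s + 2 pi i L. *)
assert (Hdist : pl d (Cexp (- (RtoC (2 * PI) * s))) =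
  csum (fun j => RtoC (/ N ^ S d) * pl d (Cexp (- w (INR L - INR j)%R)))%C (S (2 * L))).
{ rewrite csum_scal.
  set (X := Cexp (- w (INR L))).
  assert (HX : Cmod X < 1).
  { unfold X; rewrite Cmod_Cexp, re_opp, <- exp_0; apply exp_increasing.
    specialize (HwRe (INR L)); lra. }
  assert (Hn : RtoC N <> 0) by (apply RtoC_neq; lra).
  rewrite (csum_ext _ (fun j => pl d (cis (2 * PI / INR (S (2 * L))) ^ j * X)%C)).
  2: { intros j _; f_equal; unfold X.
       rewrite cis_pow; fold N.
       replace (cis (INR j * (2 * PI / N))) with (Cexp (Ci * RtoC (INR j * (2 * PI / N)))).
       2: { rewrite Cexp_cis; simpl.
            replace (0 * (INR j * (2 * PI / N)) - 1 * 0) with 0 by ring.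
            replace (0 * 0 + 1 * (INR j * (2 * PI / N))) with (INR j * (2 * PI / N)) by ring.
            rewrite exp_0; ring. }
       rewrite <- Cexp_plus; f_equal; unfold w, y; rewrite RtoC_minus, !RtoC_mult; ring. }
  rewrite pl_distribution by auto; fold N.
  rewrite Cmult_assoc, <- RtoC_mult, Rinv_l, Cmult_1_l by (apply pow_nonzero; lra).
  f_equal; unfold X; rewrite Cexp_pow; fold N.
  replace (RtoC N * - w (INR L))%C with (- (RtoC (2 * PI) * s) + - (Ci * RtoC (0 + 2 * INR L * PI)))%C.
  2: { unfold w, y, Rdiv; rewrite !RtoC_plus, !RtoC_mult, RtoC_inv by lra; field; auto. }
  rewrite Cexp_plus.
  replace (Cexp (- (Ci * RtoC (0 + 2 * INR L * PI)))) with (RtoC 1); [ring|].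
  rewrite Cexp_cis; simpl.
  replace (- (0 * (0 + 2 * INR L * PI) - 1 * 0)) with 0 by ring.
  replace (- (0 * 0 + 1 * (0 + 2 * INR L * PI))) with (- (0 + 2 * INR L * PI)) by ring.
  rewrite exp_0, cis_opp, cis_2PI, cis_0.
  apply injective_projections; simpl; ring. }
assert (Hlip : (RtoC (lipconst d) * lipsum (S d) s L)%C =
  csum (fun j => RtoC (lipconst d) / y (INR L - INR j)%R ^ S d)%C (S (2 * L))).
{ rewrite (csum_symmetric (fun r => RtoC (lipconst d) / y r ^ S d)%C).
  unfold lipsum; rewrite Cmult_plus_distr_l, <- csum_scal; f_equal.
  - unfold y; rewrite Cmult_0_r, Cplus_0_r; reflexivity.
  - apply csum_ext; intros i _; unfold y, Cdiv; rewrite RtoC_opp.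
    replace (s + Ci * - INR (S i))%C with (s - Ci * INR (S i))%C by ring; ring. }
rewrite Cmod_minus_sym, Hdist, Hlip, <- csum_minus.
rewrite (csum_ext _ (fun j => f (INR L - INR j)%R)) by reflexivity; rewrite (csum_symmetric f L).
assert (HNi : 0 < / N) by (apply Rinv_0_lt_compat; auto).
assert (HBN : 0 <= B * / N) by (apply Rmult_le_pos; lra).
assert (Hsg : forall n, 0 < sg ^ n) by (intros n; apply pow_lt; auto).
eapply Rle_trans; [apply Cmod_triangle|].
assert (H0 : Cmod (f 0) <= B * / N * / sg ^ d).
{ eapply Rle_trans; [apply Hf; rewrite Rabs_R0; apply pos_INR|].
  apply Rmult_le_compat_l; auto; apply Rinv_le_contravar; auto.
  apply pow_incr; split; [lra|apply Hy]. }
(* Of the d factors |y r|, all but two are bounded below by Re s and the last two by |r| / 2, which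
   leaves a convergent sum of inverse squares. *)
assert (H1 : Cmod (csum (fun i => f (INR (S i)) + f (- INR (S i))%R)%C L) <=
  B * / N * (16 * / sg ^ (d - 2))).
{ eapply Rle_trans; [apply (Cmod_csum_le _ (fun i => B * / N * (8 * / sg ^ (d - 2)) * / INR (S i) ^ 2))|].
  - intros i HiL.
    assert (Hi1 : 1 <= INR (S i)) by (change 1 with (INR 1); apply le_INR; lia).
    assert (HiLR : INR (S i) <= INR L) by (apply le_INR; lia).
    assert (G : forall r, Rabs r = INR (S i) ->
      Cmod (f r) <= B * / N * (4 * / sg ^ (d - 2) * / INR (S i) ^ 2)).
    { intros r Hr; eapply Rle_trans; [apply Hf; lra|].
      apply Rmult_le_compat_l; auto.
      assert (Hyr := Hy2 r ltac:(lra)); rewrite Hr in Hyr.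
      replace (4 * / sg ^ (d - 2) * / INR (S i) ^ 2) with
        (/ (sg ^ (d - 2) * (INR (S i) / 2) ^ 2)).
      2: { specialize (Hsg (d - 2)%nat); field; split; lra. }
      replace d with (d - 2 + 2)%nat at 1 by lia; rewrite pow_add.
      apply Rinv_le_contravar.
      - apply Rmult_lt_0_compat; auto; apply pow_lt; lra.
      - apply Rmult_le_compat; try (apply pow_le; lra).
        + apply pow_incr; split; [lra|apply Hy].
        + apply pow_incr; lra. }
    eapply Rle_trans; [apply Cmod_triangle|].
    assert (G1 := G (INR (S i)) ltac:(rewrite Rabs_pos_eq; lra)).
    assert (G2 := G (- INR (S i)) ltac:(rewrite Rabs_Ropp, Rabs_pos_eq; lra)).
    lra.
  - rewrite rsum_scal.
    assert (H2 := rsum_inv_sqr L).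
    assert (H3 : 0 <= B * / N * (8 * / sg ^ (d - 2))).
    { apply Rmult_le_pos; auto; specialize (Hsg (d - 2)%nat).
      apply Rinv_0_lt_compat in Hsg; lra. }
    nra. }
unfold K; lra.
Qed.

(** * Vanishing of the odd Bernoulli numbers *)

Definition conv (a b : nat -> R) (n : nat) : R := rsum (fun j => a j * b (n - j)%nat) (S n).

Lemma rsum_0 (a : nat -> R) (n : nat) : (forall i, (i < n)%nat -> a i = 0) -> rsum a n = 0.
Proof.
induction n as [|n IH]; intros H; [reflexivity|].
simpl; rewrite IH, H; auto; ring.
Qed.

Lemma rsum_swap (a : nat -> nat -> R) (m n : nat) :
  rsum (fun i => rsum (a i) n) m = rsum (fun j => rsum (fun i => a i j) m) n.
Proof.
induction m as [|m IH]; simpl.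
- symmetry; apply rsum_0; reflexivity.
- rewrite IH, <- rsum_plus; reflexivity.
Qed.

Lemma rsum_truncate (g : nat -> R) (j n : nat) : (j <= n)%nat ->
  rsum (fun i => if (j + i <=? n)%nat then g i else 0) (S n) = rsum g (S (n - j)).
Proof.
intros Hj; replace (S n) with (S (n - j) + j)%nat by lia; rewrite rsum_add.
rewrite (rsum_0 (fun i => if (j + (S (n - j) + i) <=? n)%nat then _ else _)), Rplus_0_r.
- apply rsum_ext; intros i Hi; destruct (Nat.leb_spec (j + i) n); [reflexivity|lia].
- intros i _; destruct (Nat.leb_spec (j + (S (n - j) + i)) n); [lia|reflexivity].
Qed.

(** Both sides sum a_j b_i c_(n-i-j) over the triangle i + j <= n, which is symmetric in i and j. *)
Lemma conv_exchange (a b c : nat -> R) (n : nat) : conv a (conv b c) n = conv b (conv a c) n.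
Proof.
assert (G : forall a b, conv a (conv b c) n =
  rsum (fun j => rsum (fun i => if (j + i <=? n)%nat then a j * b i * c (n - j - i)%nat else 0) (S n)) (S n)).
{ clear a b; intros a b; unfold conv; apply rsum_ext; intros j Hj.
  rewrite (rsum_truncate (fun i => a j * b i * c (n - j - i)%nat)) by lia.
  rewrite <- rsum_scal; apply rsum_ext; intros; ring. }
rewrite !G, rsum_swap; apply rsum_ext; intros i _; apply rsum_ext; intros j _.
rewrite (Nat.add_comm i j); destruct (j + i <=? n)%nat; [|reflexivity].
replace (n - i - j)%nat with (n - j - i)%nat by lia; ring.
Qed.

Lemma sum_f_R0_rsum (a : nat -> R) (n : nat) : sum_f_R0 a n = rsum a (S n).
Proof. induction n as [|n IH]; [simpl; ring|rewrite tech5, IH; reflexivity]. Qed.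

(** Formally (x / (e^x - 1)) ((e^x - 1) / x) = 1; this is the defining recursion divided by (n +
    1)!. *)
Lemma bernoulli_conv (n : nat) :
  conv (fun j => bernoulli j / INR (fact j)) (fun i => / INR (fact (S i))) n =
  match n with O => 1 | _ => 0 end.
Proof.
destruct n as [|n].
- unfold conv; simpl; unfold bernoulli; simpl; field.
- assert (H := bernoulli_rec n); rewrite sum_f_R0_rsum in H.
  assert (Hf : forall i, INR (fact i) <> 0) by (intros; apply INR_fact_neq_0).
  apply Rmult_eq_reg_l with (INR (fact (S (S n)))); auto.
  rewrite Rmult_0_r, <- H; unfold conv; rewrite <- rsum_scal; apply rsum_ext; intros j Hj.
  unfold Binomial.C; replace (S (S n) - j)%nat with (S (S n - j)) by lia.
  field; split; auto.
Qed.

(** Formally e^(-x) (e^x - 1) / x = (1 - e^(-x)) / x; in degree n it is the binomial expansion of (1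
    - 1)^(n+1). *)
Lemma exp_neg_conv (n : nat) :
  conv (fun i => (-1) ^ i / INR (fact i)) (fun i => / INR (fact (S i))) n =
  (-1) ^ n / INR (fact (S n)).
Proof.
assert (Hf : forall i, INR (fact i) <> 0) by (intros; apply INR_fact_neq_0).
assert (H := binomial (-1) 1 (S n)).
replace (-1 + 1) with 0 in H by ring; rewrite pow_i, sum_f_R0_rsum in H by lia.
cbn [rsum] in H; fold (rsum (fun i => Binomial.C (S n) i * (-1) ^ i * 1 ^ (S n - i)) (S n)) in H.
apply Rmult_eq_reg_l with (INR (fact (S n))); auto.
replace (INR (fact (S n)) * ((-1) ^ n / INR (fact (S n)))) with ((-1) ^ n) by (field; auto).
unfold conv; rewrite <- rsum_scal.
rewrite (rsum_ext _ (fun i => Binomial.C (S n) i * (-1) ^ i * 1 ^ (S n - i))).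
- cbn [rsum].
  replace (Binomial.C (S n) (S n)) with 1 in H.
  + rewrite !pow1 in *; rewrite <- tech_pow_Rmult in H; lra.
  + unfold Binomial.C; rewrite Nat.sub_diag; simpl (fact 0); simpl (INR 1); field; auto.
- intros i Hi; unfold Binomial.C; rewrite pow1.
  replace (S n - i)%nat with (S (n - i)) by lia; field; split; auto.
Qed.

(* With x/(e^x - 1) = sum b_j x^j, both sum b_j x^j + x and sum b_j (-x)^j are inverse to (1 - e^{-x})/x. *)
Lemma bernoulli_odd (k : nat) : (3 <= k)%nat -> Nat.Odd k -> bernoulli k = 0.
Proof.
intros Hk Hodd.
set (b := fun j => bernoulli j / INR (fact j)).
set (e' := fun i => (-1) ^ i / INR (fact (S i))).
set (s := fun i => (-1) ^ i / INR (fact i)).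
(* The difference of the two inverses. Its product with [e'] vanishes and [e'] has constant term 1,
   so [D] is zero; at an odd index above 1 it equals 2 b_k. *)
set (D := fun j => b j + (if (j =? 1)%nat then 1 else 0) - (-1) ^ j * b j).
assert (Hf : forall i, INR (fact i) <> 0) by (intros; apply INR_fact_neq_0).
assert (Hbe : forall n, conv b e' n = s n).
{ intros n; transitivity (conv b (conv s (fun i => / INR (fact (S i)))) n).
  - unfold conv at 1 2; apply rsum_ext; intros j _; f_equal; symmetry; apply exp_neg_conv.
  - rewrite conv_exchange; unfold conv at 1; cbn [rsum].
    rewrite Nat.sub_diag; unfold b; rewrite bernoulli_conv, rsum_0; [ring|].
    intros i Hi; rewrite bernoulli_conv.
    destruct (n - i)%nat eqn:E; [lia|ring]. }
assert (H1 : forall n, conv (fun j => if (j =? 1)%nat then 1 else 0) e' n = match n with O => 0 | _ => - s n end).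
{ intros [|n]; unfold conv; [simpl; ring|].
  rewrite !rsum_shift; rewrite rsum_0.
  - simpl (0 =? 1)%nat; simpl (1 =? 1)%nat.
    replace (S n - 1)%nat with n by lia; unfold e', s; simpl pow; field; auto.
  - intros i _; simpl; ring. }
assert (H2 : forall n, conv (fun j => (-1) ^ j * b j) e' n = match n with O => 1 | _ => 0 end).
{ intros n; transitivity ((-1) ^ n * match n with O => 1 | _ => 0 end).
  2: { destruct n; simpl; ring. }
  rewrite <- bernoulli_conv; fold b; unfold conv; rewrite <- rsum_scal; apply rsum_ext.
  intros j Hj; unfold e'; replace ((-1) ^ n) with ((-1) ^ j * (-1) ^ (n - j)) by (rewrite <- pow_add; f_equal; lia); field; auto. }
assert (HD : forall n, conv D e' n = 0).
{ intros n; transitivity (conv b e' n + conv (fun j => if (j =? 1)%nat then 1 else 0) e' n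
    + (-1) * conv (fun j => (-1) ^ j * b j) e' n).
  - unfold conv; rewrite <- rsum_scal, <- !rsum_plus; apply rsum_ext; intros j _; unfold D; ring.
  - rewrite Hbe, H1, H2; destruct n; [unfold s; simpl; field|ring]. }
assert (HD0 : forall n, D n = 0).
{ induction n as [n IH] using (well_founded_induction lt_wf).
  specialize (HD n); unfold conv in HD; cbn [rsum] in HD.
  rewrite rsum_0, Nat.sub_diag in HD.
  - unfold e' in HD; simpl in HD; lra.
  - intros i Hi; rewrite IH by auto; ring. }
specialize (HD0 k); unfold D in HD0.
destruct Hodd as [m Hm].
replace ((-1) ^ k) with (- 1) in HD0.
2: { rewrite Hm, pow_add, pow_1_even; simpl; ring. }
replace (k =? 1)%nat with false in HD0 by (symmetry; apply Nat.eqb_neq; lia).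
assert (Hb : b k = 0) by lra.
unfold b in Hb; apply Rmult_eq_reg_r with (/ INR (fact k)); [|apply Rinv_neq_0_compat; auto].
rewrite Rmult_0_l; exact Hb.
Qed.

(** * The q-series of odd weight *)

(* The value at n = 0 is 0, so that gs has no constant term. *)
Definition divisor_sum (d n : nat) : R :=
  rsum (fun i => if (n mod S i =? 0)%nat then INR (S i) ^ d else 0) n.

Lemma divisor_sum_bound (d n : nat) : 0 <= divisor_sum d n <= INR n ^ S d.
Proof.
assert (G : forall M, (M <= n)%nat ->
  0 <= rsum (fun i => if (n mod S i =? 0)%nat then INR (S i) ^ d else 0) M <= INR M * INR n ^ d).
{ induction M as [|M IH]; intros HM; [simpl; lra|].
  specialize (IH ltac:(lia)); cbn [rsum]; rewrite (S_INR M), Rmult_plus_distr_r, Rmult_1_l.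
  assert (H : 0 <= INR (S M) ^ d <= INR n ^ d).
  { split; [apply pow_le, pos_INR|apply pow_incr; split; [apply pos_INR|apply le_INR; lia]]. }
  destruct (n mod S M =? 0)%nat; rewrite <- ?S_INR; lra. }
specialize (G n (Nat.le_refl n)); exact G.
Qed.

Lemma divisor_sum_0 (d : nat) : divisor_sum d 0 = 0.
Proof. reflexivity. Qed.

Lemma divisor_sum_1 (d : nat) : divisor_sum d 1 = 1.
Proof. unfold divisor_sum; simpl; rewrite pow1; ring. Qed.

Lemma divisor_sum_geo (d : nat) (r : R) : 1 < r -> exists K, geo K r (fun n => RtoC (divisor_sum d n)).
Proof.
intros Hr; destruct (poly_le_geom (S d) r Hr) as [K [_ HK]]; exists K; intros n.
destruct (divisor_sum_bound d n); rewrite Cmod_R, Rabs_pos_eq by auto.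
eapply Rle_trans; [eassumption|apply HK].
Qed.

Definition gs (d : nat) (q : C) : C := PS (fun n => RtoC (divisor_sum d n)) q.

Lemma gs_Ccv (d : nat) (q : C) : Cmod q < 1 ->
  Ccv (csum (fun n => RtoC (divisor_sum d n) * q ^ n)%C) (gs d q).
Proof.
intros Hq; destruct (radius_exists (Cmod q)) as [r [Hr Hrq]].
{ split; auto; apply Cmod_ge_0. }
destruct (divisor_sum_geo d r Hr) as [K HK]; apply (PS_Ccv K r _ q HK); lra.
Qed.

Lemma one_minus_pow_lower (q : C) (m : nat) : Cmod q < 1 -> (1 <= m)%nat ->
  1 - Cmod q <= Cmod (1 - q ^ m).
Proof.
intros Hq Hm; assert (H := Cmod_triangle_rev 1 (- q ^ m)).
rewrite Cmod_1, Cmod_opp, Cmod_pow in H.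
assert (Hp : Cmod q ^ m <= Cmod q).
{ destruct m as [|m]; [lia|]; simpl; assert (H0 := Cmod_ge_0 q).
  assert (Cmod q ^ m <= 1) by (rewrite <- (pow1 m); apply pow_incr; lra).
  assert (0 <= Cmod q ^ m) by (apply pow_le; lra); nra. }
unfold Cminus; lra.
Qed.

(** The sum keeps the positive multiples of i + 1 up to N, so the first exponent left over is (i +
    1) (floor(N / (i + 1)) + 1). *)
Lemma geometric_multiples (q : C) (i N : nat) : Cmod q < 1 ->
  (q ^ S i / (1 - q ^ S i) -
   csum (fun n => if ((0 <? n)%nat && (n mod S i =? 0)%nat)%bool then q ^ n else 0) (S N) =
   q ^ (S i * S (N / S i)) / (1 - q ^ S i))%C.
Proof.
intros Hq.
assert (Hm := one_minus_pow_lower q (S i) Hq ltac:(lia)).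
assert (Hnz : (1 - q ^ S i)%C <> 0) by (apply Cmod_gt_0; lra).
induction N as [|N IH].
- rewrite Nat.Div0.div_0_l; cbn [csum]; simpl andb; rewrite Nat.mul_1_r.
  replace (0 <? 0)%nat with false by reflexivity; simpl andb; cbn iota; field; exact Hnz.
- change (csum ?f (S (S N))) with (csum f (S N) + f (S N))%C; cbv beta.
  set (A := csum _ (S N)) in *.
  replace (0 <? S N)%nat with true by reflexivity; rewrite Bool.andb_true_l.
  assert (Hd := Nat.div_mod_eq (S N) (S i)); assert (Hd0 := Nat.div_mod_eq N (S i)).
  assert (Hr := Nat.mod_upper_bound (S N) (S i) ltac:(lia)).
  assert (Hr0 := Nat.mod_upper_bound N (S i) ltac:(lia)).
  replace (q ^ S i / (1 - q ^ S i) - (A + (if (S N mod S i =? 0)%nat then q ^ S N else 0)))%C with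
    ((q ^ S i / (1 - q ^ S i) - A) - (if (S N mod S i =? 0)%nat then q ^ S N else 0))%C by ring.
  rewrite IH; destruct (Nat.eqb_spec (S N mod S i) 0) as [H|H].
  + assert (E : (S N / S i = S (N / S i))%nat) by nia.
    assert (E2 : (S i * S (N / S i) = S N)%nat) by nia.
    rewrite E, E2, (Nat.mul_succ_r (S i)), E2, Cpow_add_r; field; exact Hnz.
  + assert (E : (S N / S i = N / S i)%nat) by nia.
    rewrite E; ring.
Qed.

Lemma csum_if_scal (c : C) (b : nat -> bool) (a : nat -> C) (n : nat) :
  csum (fun i => if b i then c * a i else 0)%C n = (c * csum (fun i => if b i then a i else 0) n)%C.
Proof.
rewrite <- csum_scal; apply csum_ext; intros i _; destruct (b i); ring.
Qed.

(** Rearranging sum over n of sigma_d(n) q^n by divisors. Instead of summing a double family, finite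
    truncations of both series at the same [N] are compared. *)
Lemma lambert_series (d : nat) (q : C) : Cmod q < 1 ->
  Ccv (csum (fun i => RtoC (INR (S i) ^ d) * (q ^ S i / (1 - q ^ S i)))%C) (gs d q).
Proof.
intros Hq; set (p := Cmod q) in *.
assert (Hp0 : 0 <= p) by apply Cmod_ge_0.
set (f := fun i => (RtoC (INR (S i) ^ d) * (q ^ S i / (1 - q ^ S i)))%C).
assert (Hgs : Ccv (fun N => csum (fun n => RtoC (divisor_sum d n) * q ^ n)%C (S N)) (gs d q)).
{ apply Ccv_shift, gs_Ccv, Hq. }
assert (Hsig : forall N, csum (fun n => RtoC (divisor_sum d n) * q ^ n)%C (S N) =
  csum (fun i => RtoC (INR (S i) ^ d) *
    csum (fun n => if ((0 <? n)%nat && (n mod S i =? 0)%nat)%bool then q ^ n else 0) (S N))%C N).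
{ intros N.
  rewrite (csum_ext (fun i => RtoC (INR (S i) ^ d) * _)%C
    (fun i => csum (fun n => if ((0 <? n)%nat && (n mod S i =? 0)%nat)%bool
       then RtoC (INR (S i) ^ d) * q ^ n else 0)%C (S N))).
  2: { intros i _; symmetry.
       apply (csum_if_scal _ (fun n => ((0 <? n)%nat && (n mod S i =? 0)%nat)%bool)). }
  rewrite csum_swap; apply csum_ext; intros n Hn.
  destruct n as [|n].
  { rewrite divisor_sum_0, csum_0; [ring|intros; reflexivity]. }
  unfold divisor_sum; rewrite <- csum_RtoC, Cmult_comm, <- csum_scal.
  replace N with (S n + (N - S n))%nat by lia; rewrite csum_add.
  (* Numbers larger than [S n] do not divide it, so the range of [divisor_sum] may be extended to
     [N]. *)
  rewrite (csum_0 (fun i => if ((0 <? S n)%nat && (S n mod S (S n + i) =? 0)%nat)%bool then _ else _)).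
  - rewrite Cplus_0_r; apply csum_ext; intros i _.
    replace (0 <? S n)%nat with true by reflexivity; rewrite Bool.andb_true_l.
    destruct (S n mod S i =? 0)%nat; ring.
  - intros i _; rewrite Nat.mod_small by lia; reflexivity. }
destruct (radius_exists p ltac:(lra)) as [r [Hr Hrp]].
destruct (poly_le_geom (S d) r Hr) as [K [HK0 HK]].
(* The difference consists of N geometric tails that start beyond exponent N, so it is at most
   N^(d+1) p^N / (1 - p). *)
assert (Hdiff : Ccv (fun N => csum f N - csum (fun n => RtoC (divisor_sum d n) * q ^ n) (S N))%C 0).
{ apply (Ccv_squeeze _ _ (fun N => K * / (1 - p) * (r * p) ^ N)).
  2: { apply lim0_scal, pow_lim0; nra. }
  intros N; rewrite Hsig, <- csum_minus.
  match goal with |- Cmod (?a - ?z)%C <= _ => replace (a - z)%C with a by ring end.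
  apply Rle_trans with (rsum (fun _ => INR N ^ d * (p ^ N * / (1 - p))) N).
  - apply Cmod_csum_le; intros i Hi.
    unfold f; rewrite (Cmult_comm (RtoC (INR (S i) ^ d))), (Cmult_comm (RtoC (INR (S i) ^ d))).
    match goal with |- Cmod (?x * ?a - ?y * ?a)%C <= _ =>
      replace (x * a - y * a)%C with (a * (x - y))%C by ring end.
    rewrite geometric_multiples by auto.
    rewrite Cmod_mult, Cmod_R, Rabs_pos_eq by (apply pow_le, pos_INR).
    assert (Hm := one_minus_pow_lower q (S i) Hq ltac:(lia)); fold p in Hm.
    assert (Hnz : (1 - q ^ S i)%C <> 0) by (apply Cmod_gt_0; lra).
    apply Rmult_le_compat; [apply pow_le, pos_INR|apply Cmod_ge_0| |].
    + apply pow_incr; split; [apply pos_INR|apply le_INR; lia].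
    + rewrite Cmod_div, Cmod_pow by auto; fold p; unfold Rdiv.
      apply Rmult_le_compat; [apply pow_le; auto|left; apply Rinv_0_lt_compat; lra| |].
      * assert (Hd0 := Nat.div_mod_eq N (S i)).
        assert (Hr0 := Nat.mod_upper_bound N (S i) ltac:(lia)).
        assert (He : (N <= S i * S (N / S i))%nat) by nia.
        replace (S i * S (N / S i))%nat with (N + (S i * S (N / S i) - N))%nat by lia.
        rewrite pow_add; rewrite <- (Rmult_1_r (p ^ N)) at 2.
        apply Rmult_le_compat_l; [apply pow_le; auto|].
        rewrite <- (pow1 (S i * S (N / S i) - N)); apply pow_incr; lra.
      * apply Rinv_le_contravar; lra.
  - assert (Ec : forall c M, rsum (fun _ => c) M = INR M * c).
    { intros c M; induction M as [|M IH]; [simpl; ring|].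
      cbn [rsum]; rewrite IH, S_INR; ring. }
    rewrite Ec; specialize (HK N); rewrite <- tech_pow_Rmult in HK.
    rewrite Rpow_mult_distr.
    assert (H0 : 0 <= p ^ N * / (1 - p)).
    { apply Rmult_le_pos; [apply pow_le; auto|left; apply Rinv_0_lt_compat; lra]. }
    nra. }
apply (Ccv_ext (fun N => (csum f N - csum (fun n => RtoC (divisor_sum d n) * q ^ n) (S N))
   + csum (fun n => RtoC (divisor_sum d n) * q ^ n) (S N))%C).
- intros N; ring.
- replace (gs d q) with (0 + gs d q)%C by ring; apply Ccv_plus; auto.
Qed.

Lemma geom_inner (q : C) (m : nat) : Cmod q < 1 -> (1 <= m)%nat ->
  Ccv (csum (fun r => q ^ (m * S r))%C) (q ^ m / (1 - q ^ m)).
Proof.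
intros Hq Hm.
assert (H1 := one_minus_pow_lower q m Hq Hm).
assert (Hnz : (1 - q ^ m)%C <> 0) by (apply Cmod_gt_0; lra).
assert (Hw : 0 <= Cmod (q ^ m) < 1).
{ split; [apply Cmod_ge_0|]; rewrite Cmod_pow; destruct m as [|m]; [lia|].
  apply pow_lt_1_compat; [split; [apply Cmod_ge_0|auto]|lia]. }
set (w := (q ^ m)%C) in *.
assert (E : forall N, csum (fun r => q ^ (m * S r))%C N = (w / (1 - w) - w / (1 - w) * w ^ N)%C).
{ induction N as [|N IH]; [simpl; field; auto|].
  cbn [csum]; rewrite IH, Cpow_mult_r; fold w; rewrite !(Cpow_S w); field; auto. }
apply (Ccv_squeeze _ _ (fun N => Cmod (w / (1 - w)) * Cmod w ^ N)).
- intros N; rewrite E.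
  replace (w / (1 - w) - w / (1 - w) * w ^ N - w / (1 - w))%C with (- (w / (1 - w) * w ^ N))%C by ring.
  rewrite Cmod_opp, Cmod_mult, Cmod_pow; lra.
- apply lim0_scal, pow_lim0, Hw.
Qed.

Lemma Cmod_nome (tau : C) : Cmod (nome tau) = exp (- (2 * PI) * Im tau).
Proof.
unfold nome; rewrite Cmod_Cexp; f_equal; destruct tau as [x y]; simpl; ring.
Qed.

Lemma Cmod_nome_lt (tau : C) : in_H tau -> Cmod (nome tau) < 1.
Proof.
intros H; unfold in_H in H; rewrite Cmod_nome, <- exp_0; apply exp_increasing.
assert (HPI := PI_RGT_0); nra.
Qed.

Lemma eisenstein_gs (k : nat) (tau : C) : (3 <= k)%nat -> Nat.Odd k -> in_H tau ->
  eisenstein k tau = gs (k - 1) (nome tau).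
Proof.
intros Hk Hodd Ht; unfold eisenstein; rewrite bernoulli_odd by auto.
unfold Rdiv; rewrite Rmult_0_l, Ropp_0, Cplus_0_l.
assert (Hq := Cmod_nome_lt _ Ht).
apply CSeries_Ccv; eapply Ccv_ext; [|exact (lambert_series (k - 1) _ Hq)].
intros N; apply csum_ext; intros i _; symmetry; apply CSeries_Ccv.
eapply Ccv_ext; [|exact (Ccv_scal (RtoC (INR (S i) ^ (k - 1))) _ _ (geom_inner (nome tau) (S i) Hq ltac:(lia)))].
intros n; simpl; rewrite <- csum_scal; reflexivity.
Qed.

(** * Comparison of the divisor series with the polylogarithm *)

Definition plr (d : nat) (p : R) : R := Re (pl d (RtoC p)).

Lemma plr_partial (d N : nat) (p : R) : 0 <= p < 1 ->
  rsum (fun n => INR n ^ d * p ^ n) N <= plr d p.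
Proof.
intros Hp.
assert (H := pl_Ccv d (RtoC p) ltac:(rewrite Cmod_R, Rabs_pos_eq; lra)).
assert (Hge : forall n, (N <= n)%nat ->
  rsum (fun n => INR n ^ d * p ^ n) N <= rsum (fun n => INR n ^ d * p ^ n) n).
{ intros n Hn; replace n with (N + (n - N))%nat by lia; rewrite rsum_add.
  assert (0 <= rsum (fun i => INR (N + i) ^ d * p ^ (N + i)) (n - N)); [|lra].
  apply rsum_nonneg; intros i _; apply Rmult_le_pos; apply pow_le; [apply pos_INR|lra]. }
assert (E : forall n, csum (fun m => RtoC (INR m ^ d) * RtoC p ^ m)%C n =
  RtoC (rsum (fun n => INR n ^ d * p ^ n) n)).
{ intros n; rewrite <- csum_RtoC; apply csum_ext; intros i _; rewrite RtoC_mult, (RtoC_pow p); reflexivity. }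
set (A := rsum (fun n => INR n ^ d * p ^ n) N) in *.
apply Rnot_lt_le; intros Hlt.
assert (He : 0 < A - plr d p) by lra.
destruct (H (fun y => y < A - plr d p)) as [M HM].
{ exists (mkposreal _ He); intros y Hy; change (Rabs (y - 0) < A - plr d p) in Hy.
  apply Rabs_lt_between in Hy; lra. }
specialize (HM (max M N) ltac:(lia)); specialize (Hge (max M N) ltac:(lia)).
rewrite E in HM.
set (T := rsum (fun n => INR n ^ d * p ^ n) (max M N)) in *.
assert (H2 := re_le_Cmod (RtoC T - pl d (RtoC p))%C).
unfold Cminus in H2; rewrite re_plus, re_opp, re_RtoC in H2; fold (plr d p) in H2.
apply Rabs_le_between in H2; unfold Cminus in HM; lra.
Qed.

Lemma plr_eq (d : nat) (p : R) : pl d (RtoC p) = RtoC (plr d p).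
Proof.
apply injective_projections; [reflexivity|exact (PS_real (fun m => INR m ^ d) p)].
Qed.

(* m^d p^(rm) = r^-d (rm)^d p^(rm), and the rm are among all exponents. *)
Lemma pl_multiples_bound (d r N : nat) (p : R) : 0 <= p < 1 ->
  rsum (fun i => INR (S i) ^ d * p ^ (S r * S i)) N <= / INR (S r) ^ d * plr d p.
Proof.
intros Hp.
assert (Hr : 0 < INR (S r) ^ d) by (apply pow_lt, lt_0_INR; lia).
assert (G : forall N, rsum (fun i => INR (S r * S i) ^ d * p ^ (S r * S i)) N <=
  rsum (fun n => INR n ^ d * p ^ n) (S (S r * N))).
{ clear N; induction N as [|N IH].
  - apply (rsum_nonneg (fun n => INR n ^ d * p ^ n) (S (S r * 0))); intros i _; apply Rmult_le_pos; apply pow_le; [apply pos_INR|lra].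
  - replace (S (S r * S N)) with (S (S r * N) + S r)%nat by lia.
    rewrite rsum_add; cbn [rsum].
    replace (S (S r * N) + r)%nat with (S r * S N)%nat by lia.
    assert (0 <= rsum (fun i => INR (S (S r * N) + i) ^ d * p ^ (S (S r * N) + i)) r).
    { apply rsum_nonneg; intros i _; apply Rmult_le_pos; apply pow_le; [apply pos_INR|lra]. }
    cbn [rsum] in IH; lra. }
apply Rmult_le_reg_l with (INR (S r) ^ d); auto.
rewrite <- Rmult_assoc, Rinv_r, Rmult_1_l, <- rsum_scal by lra.
eapply Rle_trans; [|apply (plr_partial d (S (S r * N)) p Hp)].
eapply Rle_trans; [|apply G].
right; apply rsum_ext; intros i _; rewrite mult_INR, Rpow_mult_distr; ring.
Qed.

Lemma plr_nonneg (d : nat) (p : R) : 0 <= p < 1 -> 0 <= plr d p.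
Proof. intros Hp; apply (plr_partial d 0 p Hp). Qed.

Lemma pl_shift_Ccv (d : nat) (q : C) : (1 <= d)%nat -> Cmod q < 1 ->
  Ccv (csum (fun i => RtoC (INR (S i) ^ d) * q ^ S i)%C) (pl d q).
Proof.
intros Hd Hq; assert (H := pl_Ccv d q Hq); apply Ccv_shift in H.
eapply Ccv_ext; [|exact H]; intros n; cbv beta; rewrite csum_shift.
simpl INR; rewrite pow_i by lia; ring.
Qed.

(** For r = 1 and r = 2 these are the remainders of q^m / (1 - q^m) after one or two terms. The
    denominator costs 1 / (1 - |q|), and the restriction to exponents divisible by r + 1 gains (r +
    1)^-d. *)
Lemma gs_tail_bound (d r N : nat) (q : C) : Cmod q < 1 ->
  Cmod (csum (fun i => RtoC (INR (S i) ^ d) * (q ^ (S r * S i) / (1 - q ^ S i)))%C N) <=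
  / INR (S r) ^ d * plr d (Cmod q) / (1 - Cmod q).
Proof.
intros Hq; set (p := Cmod q) in *; assert (Hp : 0 <= p) by apply Cmod_ge_0.
apply Rle_trans with (rsum (fun i => / (1 - p) * (INR (S i) ^ d * p ^ (S r * S i))) N).
- apply Cmod_csum_le; intros i _.
  assert (Hm := one_minus_pow_lower q (S i) Hq ltac:(lia)); fold p in Hm.
  assert (Hnz : (1 - q ^ S i)%C <> 0) by (apply Cmod_gt_0; lra).
  rewrite Cmod_mult, Cmod_div, Cmod_pow, Cmod_R, Rabs_pos_eq by (auto; apply pow_le, pos_INR).
  fold p; unfold Rdiv.
  rewrite (Rmult_comm (/ (1 - p))), Rmult_assoc; apply Rmult_le_compat_l; [apply pow_le, pos_INR|].
  apply Rmult_le_compat_l; [apply pow_le; auto|apply Rinv_le_contravar; lra].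
- rewrite rsum_scal; unfold Rdiv; rewrite (Rmult_comm _ (/ (1 - p))).
  apply Rmult_le_compat_l; [left; apply Rinv_0_lt_compat; lra|].
  apply pl_multiples_bound; lra.
Qed.

Lemma gs_minus_pl (d : nat) (q : C) : (1 <= d)%nat -> Cmod q < 1 ->
  Cmod (gs d q - pl d q) <= / 2 ^ d * plr d (Cmod q) / (1 - Cmod q).
Proof.
intros Hd Hq.
assert (H := Ccv_minus _ _ _ _ (lambert_series d q Hq) (pl_shift_Ccv d q Hd Hq)).
replace (gs d q - pl d q)%C with (gs d q - pl d q - 0)%C by ring.
apply (Ccv_bound _ _ _ _ 0 H); intros N _.
assert (Hb := gs_tail_bound d 1 N q Hq); replace (INR 2) with 2 in Hb by (simpl; ring).
eapply Rle_trans; [|exact Hb]; right; f_equal.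
match goal with |- (?a - ?z)%C = _ => replace (a - z)%C with a by ring end.
rewrite <- csum_minus; apply csum_ext; intros i _.
assert (Hm := one_minus_pow_lower q (S i) Hq ltac:(lia)).
assert (Hnz : (1 - q ^ S i)%C <> 0) by (apply Cmod_gt_0; lra).
replace (2 * S i)%nat with (S i + S i)%nat by lia.
rewrite Cpow_add_r; field; exact Hnz.
Qed.

(** At rho the main term can cancel, and what is left is then of the same order as the bound of
    [gs_minus_pl]; one more term has to be split off. *)
Lemma gs_minus_pl_2 (d : nat) (q : C) : (1 <= d)%nat -> Cmod q < 1 ->
  Cmod (gs d q - (pl d q + pl d (q ^ 2))) <= / 3 ^ d * plr d (Cmod q) / (1 - Cmod q).
Proof.
intros Hd Hq.
assert (Hq2 : Cmod (q ^ 2) < 1).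
{ rewrite Cmod_pow; apply pow_lt_1_compat; [split; [apply Cmod_ge_0|auto]|lia]. }
assert (H := Ccv_minus _ _ _ _ (lambert_series d q Hq)
  (Ccv_plus _ _ _ _ (pl_shift_Ccv d q Hd Hq) (pl_shift_Ccv d _ Hd Hq2))).
replace (gs d q - (pl d q + pl d (q ^ 2)))%C with (gs d q - (pl d q + pl d (q ^ 2)) - 0)%C by ring.
apply (Ccv_bound _ _ _ _ 0 H); intros N _.
assert (Hb := gs_tail_bound d 2 N q Hq); replace (INR 3) with 3 in Hb by (simpl; ring).
eapply Rle_trans; [|exact Hb]; right; f_equal.
match goal with |- (?a - ?z)%C = _ => replace (a - z)%C with a by ring end.
cbv beta; rewrite <- csum_plus, <- csum_minus; apply csum_ext; intros i _.
assert (Hm := one_minus_pow_lower q (S i) Hq ltac:(lia)).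
assert (Hnz : (1 - q ^ S i)%C <> 0) by (apply Cmod_gt_0; lra).
rewrite <- Cpow_mult_r.
replace (3 * S i)%nat with (S i + S i + S i)%nat by lia.
replace (2 * S i)%nat with (S i + S i)%nat by lia.
rewrite !Cpow_add_r; field; exact Hnz.
Qed.

(** * Estimates from the Lipschitz formula *)

Lemma pow_le_half (x y : R) (h k : nat) :
  0 <= x -> x ^ 2 <= y -> y <= 1 -> (2 * h <= k)%nat -> x ^ k <= y ^ h.
Proof.
intros Hx Hxy Hy Hk.
assert (Hx1 : x <= 1) by nra.
replace k with (2 * h + (k - 2 * h))%nat by lia.
rewrite pow_add, pow_mult.
assert (H1 : (x ^ 2) ^ h <= y ^ h) by (apply pow_incr; split; [apply pow_le|]; auto).
assert (H2 : x ^ (k - 2 * h) <= 1) by (rewrite <- (pow1 (k - 2 * h)); apply pow_incr; lra).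
assert (H3 : 0 <= (x ^ 2) ^ h) by (apply pow_le, pow_le, Hx).
assert (H4 : 0 <= x ^ (k - 2 * h)) by (apply pow_le, Hx).
nra.
Qed.

Lemma bernoulli_inv_pow (y : R) (h : nat) : 0 <= y -> (/ (1 + y)) ^ h <= / (1 + INR h * y).
Proof.
intros Hy; rewrite pow_inv; apply Rinv_le_contravar.
- assert (H := pos_INR h); nra.
- induction h as [|h IH]; [simpl; lra|].
  rewrite S_INR, <- tech_pow_Rmult; assert (H := pos_INR h).
  assert (0 <= INR h * y * y) by (apply Rmult_le_pos; auto; apply Rmult_le_pos; auto).
  nra.
Qed.

Lemma rsum_telescope (L : nat) : rsum (fun i => / (INR (S (S i)) * INR (S i))) L <= 1.
Proof.
assert (H : rsum (fun i => / (INR (S (S i)) * INR (S i))) L = 1 - / INR (S L)).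
{ induction L as [|L IH]; [simpl; field|].
  cbn [rsum]; rewrite IH, (S_INR (S L)).
  assert (0 < INR (S L)) by (apply lt_0_INR; lia); field; lra. }
rewrite H; assert (0 < / INR (S L)) by (apply Rinv_0_lt_compat, lt_0_INR; lia); lra.
Qed.

Lemma Cmod2_shift (s : C) (y : R) :
  Cmod (s + Ci * RtoC y) ^ 2 = Cmod s ^ 2 + 2 * y * Im s + y ^ 2.
Proof. rewrite !Cmod2_alt; destruct s as [a b]; simpl; ring. Qed.

Lemma shifted_ratio (s : C) (y c : R) (h k : nat) : 0 < Re s -> 0 <= c ->
  c <= 2 * y * Im s + y ^ 2 -> (2 * h <= k)%nat ->
  (s + Ci * RtoC y)%C <> 0 /\
  Cmod (s ^ k / (s + Ci * RtoC y) ^ k) <= (Cmod s ^ 2 / (Cmod s ^ 2 + c)) ^ h.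
Proof.
intros Hs Hc Hy Hk.
assert (Ha : 0 < Cmod s).
{ apply Cmod_gt_0; intros E; rewrite E in Hs; simpl in Hs; lra. }
assert (Hnz : (s + Ci * RtoC y)%C <> 0).
{ intros E; apply (f_equal Re) in E; destruct s; simpl in *; lra. }
split; auto.
assert (Hm : 0 < Cmod (s + Ci * RtoC y)) by (apply Cmod_gt_0; auto).
assert (H2 := Cmod2_shift s y).
set (a := Cmod s) in *; set (b := Cmod (s + Ci * RtoC y)) in *.
assert (Ha2 : 0 < a ^ 2) by (apply pow_lt; auto).
rewrite Cmod_div, !Cmod_pow by (apply Cpow_nz; auto); fold a b.
replace (a ^ k / b ^ k) with ((a / b) ^ k).
2: { unfold Rdiv; rewrite Rpow_mult_distr, pow_inv; reflexivity. }
apply pow_le_half; auto.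
- left; apply Rdiv_lt_0_compat; auto.
- unfold Rdiv; rewrite Rpow_mult_distr, pow_inv; apply Rmult_le_compat_l; [lra|].
  apply Rinv_le_contravar; lra.
- apply Rmult_le_reg_r with (a ^ 2 + c); [lra|]; field_simplify; lra.
Qed.

(** The relative size of the Lipschitz terms with |n| >= 2, where a2 = |s|^2: for y = i + 2 and 0 <=
    Im s <= 1/2 one has |s +- i y|^2 >= |s|^2 + y (y - 1), and the factor 2 counts both signs. *)
Definition tail_bound (a2 : R) (h : nat) (T : R) : Prop :=
  forall L, rsum (fun i => 2 * (a2 / (a2 + INR (S (S i)) * INR (S i))) ^ h) L <= T.

(** Meant for |s|^2 up to the order of h: Bernoulli's inequality reduces the sum to a telescoping
    one. *)
Lemma tail_bound_large (a2 : R) (h : nat) : 0 < a2 -> (1 <= h)%nat ->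
  tail_bound a2 h (2 * a2 / INR h).
Proof.
intros Ha Hh L.
assert (Hh' : 0 < INR h) by (apply lt_0_INR; lia).
apply Rle_trans with (rsum (fun i => 2 * a2 / INR h * / (INR (S (S i)) * INR (S i))) L).
- apply rsum_le; intros i _; set (j := INR (S (S i)) * INR (S i)).
  assert (Hj : 0 < j) by (apply Rmult_lt_0_compat; apply lt_0_INR; lia).
  replace (a2 / (a2 + j)) with (/ (1 + j / a2)) by (field; lra).
  assert (Hja : 0 < j / a2) by (apply Rdiv_lt_0_compat; auto).
  apply Rle_trans with (2 * / (1 + INR h * (j / a2))).
  { apply Rmult_le_compat_l; [lra|]; apply bernoulli_inv_pow; lra. }
  replace (2 * a2 / INR h * / j) with (2 * / (INR h * (j / a2))) by (field; lra).
  apply Rmult_le_compat_l; [lra|]; apply Rinv_le_contravar; [|lra].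
  apply Rmult_lt_0_compat; auto.
- rewrite rsum_scal; assert (H := rsum_telescope L).
  assert (0 < 2 * a2 / INR h) by (apply Rdiv_lt_0_compat; lra); nra.
Qed.

(** Every ratio is at most 1/3 here: three factors give 1/27, and a fourth is kept for the
    telescoping sum. *)
Lemma tail_bound_small (a2 : R) (h : nat) : 0 < a2 <= 1 -> (4 <= h)%nat ->
  tail_bound a2 h (2 / 27).
Proof.
intros Ha Hh L.
apply Rle_trans with (rsum (fun i => 2 / 27 * / (INR (S (S i)) * INR (S i))) L).
- apply rsum_le; intros i _; set (j := INR (S (S i)) * INR (S i)).
  assert (Hj : 2 <= j).
  { unfold j; assert (2 <= INR (S (S i))) by (apply (le_INR 2); lia).
    assert (1 <= INR (S i)) by (apply (le_INR 1); lia); nra. }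
  set (x := a2 / (a2 + j)).
  assert (Hx : 0 <= x) by (left; apply Rdiv_lt_0_compat; lra).
  assert (Hxj : x <= / (1 + j)).
  { unfold x; apply Rmult_le_reg_r with ((a2 + j) * (1 + j)); [nra|].
    field_simplify; [|lra|lra]; nra. }
  assert (Hx3 : x <= / 3) by (eapply Rle_trans; [exact Hxj|apply Rinv_le_contravar; lra]).
  replace h with (1 + (3 + (h - 4)))%nat by lia; rewrite pow_add, pow_1.
  assert (H1 : x ^ (3 + (h - 4)) <= / 27).
  { rewrite pow_add.
    assert (x ^ 3 <= / 27) by (replace (/ 27) with ((/ 3) ^ 3) by field; apply pow_incr; lra).
    assert (x ^ (h - 4) <= 1) by (rewrite <- (pow1 (h - 4)); apply pow_incr; lra).
    assert (0 <= x ^ 3) by (apply pow_le; auto).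
    assert (0 <= x ^ (h - 4)) by (apply pow_le; auto); nra. }
  assert (H2 : / (1 + j) <= / j) by (apply Rinv_le_contravar; lra).
  assert (0 <= x ^ (3 + (h - 4))) by (apply pow_le; auto).
  assert (0 < / j) by (apply Rinv_0_lt_compat; lra).
  nra.
- rewrite rsum_scal; assert (H := rsum_telescope L); nra.
Qed.

(** For 0 <= Im s <= 1/2 the terms at s and s - i dominate. The term at s + i is next, with its own
    error, and all others go into [tail_bound]. *)
Lemma lipsum_main (s : C) (h k : nat) (T : R) : 0 < Re s -> 0 <= Im s <= 1 / 2 ->
  (2 * h <= k)%nat -> tail_bound (Cmod s ^ 2) h T -> forall L, (1 <= L)%nat ->
  Cmod (s ^ k * lipsum k s L - (1 + s ^ k / (s - Ci) ^ k)) <=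
  (Cmod s ^ 2 / (Cmod s ^ 2 + 1)) ^ h + T.
Proof.
intros Hs Hi Hk HT [|L] HL; [lia|].
unfold lipsum; rewrite csum_shift.
assert (Hsnz : (s ^ k)%C <> 0).
{ apply Cpow_nz; intros E; rewrite E in Hs; simpl in Hs; lra. }
simpl (INR 1); rewrite !Cmult_1_r.
set (R1 := csum _ L).
replace (s ^ k * (/ s ^ k + (/ (s + Ci) ^ k + / (s - Ci) ^ k + R1)) - (1 + s ^ k / (s - Ci) ^ k))%C
  with (s ^ k / (s + Ci) ^ k + s ^ k * R1)%C.
2: { transitivity (s ^ k * / s ^ k + s ^ k * (/ (s + Ci) ^ k + / (s - Ci) ^ k + R1)
       - (1 + s ^ k / (s - Ci) ^ k))%C; [|ring].
     rewrite Cinv_r by auto; unfold Cdiv; ring. }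
eapply Rle_trans; [apply Cmod_triangle|]; apply Rplus_le_compat.
- destruct (shifted_ratio s 1 1 h k) as [_ H]; auto; try lra; try nra.
  rewrite Cmult_1_r in H; exact H.
- unfold R1; rewrite <- csum_scal.
  eapply Rle_trans; [apply Cmod_csum_le|apply (HT L)].
  intros i _; cbv beta; set (y := INR (S (S i))).
  assert (Hy : 1 <= y) by (apply (le_INR 1); lia).
  assert (Ey : INR (S i) = y - 1) by (unfold y; rewrite (S_INR (S i)); ring).
  rewrite Ey.
  assert (Hc : 0 <= y * (y - 1)) by nra.
  destruct (shifted_ratio s y (y * (y - 1)) h k) as [_ H1]; auto; try nra.
  destruct (shifted_ratio s (- y) (y * (y - 1)) h k) as [_ H2]; auto; try nra.
  rewrite RtoC_opp in H2; replace (s + Ci * - y)%C with (s - Ci * y)%C in H2 by ring.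
  rewrite Cmult_plus_distr_l.
  eapply Rle_trans; [apply Cmod_triangle|]; unfold Cdiv in H1, H2; lra.
Qed.

(* The nome of tau = i s. *)
Definition nom (s : C) : C := Cexp (- (RtoC (2 * PI) * s)).

Lemma Cmod_nom (s : C) : Cmod (nom s) = exp (- (2 * PI * Re s)).
Proof. unfold nom; rewrite Cmod_Cexp, re_opp, re_scal_l; reflexivity. Qed.

Lemma pl_main (s : C) (h d : nat) (T : R) : 0 < Re s -> 0 <= Im s <= 1 / 2 ->
  (2 <= d)%nat -> (2 * h <= S d)%nat -> tail_bound (Cmod s ^ 2) h T ->
  Cmod (s ^ S d * pl d (nom s) - lipconst d * (1 + s ^ S d / (s - Ci) ^ S d)) <=
  lipconst d * ((Cmod s ^ 2 / (Cmod s ^ 2 + 1)) ^ h + T).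
Proof.
intros Hs Hi Hd Hk HT.
assert (HL := lipschitz_formula d s Hd Hs ltac:(rewrite Rabs_pos_eq; lra)).
apply (Ccv_scal (s ^ S d)) in HL.
apply (Ccv_bound _ _ _ _ 1 HL); intros L HL1; cbv beta.
replace (s ^ S d * (lipconst d * lipsum (S d) s L) - lipconst d * (1 + s ^ S d / (s - Ci) ^ S d))%C
  with (lipconst d * (s ^ S d * lipsum (S d) s L - (1 + s ^ S d / (s - Ci) ^ S d)))%C by ring.
assert (HC := lipconst_pos d).
rewrite Cmod_mult, Cmod_R, Rabs_pos_eq by lra.
apply Rmult_le_compat_l; [lra|]; apply lipsum_main; auto.
Qed.

Lemma nom_real (t : R) : nom (RtoC t) = RtoC (exp (- (2 * PI * t))).
Proof.
unfold nom; rewrite <- RtoC_mult, <- RtoC_opp, Cexp_cis.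
simpl; rewrite cis_0, Cmult_1_r; reflexivity.
Qed.

(** At a positive q only the term n = 0 is a main term. Such bounds at |q| feed [gs_error], which
    controls the part of the series beyond [pl]. *)
Lemma plr_upper (t : R) (h d : nat) (T : R) : 0 < t -> (2 <= d)%nat -> (2 * h <= S d)%nat ->
  (forall L, rsum (fun i => 2 * (t ^ 2 / (t ^ 2 + INR (S i) ^ 2)) ^ h) L <= T) ->
  t ^ S d * plr d (exp (- (2 * PI * t))) <= lipconst d * (1 + T).
Proof.
intros Ht Hd Hk HT.
assert (HL := lipschitz_formula d (RtoC t) Hd Ht ltac:(simpl; rewrite Rabs_R0; lra)).
fold (nom t) in HL; rewrite nom_real in HL.
apply (Ccv_scal (RtoC t ^ S d)) in HL.
assert (HC := lipconst_pos d).
assert (Htn : (RtoC t ^ S d)%C <> 0) by (apply Cpow_nz, RtoC_neq; lra).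
assert (H : Cmod (RtoC t ^ S d * pl d (RtoC (exp (- (2 * PI * t)))) - lipconst d) <= lipconst d * T).
{ apply (Ccv_bound _ _ _ _ 0 HL); intros L _; cbv beta.
  unfold lipsum; set (R1 := csum _ L).
  replace (RtoC t ^ S d * (lipconst d * (/ RtoC t ^ S d + R1)) - lipconst d)%C
    with (lipconst d * (RtoC t ^ S d * R1))%C.
  2: { transitivity (lipconst d * (RtoC t ^ S d * / RtoC t ^ S d) + lipconst d * (RtoC t ^ S d * R1)
         - lipconst d)%C; [rewrite Cinv_r by auto; ring|ring]. }
  rewrite Cmod_mult, Cmod_R, Rabs_pos_eq by lra.
  apply Rmult_le_compat_l; [lra|].
  unfold R1; rewrite <- csum_scal.
  eapply Rle_trans; [apply Cmod_csum_le|apply (HT L)].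
  intros i _; cbv beta; set (y := INR (S i)).
  assert (Et : Cmod (RtoC t) = t) by (rewrite Cmod_R, Rabs_pos_eq; lra).
  assert (Ei : Im (RtoC t) = 0) by reflexivity.
  assert (Hy0 : 0 <= y ^ 2) by apply pow2_ge_0.
  destruct (shifted_ratio (RtoC t) y (y ^ 2) h (S d)) as [_ H1]; auto; try (rewrite Ei; lra).
  destruct (shifted_ratio (RtoC t) (- y) (y ^ 2) h (S d)) as [_ H2]; auto; try (rewrite Ei; nra).
  rewrite Et in H1, H2.
  rewrite RtoC_opp in H2; replace (t + Ci * - y)%C with (t - Ci * y)%C in H2 by ring.
  rewrite Cmult_plus_distr_l.
  eapply Rle_trans; [apply Cmod_triangle|]; unfold Cdiv in H1, H2; lra. }
rewrite plr_eq, <- RtoC_pow, <- RtoC_mult, <- RtoC_minus, Cmod_R in H.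
apply Rabs_le_between in H; lra.
Qed.

Lemma plr_upper_large (t : R) (h d : nat) : 0 < t -> (1 <= h)%nat -> (2 <= d)%nat -> (2 * h <= S d)%nat ->
  t ^ S d * plr d (exp (- (2 * PI * t))) <= lipconst d * (1 + 4 * t ^ 2 / INR h).
Proof.
intros Ht Hh Hd Hk; apply (plr_upper t h); auto; intros L.
assert (Hh' : 0 < INR h) by (apply lt_0_INR; lia).
assert (Ht2 : 0 < t ^ 2) by (apply pow_lt; auto).
apply Rle_trans with (rsum (fun i => 2 * t ^ 2 / INR h * / INR (S i) ^ 2) L).
- apply rsum_le; intros i _.
  assert (Hj : 0 < INR (S i) ^ 2) by (apply pow_lt, lt_0_INR; lia); set (j := INR (S i) ^ 2) in *.
  set (a2 := t ^ 2) in *.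
  replace (a2 / (a2 + j)) with (/ (1 + j / a2)) by (field; lra).
  assert (Hja : 0 < j / a2) by (apply Rdiv_lt_0_compat; auto).
  apply Rle_trans with (2 * / (1 + INR h * (j / a2))).
  { apply Rmult_le_compat_l; [lra|]; apply bernoulli_inv_pow; lra. }
  replace (2 * a2 / INR h * / j) with (2 * / (INR h * (j / a2))) by (field; lra).
  apply Rmult_le_compat_l; [lra|]; apply Rinv_le_contravar; [|lra].
  apply Rmult_lt_0_compat; auto.
- rewrite rsum_scal; assert (H := rsum_inv_sqr L).
  assert (0 < 2 * t ^ 2 / INR h) by (apply Rdiv_lt_0_compat; lra).
  replace (4 * t ^ 2 / INR h) with (2 * t ^ 2 / INR h * 2) by (field; lra); nra.
Qed.

Lemma plr_upper_small (t : R) (h d : nat) : 0 < t -> (1 <= h)%nat -> (2 <= d)%nat -> (2 * h <= S d)%nat ->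
  t ^ S d * plr d (exp (- (2 * PI * t))) <=
  lipconst d * (1 + 4 * t ^ 2 * (t ^ 2 / (t ^ 2 + 1)) ^ (h - 1)).
Proof.
intros Ht Hh Hd Hk; apply (plr_upper t h); auto; intros L.
assert (Ht2 : 0 < t ^ 2) by (apply pow_lt; auto); set (a2 := t ^ 2) in *.
set (c := (a2 / (a2 + 1)) ^ (h - 1)).
assert (Hc : 0 <= c) by (apply pow_le; left; apply Rdiv_lt_0_compat; lra).
apply Rle_trans with (rsum (fun i => 2 * a2 * c * / INR (S i) ^ 2) L).
- apply rsum_le; intros i _.
  assert (Hj : 1 <= INR (S i) ^ 2).
  { assert (1 <= INR (S i)) by (apply (le_INR 1); lia); nra. }
  set (j := INR (S i) ^ 2) in *.
  replace h with (1 + (h - 1))%nat at 1 by lia; rewrite pow_add, pow_1.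
  assert (H1 : (a2 / (a2 + j)) ^ (h - 1) <= c).
  { apply pow_incr; split; [left; apply Rdiv_lt_0_compat; lra|].
    apply Rmult_le_compat_l; [lra|apply Rinv_le_contravar; lra]. }
  assert (H2 : a2 / (a2 + j) <= a2 * / j).
  { apply Rmult_le_compat_l; [lra|apply Rinv_le_contravar; lra]. }
  assert (H3 : 0 <= (a2 / (a2 + j)) ^ (h - 1)) by (apply pow_le; left; apply Rdiv_lt_0_compat; lra).
  assert (H4 : 0 <= a2 / (a2 + j)) by (left; apply Rdiv_lt_0_compat; lra).
  replace (2 * a2 * c * / j) with (2 * ((a2 * / j) * c)) by ring.
  apply Rmult_le_compat_l; [lra|]; apply Rmult_le_compat; auto.
- rewrite rsum_scal; assert (H := rsum_inv_sqr L).
  assert (0 <= 2 * a2 * c) by (apply Rmult_le_pos; lra).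
  replace (4 * a2 * c) with (2 * a2 * c * 2) by ring; nra.
Qed.

(* With k = d + 1: 2^-d t^-k |s|^k = 2 (|s| / 2t)^k. *)
Lemma gs_error (s : C) (h d : nat) (S0 : R) : 0 < Re s -> (1 <= d)%nat -> (2 * h <= S d)%nat ->
  exp (- (2 * PI * Re s)) <= 1 / 8 -> Cmod s ^ 2 / (4 * Re s ^ 2) <= 1 ->
  Re s ^ S d * plr d (exp (- (2 * PI * Re s))) <= lipconst d * S0 ->
  Cmod (s ^ S d * (gs d (nom s) - pl d (nom s))) <=
  lipconst d * (16 / 7 * (Cmod s ^ 2 / (4 * Re s ^ 2)) ^ h * S0).
Proof.
intros Hs Hd Hk Hp Hkap HS.
assert (Hep := exp_pos (- (2 * PI * Re s))).
assert (Hq : Cmod (nom s) < 1) by (rewrite Cmod_nom; lra).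
assert (H := gs_minus_pl d (nom s) Hd Hq); rewrite Cmod_nom in H.
set (t := Re s) in *; set (p := exp (- (2 * PI * t))) in *.
assert (Ht : 0 < t ^ S d) by (apply pow_lt; auto).
assert (HC := lipconst_pos d).
assert (Hpl := plr_nonneg d p ltac:(lra)).
rewrite Cmod_mult, Cmod_pow.
set (a := Cmod s) in *; assert (Ha : 0 <= a) by apply Cmod_ge_0.
apply Rle_trans with (a ^ S d * (/ 2 ^ d * (lipconst d * S0 / t ^ S d) * (8 / 7))).
{ apply Rmult_le_compat_l; [apply pow_le; auto|].
  eapply Rle_trans; [exact H|]; unfold Rdiv at 1.
  assert (H2 : 0 < / 2 ^ d) by (apply Rinv_0_lt_compat, pow_lt; lra).
  assert (Hpl2 : plr d p <= lipconst d * S0 / t ^ S d).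
  { apply Rmult_le_reg_l with (t ^ S d); auto.
    replace (t ^ S d * (lipconst d * S0 / t ^ S d)) with (lipconst d * S0) by (field; lra); exact HS. }
  apply Rmult_le_compat.
  - apply Rmult_le_pos; lra.
  - left; apply Rinv_0_lt_compat; lra.
  - apply Rmult_le_compat_l; lra.
  - replace (8 / 7) with (/ (7 / 8)) by field; apply Rinv_le_contravar; lra. }
assert (Hs0 : 0 <= S0).
{ assert (0 <= t ^ S d * plr d p) by (apply Rmult_le_pos; lra); nra. }
replace (a ^ S d * (/ 2 ^ d * (lipconst d * S0 / t ^ S d) * (8 / 7))) with
  (lipconst d * (16 / 7 * (a / (2 * t)) ^ S d * S0)).
2: { unfold Rdiv; rewrite (Rpow_mult_distr a), pow_inv, (Rpow_mult_distr 2).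
     rewrite <- (tech_pow_Rmult 2 d).
     assert (0 < 2 ^ d) by (apply pow_lt; lra); field; split; lra. }
apply Rmult_le_compat_l; [lra|]; apply Rmult_le_compat_r; auto.
apply Rmult_le_compat_l; [lra|].
apply pow_le_half; auto.
- apply Rmult_le_pos; auto; left; apply Rinv_0_lt_compat; lra.
- right; field; lra.
Qed.

(** * The circle through an extremal point *)

(** The Taylor polynomial of degree 4 shows cos 1.6 < 0, whereas cos is nonnegative up to pi / 2. *)
Lemma PI_lt_3_2 : PI < 3.2.
Proof.
apply Rnot_le_lt; intros H.
assert (H1 := cos_ge_0 1.6 ltac:(lra) ltac:(lra)).
destruct (pre_cos_bound 1.6 0) as [_ H2]; try lra.
unfold cos_approx, cos_term in H2; simpl in H2; lra.
Qed.

Lemma PI_gt_3 : 3 < PI.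
Proof. assert (H := PI2_3_2); lra. Qed.

Lemma atan_le_id (x : R) : Rabs (atan x) <= Rabs x.
Proof.
destruct (MVT_gen atan 0 x (fun y => / (1 + y²))) as [c [_ Hc]].
- intros y _; apply is_derive_atan.
- intros y _; apply derivable_continuous_pt, derivable_pt_atan.
- rewrite atan_0, !Rminus_0_r in Hc; rewrite Hc, Rabs_mult.
  rewrite <- (Rmult_1_l (Rabs x)) at 2; apply Rmult_le_compat_r; [apply Rabs_pos|].
  assert (H := Rle_0_sqr c).
  rewrite Rabs_pos_eq; [rewrite <- Rinv_1; apply Rinv_le_contravar; lra|].
  left; apply Rinv_0_lt_compat; lra.
Qed.

(** 0.74 bounds 3 pi / 13 when pi < 3.2; the other constants come from 1 - 0.74^2 / 6 > 0.908 and 1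
    - 0.74^2 / 2 > 0.726. *)
Lemma trig_bounds (x : R) : 0 < x <= 0.74 ->
  0.908 * x <= sin x /\ 0 < sin x <= 0.74 /\ 0.726 <= cos x /\ sin x ^ 2 + cos x ^ 2 = 1.
Proof.
intros Hx; assert (HPI := PI_gt_3).
assert (H1 := sin_cubic_lower x ltac:(lra)).
assert (H2 := sin_le_id x ltac:(lra)).
assert (H3 := one_minus_cos x).
assert (H4 := sin_le_id (x / 2) ltac:(lra)).
assert (H5 : 0 <= sin (x / 2)) by (apply sin_ge_0; lra).
assert (H6 := sin2_cos2 x); unfold Rsqr in H6.
assert (Hx2 : x ^ 2 <= 0.5476) by nra.
assert (Hlow : 0.908 * x <= sin x).
{ eapply Rle_trans; [|exact H1]; simpl in *; nra. }
repeat split; try lra.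
assert (sin (x / 2) ^ 2 <= (x / 2) ^ 2) by (apply pow_incr; lra).
nra.
Qed.

(* The point i s = tau with Re tau = -1/2 and arg s = delta. *)
Definition height (delta : R) : R := cos delta / (2 * sin delta).

(** With s = t + i / 2 of argument delta: |s| = 1 / (2 sin delta) and |s| / (2 t) = 1 / (2 cos
    delta), the base of the error in [gs_error]. *)
Lemma height_facts (delta : R) : 0 < delta <= 0.74 ->
  0.5 < height delta /\ height delta ^ 2 + 1 / 4 = / (4 * sin delta ^ 2) /\
  (height delta ^ 2 + 1 / 4) / (4 * height delta ^ 2) <= 0.475 /\
  exp (- (2 * PI * height delta)) <= 1 / 8.
Proof.
intros Hd; destruct (trig_bounds delta Hd) as [_ [Hs [Hc H1]]].
unfold height; set (s := sin delta) in *; set (c := cos delta) in *.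
assert (Ht : 0.5 < c / (2 * s)).
{ destruct (Rlt_le_dec 0.5 (c / (2 * s))) as [|H]; auto.
  apply (Rmult_le_compat_r (2 * s)) in H; [|lra].
  replace (c / (2 * s) * (2 * s)) with c in H by (field; lra).
  assert (s ^ 2 <= 1 - 0.726 ^ 2) by nra; nra. }
split; auto; split; [|split].
- replace ((c / (2 * s)) ^ 2 + 1 / 4) with ((s ^ 2 + c ^ 2) / (4 * s ^ 2)) by (field; lra).
  rewrite H1; field; lra.
- replace (((c / (2 * s)) ^ 2 + 1 / 4) / (4 * (c / (2 * s)) ^ 2)) with
    ((s ^ 2 + c ^ 2) / (4 * c ^ 2)) by (field; lra).
  rewrite H1; apply Rmult_le_reg_r with (4 * c ^ 2); [nra|].
  field_simplify; [nra|lra].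
- assert (HPI := PI_gt_3); rewrite exp_Ropp.
  replace (1 / 8) with (/ 8) by field; apply Rinv_le_contravar; [lra|].
  apply Rle_trans with (exp 3).
  + replace 3 with (1 + 1 + 1) by ring; rewrite !exp_plus.
    assert (H := exp_ineq1_le 1); nra.
  + left; apply exp_increasing.
    set (t := c / (2 * s)) in *; nra.
Qed.

Lemma Cmod2_conj_mult (z w : C) : w <> 0 -> (z / w)%C = (RtoC (/ Cmod w ^ 2) * (z * Cconj w))%C.
Proof.
intros Hw; assert (H := Cmod2_conj w).
assert (Hm : Cmod w ^ 2 <> 0) by (apply pow_nonzero; apply Cmod_gt_0 in Hw; lra).
rewrite RtoC_inv by auto.
assert (Hm' := RtoC_neq _ Hm).
assert (E : (RtoC (Cmod w ^ 2) = w * Cconj w)%C) by (rewrite <- H; reflexivity).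
assert (Hc : Cconj w <> 0) by (intros E0; rewrite E0, Cmult_0_r in E; auto).
rewrite E; field; auto.
Qed.

Lemma polar_height (delta : R) : 0 < delta <= 0.74 ->
  ((height delta, 1 / 2) : C) = (RtoC (/ (2 * sin delta)) * cis delta)%C.
Proof.
intros Hd; destruct (trig_bounds delta Hd) as [_ [Hs _]].
unfold height, cis; apply injective_projections; simpl; field; lra.
Qed.

(* zeta = (s / (s - i)) e^{-2 i delta}. Moving away from Re tau = -1/2 horizontally decreases |zeta| to first order,
   but changes its argument only to second order. *)
Lemma ratio_lower (delta y : R) (h k M : nat) :
  PI / 6 <= delta <= 0.74 -> INR k * delta = INR M * PI -> 0 <= y <= 1 / 2 ->
  (4 <= h)%nat -> (k = 2 * h + 1)%nat ->
  let s := (height delta, y) : C in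
  - (1 / 2) <= Re (s ^ k / (s - Ci) ^ k).
Proof.
intros Hd HM Hy Hh Hk s; assert (HPI := PI_gt_3); assert (HPI' := PI_lt_3_2).
assert (Hd0 : 0 < delta <= 0.74) by lra.
destruct (trig_bounds delta Hd0) as [_ [Hsin _]].
destruct (height_facts delta Hd0) as [Ht [Hrho _]].
assert (Hpol := polar_height delta Hd0).
assert (Hsin2 : 1 / 2 <= sin delta).
{ rewrite <- sin_PI6; destruct (Req_dec delta (PI / 6)) as [->|]; [lra|].
  left; apply sin_increasing_1; lra. }
set (t := height delta) in *.
set (s0 := (t, 1 / 2) : C) in *.
set (A := t ^ 2 + 1 / 4) in *.
assert (HA : A <= 1).
{ rewrite Hrho; apply Rle_trans with (/ 1); [apply Rinv_le_contravar; nra|lra]. }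
assert (HA2 : 1 / 2 < A) by (unfold A; nra).
set (x := 1 / 2 - y) in *.
set (num := (s * Cconj s0)%C); set (den := ((s - Ci) * s0)%C).
assert (Enum : num = (A - x / 2, - (t * x))) by
  (unfold num, s, s0, A, x; apply injective_projections; simpl; field).
assert (Eden : den = (A + x / 2, - (t * x))) by
  (unfold den, s, s0, A, x; apply injective_projections; simpl; field).
assert (Hs0 : s0 <> 0).
{ intros E; apply (f_equal Re) in E; simpl in E; lra. }
assert (Hcs0 : Cconj s0 <> 0).
{ intros E; apply (f_equal Re) in E; simpl in E; lra. }
assert (Hsi : (s - Ci)%C <> 0).
{ intros E; apply (f_equal Re) in E; simpl in E; lra. }
assert (Hden : den <> 0) by (apply Cmult_neq_0; auto).
(* Since k delta = M pi, the power s0^k is real; this is where the factor e^(-2 i delta) of zeta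
   disappears. *)
assert (Hcis : (s0 ^ k = Cconj s0 ^ k)%C).
{ rewrite Hpol, Cmult_conj.
  replace (Cconj (RtoC (/ (2 * sin delta)))) with (RtoC (/ (2 * sin delta)))
    by (apply injective_projections; simpl; ring).
  rewrite !Cpow_mult_l; f_equal; rewrite <- cis_opp, !cis_pow.
  rewrite Ropp_mult_distr_r_reverse, HM.
  replace (INR M * PI) with (- (INR M * PI) + 2 * INR M * PI) at 1 by ring.
  apply cis_2PI. }
set (zeta := (num / den)%C).
assert (Ez : (s ^ k / (s - Ci) ^ k = zeta ^ k)%C).
{ unfold zeta, Cdiv; rewrite Cpow_mult_l, Cpow_inv by auto.
  unfold num, den; rewrite !Cpow_mult_l, Hcis.
  field; split; apply Cpow_nz; auto. }
rewrite Ez.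
assert (Hn2 : Cmod num ^ 2 = (A - x / 2) ^ 2 + (t * x) ^ 2).
{ rewrite Cmod2_alt, Enum; simpl; ring. }
assert (Hd2 : Cmod den ^ 2 = (A + x / 2) ^ 2 + (t * x) ^ 2).
{ rewrite Cmod2_alt, Eden; simpl; ring. }
assert (Hx : 0 <= x <= 1 / 2) by (unfold x; lra).
set (n2 := (A - x / 2) ^ 2 + (t * x) ^ 2) in *.
set (d2 := (A + x / 2) ^ 2 + (t * x) ^ 2) in *.
assert (Hn2p : 0 < n2) by (unfold n2; nra).
assert (Hdn : d2 = n2 + 2 * A * x) by (unfold n2, d2; field).
assert (Hzm : Cmod zeta ^ 2 = n2 / d2).
{ unfold zeta; rewrite Cmod_div by auto; unfold Rdiv.
  rewrite Rpow_mult_distr, pow_inv, Hn2, Hd2; reflexivity. }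
assert (Hhk : INR k = 2 * INR h + 1) by (rewrite Hk, plus_INR, mult_INR; simpl; ring).
assert (Hh4 : 4 <= INR h) by (apply (le_INR 4) in Hh; simpl in Hh; lra).
(* Far from the line, |zeta|^k is at most 1/2. Near it, k times the argument of zeta is at most 1 in
   absolute value, so the real part of zeta^k is nonnegative. *)
destruct (Rle_lt_dec n2 (INR h * (2 * A * x))) as [Hc|Hc].
- assert (Hsmall : Cmod (zeta ^ k) <= 1 / 2).
  { rewrite Cmod_pow.
    assert (Hax : 0 <= 2 * A * x) by (apply Rmult_le_pos; lra).
    assert (Hw : 0 <= 2 * A * x / n2) by (apply Rmult_le_pos; [auto|left; apply Rinv_0_lt_compat; auto]).
    apply Rle_trans with ((/ (1 + 2 * A * x / n2)) ^ h).
    - apply pow_le_half; [apply Cmod_ge_0| | |lia].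
      + rewrite Hzm, Hdn; right; field; split; lra.
      + rewrite <- Rinv_1; apply Rinv_le_contravar; lra.
    - eapply Rle_trans; [apply bernoulli_inv_pow; auto|].
      replace (1 / 2) with (/ 2) by field; apply Rinv_le_contravar; [lra|].
      assert (1 <= INR h * (2 * A * x / n2)); [|lra].
      apply Rmult_le_reg_r with n2; auto.
      replace (INR h * (2 * A * x / n2) * n2) with (INR h * (2 * A * x)) by (field; lra); lra. }
  assert (H := re_le_Cmod (zeta ^ k)); apply Rabs_le_between in H; lra.
(* In this case x is at most of order A / (2 h), while the argument of zeta is at most t x^2 / A^2;
   this gains a full factor h. *)
- assert (HxA : x * (2 * INR h - 1 / 2) <= A).
  { assert (n2 <= A ^ 2 + A * x / 2).
    { unfold n2; assert (t ^ 2 <= A) by (unfold A; lra).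
      assert (x ^ 2 <= x / 2) by nra.
      assert ((t * x) ^ 2 <= A * x / 2) by nra.
      assert ((A - x / 2) ^ 2 <= A ^ 2) by nra; lra. }
    apply Rmult_le_reg_l with A; lra. }
  assert (Ezr : zeta = (RtoC (/ d2) * ((A ^ 2 + x ^ 2 * (t ^ 2 - 1 / 4))%R, (- (t * x ^ 2))%R))%C).
  { unfold zeta; rewrite Cmod2_conj_mult, Hd2 by auto; f_equal.
    rewrite Enum, Eden; apply injective_projections; simpl; field. }
  assert (Hd2p : 0 < d2) by (rewrite Hdn; assert (0 <= 2 * A * x) by (apply Rmult_le_pos; lra); lra).
  set (X := A ^ 2 + x ^ 2 * (t ^ 2 - 1 / 4)) in *.
  assert (HX : A ^ 2 <= X).
  { unfold X; assert (0 <= x ^ 2 * (t ^ 2 - 1 / 4)) by (apply Rmult_le_pos; [apply pow2_ge_0|nra]); lra. }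
  assert (HX0 : 0 < A ^ 2) by nra.
  assert (Hre : 0 < Re zeta).
  { rewrite Ezr, re_scal_l; apply Rmult_lt_0_compat; [apply Rinv_0_lt_compat; auto|simpl; lra]. }
  assert (Hp := polar_of_Re_pos zeta Hre).
  set (psi := atan (Im zeta / Re zeta)) in *.
  assert (Hq : Im zeta / Re zeta = - (t * x ^ 2) / X).
  { rewrite Ezr, re_scal_l, im_scal_l; simpl; field; split; lra. }
  assert (Hpsi : Rabs psi <= t * x ^ 2 / A ^ 2).
  { unfold psi; eapply Rle_trans; [apply atan_le_id|]; rewrite Hq.
    replace (- (t * x ^ 2) / X) with (- (t * x ^ 2 / X)) by (field; lra).
    assert (0 <= t * x ^ 2) by nra.
    rewrite Rabs_Ropp, Rabs_pos_eq; [|apply Rmult_le_pos; [auto|left; apply Rinv_0_lt_compat; lra]].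
    apply Rmult_le_compat_l; auto; apply Rinv_le_contravar; lra. }
  assert (Hkpsi : Rabs (INR k * psi) <= 1).
  { rewrite Rabs_mult, (Rabs_pos_eq (INR k)) by (rewrite Hhk; lra).
    apply Rle_trans with (INR k * (t * x ^ 2 / A ^ 2)).
    { apply Rmult_le_compat_l; [rewrite Hhk; lra|auto]. }
    assert (Ht1 : t <= 1) by (unfold A in HA; nra).
    apply Rmult_le_reg_r with (A ^ 2); auto.
    replace (INR k * (t * x ^ 2 / A ^ 2) * A ^ 2) with (INR k * t * x ^ 2) by (field; lra).
    set (g := 2 * INR h - 1 / 2) in *.
    assert (Hk2 : INR k <= g ^ 2) by (rewrite Hhk; unfold g; nra).
    apply Rle_trans with (g ^ 2 * x ^ 2).
    - apply Rmult_le_compat_r; [nra|].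
      assert (0 <= INR k) by (rewrite Hhk; lra); nra.
    - replace (g ^ 2 * x ^ 2) with ((x * g) ^ 2) by ring.
      rewrite Rmult_1_l; apply pow_incr; split; [unfold g; nra|auto]. }
  rewrite Hp, Cpow_mult_l, cis_pow, <- RtoC_pow, re_scal_l.
  apply Rabs_le_between in Hkpsi.
  assert (0 <= cos (INR k * psi)) by (apply cos_ge_0; lra).
  assert (0 <= Cmod zeta ^ k) by (apply pow_le, Cmod_ge_0).
  apply Rle_trans with 0; [lra|]; apply Rmult_le_pos; auto.
Qed.

Lemma quarter_pow_bound (x : R) (h : nat) : 0 <= x <= 0.475 -> (4 <= h)%nat -> x ^ h <= 0.051.
Proof.
intros Hx Hh; replace h with (4 + (h - 4))%nat by lia; rewrite pow_add.
assert (H1 : x ^ 4 <= 0.475 ^ 4) by (apply pow_incr; lra).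
assert (H2 : x ^ (h - 4) <= 1) by (rewrite <- (pow1 (h - 4)); apply pow_incr; lra).
assert (H3 : 0 <= x ^ (h - 4)) by (apply pow_le; lra).
assert (H4 : 0 <= x ^ 4) by (apply pow_le; lra).
nra.
Qed.

Lemma pow_anti (x : R) (m n : nat) : 0 <= x <= 1 -> (m <= n)%nat -> x ^ n <= x ^ m.
Proof.
intros Hx Hn; replace n with (m + (n - m))%nat by lia; rewrite pow_add.
assert (H2 : x ^ (n - m) <= 1) by (rewrite <- (pow1 (n - m)); apply pow_incr; lra).
assert (H4 : 0 <= x ^ m) by (apply pow_le; lra); nra.
Qed.

(** 1.24 bounds 1 + 4 u (u / (u + 1))^3 at u = 3/4, that is 1 + 3 (3/7)^3. *)
Lemma plr_upper_unit (t : R) (h d : nat) : 0 < t -> t ^ 2 <= 3 / 4 -> (4 <= h)%nat -> (2 * h <= S d)%nat ->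
  t ^ S d * plr d (exp (- (2 * PI * t))) <= lipconst d * 1.24.
Proof.
intros Ht Ht2 Hh Hd; assert (HC := lipconst_pos d).
eapply Rle_trans; [apply (plr_upper_small t h d); lia || auto|].
apply Rmult_le_compat_l; [lra|].
assert (Ht0 : 0 < t ^ 2) by (apply pow_lt; auto); set (u := t ^ 2) in *.
assert (Hu : 0 <= u / (u + 1) <= 3 / 7).
{ split; [left; apply Rdiv_lt_0_compat; lra|].
  apply Rmult_le_reg_r with (u + 1); [lra|]; field_simplify; lra. }
assert (H1 := pow_anti (u / (u + 1)) 3 (h - 1) ltac:(lra) ltac:(lia)).
assert (H2 : (u / (u + 1)) ^ 3 <= (3 / 7) ^ 3) by (apply pow_incr; lra).
assert (0 <= (u / (u + 1)) ^ (h - 1)) by (apply pow_le; lra).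
nra.
Qed.

(** In units of [lipconst d], the main term has real part at least 1/2 by [ratio_lower], and the
    errors 1/16, 2/27 and 16/7 * 0.051 * 1.24 add up to less than 0.3. *)
Lemma circle_real_part_half (delta y : R) (h d M : nat) :
  PI / 6 <= delta <= 0.74 -> INR (S d) * delta = INR M * PI -> 0 <= y <= 1 / 2 ->
  (4 <= h)%nat -> (d = 2 * h)%nat ->
  let s := (height delta, y) : C in 0 < Re (s ^ S d * gs d (nom s)).
Proof.
intros Hd HM Hy Hh Hk s.
assert (Hr := ratio_lower delta y h (S d) M Hd HM Hy Hh ltac:(lia)).
change (- (1 / 2) <= Re (s ^ S d / (s - Ci) ^ S d)) in Hr.
assert (HPI := PI_gt_3); assert (Hd0 : 0 < delta <= 0.74) by lra.
destruct (trig_bounds delta Hd0) as [_ [Hsin _]].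
destruct (height_facts delta Hd0) as [Ht [Hrho [Hkap Hp]]].
assert (Hsin2 : 1 / 2 <= sin delta).
{ rewrite <- sin_PI6; destruct (Req_dec delta (PI / 6)) as [->|]; [lra|].
  left; apply sin_increasing_1; lra. }
assert (HC := lipconst_pos d).
set (t := height delta) in *.
assert (HA : t ^ 2 + 1 / 4 <= 1).
{ rewrite Hrho; apply Rle_trans with (/ 1); [apply Rinv_le_contravar; nra|lra]. }
assert (Hs2 : Cmod s ^ 2 = t ^ 2 + y ^ 2) by (rewrite Cmod2_alt; reflexivity).
assert (Ht2 : 0.25 < t ^ 2) by nra.
assert (Ha : 0 < Cmod s ^ 2 <= 1) by (rewrite Hs2; nra).
assert (H1 := pl_main s h d (2 / 27) ltac:(simpl; lra) Hy ltac:(lia) ltac:(lia)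
  (tail_bound_small _ _ Ha Hh)).
assert (Hkap2 : Cmod s ^ 2 / (4 * t ^ 2) <= 0.475).
{ eapply Rle_trans; [|exact Hkap]; apply Rmult_le_compat_r.
  - left; apply Rinv_0_lt_compat; lra.
  - rewrite Hs2; nra. }
assert (Hpl := plr_upper_unit t h d ltac:(lra) ltac:(lra) Hh ltac:(lia)).
assert (H2 := gs_error s h d 1.24 ltac:(simpl; lra) ltac:(lia) ltac:(lia) Hp ltac:(simpl Re; fold t; lra) Hpl).
simpl (Re s) in H2; fold t in H2.
assert (Hq1 : (Cmod s ^ 2 / (Cmod s ^ 2 + 1)) ^ h <= 1 / 16).
{ set (u := Cmod s ^ 2) in *.
  assert (Hu : 0 <= u / (u + 1) <= 1 / 2).
  { split; [left; apply Rdiv_lt_0_compat; lra|].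
    apply Rmult_le_reg_r with (u + 1); [lra|]; field_simplify; lra. }
  eapply Rle_trans; [apply (pow_anti _ 4); [lra|lia]|].
  replace (1 / 16) with ((1 / 2) ^ 4) by field; apply pow_incr; lra. }
assert (Hq2 : (Cmod s ^ 2 / (4 * t ^ 2)) ^ h <= 0.051).
{ apply quarter_pow_bound; auto; split; auto; left; apply Rdiv_lt_0_compat; lra. }
set (z := (s ^ S d / (s - Ci) ^ S d)%C) in *.
set (P := (s ^ S d * pl d (nom s))%C) in *.
set (Q := (s ^ S d * (gs d (nom s) - pl d (nom s)))%C) in *.
replace (s ^ S d * gs d (nom s))%C with (lipconst d * (1 + z) + ((P - lipconst d * (1 + z)) + Q))%C
  by (unfold P, Q; ring).
rewrite !re_plus, re_scal_l, re_plus, re_RtoC.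
assert (H3 := re_le_Cmod (P - lipconst d * (1 + z))%C); apply Rabs_le_between in H3.
assert (H4 := re_le_Cmod Q); apply Rabs_le_between in H4.
assert (H5 : lipconst d * ((Cmod s ^ 2 / (Cmod s ^ 2 + 1)) ^ h + 2 / 27) <= lipconst d * (1 / 16 + 2 / 27)).
{ apply Rmult_le_compat_l; lra. }
assert (H6 : lipconst d * (16 / 7 * (Cmod s ^ 2 / (4 * t ^ 2)) ^ h * 1.24) <= lipconst d * (16 / 7 * 0.051 * 1.24)).
{ apply Rmult_le_compat_l; lra. }
nra.
Qed.

(** * Signs on the negative q-axis *)

Definition gsr (d : nat) (x : R) : R := Re (gs d (RtoC x)).

Lemma gs_real (d : nat) (x : R) : gs d (RtoC x) = RtoC (gsr d x).
Proof. apply injective_projections; [reflexivity|exact (PS_real (divisor_sum d) x)]. Qed.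

Lemma gs_conj (d : nat) (q : C) : gs d (Cconj q) = Cconj (gs d q).
Proof. exact (PS_conj (divisor_sum d) q). Qed.

Lemma nom_conj (s : C) : nom (Cconj s) = Cconj (nom s).
Proof.
unfold nom; rewrite !Cexp_cis.
rewrite Cmult_conj, <- cis_opp, !re_opp, !im_opp, !re_scal_l, !im_scal_l, re_conj, im_conj.
f_equal; [apply injective_projections; simpl; ring|f_equal; ring].
Qed.

Lemma nom_half (t : R) : nom (t, 1 / 2) = RtoC (- exp (- (2 * PI * t))).
Proof.
unfold nom; rewrite Cexp_cis, re_opp, im_opp, re_scal_l, im_scal_l; simpl.
replace (2 * PI * (1 / 2)) with PI by field; rewrite cis_opp, cis_PI.
apply injective_projections; simpl; ring.
Qed.

(** On this line s - i is the conjugate of s, so up to the phase of s^k the two main terms add up to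
    2 cos(k delta), and the phase drops out of the moduli. *)
Lemma line_value (delta T S0 : R) (h d : nat) : 0 < delta <= 0.74 -> (2 <= d)%nat ->
  (2 * h <= S d)%nat ->
  tail_bound (height delta ^ 2 + 1 / 4) h T ->
  height delta ^ S d * plr d (exp (- (2 * PI * height delta))) <= lipconst d * S0 ->
  Rabs ((/ (2 * sin delta)) ^ S d * gsr d (- exp (- (2 * PI * height delta)))
     - lipconst d * (2 * cos (INR (S d) * delta))) <=
  lipconst d * (((height delta ^ 2 + 1 / 4) / (height delta ^ 2 + 1 / 4 + 1)) ^ h + T +
    16 / 7 * ((height delta ^ 2 + 1 / 4) / (4 * height delta ^ 2)) ^ h * S0).
Proof.
intros Hd Hd2 Hk HT HS.
destruct (trig_bounds delta Hd) as [_ [Hsin _]].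
destruct (height_facts delta Hd) as [Ht [Hrho [Hkap Hp]]].
assert (Hpol := polar_height delta Hd).
set (t := height delta) in *.
set (s := (t, 1 / 2) : C) in *.
assert (Hs2 : Cmod s ^ 2 = t ^ 2 + 1 / 4) by (rewrite Cmod2_alt; simpl; field).
rewrite <- Hs2 in HT, Hkap |- *.
assert (H1 := pl_main s h d T ltac:(simpl; lra) ltac:(simpl; lra) Hd2 Hk HT).
assert (H2 := gs_error s h d S0 ltac:(simpl; lra) ltac:(lia) Hk Hp ltac:(simpl Re; lra) HS).
simpl (Re s) in H2.
assert (HC := lipconst_pos d).
assert (Hr : 0 < / (2 * sin delta)) by (apply Rinv_0_lt_compat; lra).
set (r := / (2 * sin delta)) in *.
assert (Hsk : (s ^ S d = RtoC (r ^ S d) * cis (INR (S d) * delta))%C).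
{ rewrite Hpol, Cpow_mult_l, cis_pow, RtoC_pow; reflexivity. }
assert (Hck : ((s - Ci) ^ S d = RtoC (r ^ S d) * Cconj (cis (INR (S d) * delta)))%C).
{ replace (s - Ci)%C with (Cconj s).
  - rewrite <- Cpow_conj, Hsk, Cmult_conj; f_equal; apply injective_projections; simpl; ring.
  - unfold s; apply injective_projections; simpl; field. }
assert (Hrk : RtoC (r ^ S d) <> 0) by (apply RtoC_neq, pow_nonzero; lra).
set (c := cis (INR (S d) * delta)) in *.
assert (Hcc : (c * Cconj c = 1)%C).
{ unfold c; rewrite <- cis_opp, <- cis_plus, Rplus_opp_r; apply cis_0. }
assert (Hcn : c <> 0) by apply cis_nz.
assert (Hccn : Cconj c <> 0) by (unfold c; rewrite <- cis_opp; apply cis_nz).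
assert (Hratio : (1 + s ^ S d / (s - Ci) ^ S d = c * RtoC (2 * cos (INR (S d) * delta)))%C).
{ rewrite Hsk, Hck.
  transitivity (c * (Cconj c + c))%C.
  - rewrite Cmult_plus_distr_l, Hcc; f_equal.
    transitivity (c * (c * Cconj c) / Cconj c)%C; [rewrite Hcc; field; auto|field; auto].
  - f_equal; unfold c, cis; apply injective_projections; simpl; ring. }
rewrite Hratio in H1.
assert (Hq : nom s = RtoC (- exp (- (2 * PI * t)))) by apply nom_half.
rewrite Hq, gs_real in H2; rewrite Hq in H1.
set (p := - exp (- (2 * PI * t))) in *.
replace (r ^ S d * gsr d p - lipconst d * (2 * cos (INR (S d) * delta))) with
  (Re (RtoC (r ^ S d * gsr d p - lipconst d * (2 * cos (INR (S d) * delta))))) by apply re_RtoC.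
eapply Rle_trans; [apply re_le_Cmod|].
assert (Hmc : forall z, Cmod z = Cmod (c * z)) by (intros z; unfold c; rewrite Cmod_mult, Cmod_cis; ring).
rewrite Hmc.
replace (c * RtoC (r ^ S d * gsr d p - lipconst d * (2 * cos (INR (S d) * delta))))%C with
  ((s ^ S d * pl d p - lipconst d * (c * (2 * cos (INR (S d) * delta))%R))
    + s ^ S d * (gsr d p - pl d p))%C.
2: { rewrite Hsk, RtoC_minus, (RtoC_mult (r ^ S d)), (RtoC_mult (lipconst d)); ring. }
eapply Rle_trans; [apply Cmod_triangle|].
rewrite Rmult_plus_distr_l; apply Rplus_le_compat; [exact H1|exact H2].
Qed.

Lemma line_sign (delta T S0 : R) (h d : nat) : 0 < delta <= 0.74 -> (2 <= d)%nat ->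
  (2 * h <= S d)%nat ->
  tail_bound (height delta ^ 2 + 1 / 4) h T ->
  height delta ^ S d * plr d (exp (- (2 * PI * height delta))) <= lipconst d * S0 ->
  ((height delta ^ 2 + 1 / 4) / (height delta ^ 2 + 1 / 4 + 1)) ^ h + T +
    16 / 7 * ((height delta ^ 2 + 1 / 4) / (4 * height delta ^ 2)) ^ h * S0 <
  2 * Rabs (cos (INR (S d) * delta)) ->
  0 < cos (INR (S d) * delta) * gsr d (- exp (- (2 * PI * height delta))).
Proof.
intros Hd Hd2 Hk HT HS Herr.
assert (H := line_value delta T S0 h d Hd Hd2 Hk HT HS).
destruct (trig_bounds delta Hd) as [_ [Hsin _]].
assert (HC := lipconst_pos d).
assert (Hr : 0 < (/ (2 * sin delta)) ^ S d) by (apply pow_lt, Rinv_0_lt_compat; lra).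
set (r := (/ (2 * sin delta)) ^ S d) in *.
set (g := gsr d _) in *; set (c := cos _) in *.
set (e := _ + _ + _) in *.
assert (H2 : Rabs (r * g - lipconst d * (2 * c)) < lipconst d * (2 * Rabs c)).
{ eapply Rle_lt_trans; [exact H|]; apply Rmult_lt_compat_l; auto. }
apply Rabs_lt_between in H2.
unfold Rabs in H2; destruct (Rcase_abs c) as [Hc|Hc].
- assert (r * g < 0) by lra; assert (g < 0) by nra; nra.
- assert (0 < c) by (destruct (Req_dec c 0) as [E|]; [rewrite E in H2|]; lra).
  assert (0 < r * g) by lra; assert (0 < g) by nra; nra.
Qed.

Lemma cos_nat_PI (m : nat) : cos (INR m * PI) = (-1) ^ m.
Proof.
induction m as [|m IH]; [simpl; rewrite Rmult_0_l; apply cos_0|].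
rewrite S_INR, Rmult_plus_distr_r, Rmult_1_l, neg_cos, IH; simpl; ring.
Qed.

(** The condition 8 m^2 > k keeps A = |s|^2 below 0.55 h. The errors are then at most 0.36, 1.1 and
    16/7 * 0.051 * 3.2, in total less than the main term 2. *)
Lemma sign_at_extremum (d h m : nat) : (4 <= h)%nat -> (d = 2 * h)%nat -> (S d < 8 * m * m)%nat ->
  (13 * m <= 3 * S d)%nat ->
  let delta := INR m * PI / INR (S d) in
  0 < (-1) ^ m * gsr d (- exp (- (2 * PI * height delta))).
Proof.
intros Hh Hd Hm1 Hm2 delta; assert (HPI := PI_gt_3); assert (HPI' := PI_lt_3_2).
set (k := S d) in *.
assert (Hk0 : 0 < INR k) by (apply lt_0_INR; lia).
assert (Hm0 : 1 <= INR m) by (apply (le_INR 1); lia).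
assert (Hmk : 13 * INR m <= 3 * INR k).
{ apply le_INR in Hm2; rewrite !mult_INR in Hm2; simpl (INR 13) in Hm2; simpl (INR 3) in Hm2; lra. }
assert (Hdel : 0 < delta <= 0.74).
{ unfold delta; split.
  - apply Rdiv_lt_0_compat; auto; apply Rmult_lt_0_compat; lra.
  - apply Rmult_le_reg_r with (INR k); auto.
    replace (INR m * PI / INR k * INR k) with (INR m * PI) by (field; lra); nra. }
assert (Hkd : INR k * delta = INR m * PI) by (unfold delta; field; lra).
destruct (trig_bounds delta Hdel) as [Hsl [Hsin _]].
destruct (height_facts delta Hdel) as [Ht [Hrho [Hkap Hp]]].
assert (Hh4 : 4 <= INR h) by (apply (le_INR 4) in Hh; simpl in Hh; lra).
assert (Hkh : INR k = 2 * INR h + 1).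
{ unfold k; rewrite Hd, S_INR, mult_INR; simpl; ring. }
set (A := height delta ^ 2 + 1 / 4) in *.
set (hr := INR h) in *.
assert (Hm3 : INR k + 1 <= 8 * (INR m * INR m)).
{ assert (H : (k + 1 <= 8 * (m * m))%nat) by lia.
  apply le_INR in H; rewrite plus_INR, !mult_INR in H; simpl (INR 8) in H; simpl (INR 1) in H; lra. }
(* From sin delta >= 0.908 * 3 m / k and 8 m^2 >= k + 1 the left side is bounded by 0.908^2 * (9/8)
   (1 - 1 / k^2), with k >= 9. *)
assert (Hsin2 : 0.915 <= 2 * hr * sin delta ^ 2).
{ assert (H1 : (0.908 * (3 * INR m / INR k)) ^ 2 <= sin delta ^ 2).
  { apply pow_incr; split.
    - apply Rmult_le_pos; [lra|left; apply Rdiv_lt_0_compat; lra].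
    - eapply Rle_trans; [|exact Hsl]; apply Rmult_le_compat_l; [lra|].
      unfold delta; apply Rmult_le_compat_r; [left; apply Rinv_0_lt_compat; auto|nra]. }
  apply Rle_trans with (2 * hr * (0.908 * (3 * INR m / INR k)) ^ 2); [|nra].
  replace (2 * hr * (0.908 * (3 * INR m / INR k)) ^ 2) with
    (0.908 ^ 2 * 9 / 8 * (2 * hr * (8 * (INR m * INR m))) / INR k ^ 2) by (field; lra).
  apply Rmult_le_reg_r with (INR k ^ 2); [apply pow_lt; auto|].
  replace (0.908 ^ 2 * 9 / 8 * (2 * hr * (8 * (INR m * INR m))) / INR k ^ 2 * INR k ^ 2) with
    (0.908 ^ 2 * 9 / 8 * (2 * hr * (8 * (INR m * INR m)))) by (field; lra).
  apply Rle_trans with (0.908 ^ 2 * 9 / 8 * (2 * hr * (INR k + 1))).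
  - rewrite Hkh; nra.
  - apply Rmult_le_compat_l; [lra|]; apply Rmult_le_compat_l; lra. }
assert (HA : 0 < A / hr <= 0.55).
{ assert (HA0 : 0 < A) by (rewrite Hrho; apply Rinv_0_lt_compat; nra).
  split; [apply Rdiv_lt_0_compat; lra|].
  rewrite Hrho; apply Rmult_le_reg_r with (4 * sin delta ^ 2 * hr); [nra|].
  replace (/ (4 * sin delta ^ 2) / hr * (4 * sin delta ^ 2 * hr)) with 1 by (field; lra); nra. }
assert (HA0 : 0 < A) by (rewrite Hrho; apply Rinv_0_lt_compat; nra).
unfold k in Hkd; rewrite <- (cos_nat_PI m), <- Hkd.
apply (line_sign delta (2 * A / hr) (1 + 4 * height delta ^ 2 / hr) h d); auto; try lia.
- fold A; apply tail_bound_large; auto; lia.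
- apply plr_upper_large; lia || lra.
- rewrite Hkd, cos_nat_PI; fold A.
  assert (E1 : Rabs ((-1) ^ m) = 1) by apply pow_1_abs.
  rewrite E1.
  assert (H1 : (A / (A + 1)) ^ h <= 0.36).
  { replace (A / (A + 1)) with (/ (1 + / A)) by (field; lra).
    assert (HiA : 0 < / A) by (apply Rinv_0_lt_compat; auto).
    eapply Rle_trans; [apply bernoulli_inv_pow; lra|]; fold hr.
    assert (H : 1.8 <= hr * / A).
    { replace (hr * / A) with (/ (A / hr)) by (field; lra).
      apply Rmult_le_reg_r with (A / hr); [lra|]; rewrite Rinv_l; lra. }
    apply Rmult_le_reg_r with (1 + hr * / A); [lra|]; rewrite Rinv_l; lra. }
  assert (H2 : (A / (4 * height delta ^ 2)) ^ h <= 0.051).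
  { apply quarter_pow_bound; auto; split; auto; left; apply Rdiv_lt_0_compat; nra. }
  assert (H3 : 4 * height delta ^ 2 / hr <= 2.2).
  { replace (4 * height delta ^ 2 / hr) with (4 * (A / hr) - 1 / hr) by (unfold A; field; lra).
    assert (0 < 1 / hr) by (apply Rdiv_lt_0_compat; lra); lra. }
  assert (H4 : 0 <= 4 * height delta ^ 2 / hr) by (apply Rmult_le_pos; [nra|left; apply Rinv_0_lt_compat; lra]).
  replace (2 * A / hr) with (2 * (A / hr)) by (field; lra).
  assert (H5 : 0 <= (A / (4 * height delta ^ 2)) ^ h) by (apply pow_le; left; apply Rdiv_lt_0_compat; nra).
  nra.
Qed.

(** * The sign at rho *)

Lemma height_PI6 : height (PI / 6) = sqrt 3 / 2.
Proof. unfold height; rewrite cos_PI6, sin_PI6; field. Qed.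

Lemma sqrt3_sqr : sqrt 3 ^ 2 = 3.
Proof. apply pow2_sqrt; lra. Qed.

Lemma sqrt3_bounds : 1.7 < sqrt 3 < 1.8.
Proof.
assert (H := sqrt3_sqr); assert (H0 := sqrt_pos 3); split; nra.
Qed.

Definition rho_nome : R := - exp (- (2 * PI * (sqrt 3 / 2))).

Lemma cos_shift_nat_PI (x : R) (a : nat) : cos (INR a * PI + x) = (-1) ^ a * cos x.
Proof.
rewrite cos_plus, cos_nat_PI.
assert (Hs : sin (INR a * PI) = 0).
{ assert (H := sin2_cos2 (INR a * PI)); rewrite cos_nat_PI in H; unfold Rsqr in H.
  assert (H1 : (-1) ^ a * (-1) ^ a = 1) by (rewrite <- pow_add; replace (a + a)%nat with (2 * a)%nat by lia; apply pow_1_even).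
  nra. }
rewrite Hs; ring.
Qed.

(** The main term 2 cos(k pi / 6) has modulus sqrt 3, while the errors add up to less than 0.3. *)
Lemma sign_at_rho_generic (d h : nat) : (4 <= h)%nat -> (d = 2 * h)%nat ->
  Rabs (cos (INR (S d) * (PI / 6))) = sqrt 3 / 2 ->
  0 < cos (INR (S d) * (PI / 6)) * gsr d rho_nome.
Proof.
intros Hh Hd Hc; assert (HPI := PI_gt_3); assert (HPI' := PI_lt_3_2).
assert (Hdel : 0 < PI / 6 <= 0.74) by lra.
assert (H3 := sqrt3_sqr); assert (H3b := sqrt3_bounds).
assert (HA : height (PI / 6) ^ 2 + 1 / 4 = 1) by (rewrite height_PI6; nra).
unfold rho_nome; rewrite <- height_PI6.
apply (line_sign (PI / 6) (2 / 27) 1.24 h d); auto; try lia.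
- rewrite HA; apply tail_bound_small; auto; lra.
- apply (plr_upper_unit _ h); try lia; rewrite height_PI6; [lra|nra].
- rewrite HA, Hc.
  replace (4 * height (PI / 6) ^ 2) with 3 by (rewrite height_PI6; nra).
  assert (H1 : (1 / (1 + 1)) ^ h <= 1 / 16).
  { eapply Rle_trans; [apply (pow_anti _ 4); [lra|lia]|]; lra. }
  assert (H2 : (1 / 3) ^ h <= 0.051) by (apply quarter_pow_bound; auto; lra).
  lra.
Qed.

(** This is the sign at r_a, so the last zero lies between the nome of rho and -r_(a+1), that is
    below rho. *)
Lemma sign_at_rho_1 (a d h : nat) : (4 <= h)%nat -> (d = 2 * h)%nat -> (S d = 6 * a + 1)%nat ->
  0 < (-1) ^ a * gsr d rho_nome.
Proof.
intros Hh Hd Ha.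
assert (Hc : cos (INR (S d) * (PI / 6)) = (-1) ^ a * (sqrt 3 / 2)).
{ rewrite Ha, plus_INR, mult_INR; simpl (INR 6); simpl (INR 1).
  replace (((1 + 1 + 1 + 1 + 1 + 1) * INR a + 1) * (PI / 6)) with (INR a * PI + PI / 6) by field.
  rewrite cos_shift_nat_PI, cos_PI6; reflexivity. }
assert (H3b := sqrt3_bounds).
assert (H := sign_at_rho_generic d h Hh Hd).
rewrite Hc, Rabs_mult, pow_1_abs, Rabs_pos_eq in H by lra.
specialize (H ltac:(ring)); nra.
Qed.

(** This is the sign at r_(a+1), so the last zero lies above rho. *)
Lemma sign_at_rho_5 (a d h : nat) : (4 <= h)%nat -> (d = 2 * h)%nat -> (S d = 6 * a + 5)%nat ->
  0 < (-1) ^ S a * gsr d rho_nome.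
Proof.
intros Hh Hd Ha.
assert (Hc : cos (INR (S d) * (PI / 6)) = (-1) ^ S a * (sqrt 3 / 2)).
{ rewrite Ha, plus_INR, mult_INR; simpl (INR 6); simpl (INR 5).
  replace (((1 + 1 + 1 + 1 + 1 + 1) * INR a + (1 + 1 + 1 + 1 + 1)) * (PI / 6)) with
    (INR (S a) * PI + - (PI / 6)) by (rewrite S_INR; field).
  rewrite cos_shift_nat_PI, cos_neg, cos_PI6; reflexivity. }
assert (H3b := sqrt3_bounds).
assert (H := sign_at_rho_generic d h Hh Hd).
rewrite Hc, Rabs_mult, pow_1_abs, Rabs_pos_eq in H by lra.
specialize (H ltac:(ring)); nra.
Qed.

(** The terms with n >= 3 at rho, relative to the modulus sqrt 3 of the two deciding ones. Three
    factors 3/7 leave a telescoping sum that starts at 1 / (2 * 3). *)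
Lemma rho_tail (h L : nat) : (4 <= h)%nat ->
  rsum (fun i => 2 * (3 / (3 / 4 + (INR (S (S (S i))) - 1 / 2) ^ 2)) ^ h) L <= 1 / 4.
Proof.
intros Hh.
apply Rle_trans with (rsum (fun i => 1 / 2 * / (INR (S (S (S i))) * INR (S (S i)))) L).
- apply rsum_le; intros i _; set (j := INR (S (S i))).
  assert (Hj : 2 <= j) by (unfold j; apply (le_INR 2); lia).
  assert (Ej3 : INR (S (S (S i))) = j + 1) by (unfold j; rewrite (S_INR (S (S i))); ring).
  rewrite Ej3.
  set (b := 3 / 4 + (j + 1 - 1 / 2) ^ 2).
  assert (Hb7 : 7 <= b) by (unfold b; nra).
  set (x := 3 / b).
  assert (Hx : 0 <= x <= 3 / 7).
  { unfold x; split; [left; apply Rdiv_lt_0_compat; lra|].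
    apply Rmult_le_compat_l; [lra|apply Rinv_le_contravar; lra]. }
  assert (Hxj : x <= 3 * / ((j + 1) * j)).
  { unfold x; apply Rmult_le_compat_l; [lra|]; apply Rinv_le_contravar; [nra|unfold b; nra]. }
  assert (H1 := pow_anti x 4 h ltac:(lra) Hh).
  assert (H2 : x ^ 3 <= (3 / 7) ^ 3) by (apply pow_incr; lra).
  assert (H3 : 0 <= x ^ 3) by (apply pow_le; lra).
  assert (H4 : 0 < / ((j + 1) * j)) by (apply Rinv_0_lt_compat; nra).
  replace (x ^ 4) with (x ^ 3 * x) in H1 by ring.
  assert (H5 : x ^ 3 * x <= (3 / 7) ^ 3 * (3 * / ((j + 1) * j))) by (apply Rmult_le_compat; lra).
  lra.
- rewrite rsum_scal; assert (H := rsum_telescope (S L)); rewrite rsum_shift in H.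
  simpl (INR 2) in H; simpl (INR 1) in H; lra.
Qed.

Lemma inv_pow_scaled (z : C) (h k : nat) : 3 <= Cmod z ^ 2 -> (2 * h <= k)%nat ->
  Cmod (/ z ^ k) <= (/ sqrt 3) ^ k * (3 / Cmod z ^ 2) ^ h.
Proof.
intros Hz Hk; assert (H3 := sqrt3_sqr); assert (H3b := sqrt3_bounds).
assert (Hz0 : 0 < Cmod z) by (assert (H := Cmod_ge_0 z); nra).
assert (Hzn : z <> 0) by (apply Cmod_gt_0; auto).
rewrite Cmod_inv, Cmod_pow by (apply Cpow_nz; auto).
apply Rle_trans with ((/ sqrt 3) ^ k * (sqrt 3 / Cmod z) ^ k).
- right; rewrite <- Rpow_mult_distr, <- pow_inv; f_equal; field; lra.
- apply Rmult_le_compat_l; [apply pow_le; left; apply Rinv_0_lt_compat; lra|].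
  apply pow_le_half; auto.
  + left; apply Rdiv_lt_0_compat; lra.
  + unfold Rdiv; rewrite Rpow_mult_distr, H3, pow_inv; lra.
  + apply Rmult_le_reg_r with (Cmod z ^ 2); [lra|].
    replace (3 / Cmod z ^ 2 * Cmod z ^ 2) with 3 by (field; lra); lra.
Qed.

(* When 3 divides k the two main terms cancel at rho; the next two, at distance sqrt 3, decide. *)
Lemma pl_at_rho_3 (a d h : nat) : (4 <= h)%nat -> (d = 2 * h)%nat -> (S d = 6 * a + 3)%nat ->
  Re (pl d (RtoC rho_nome)) <= lipconst d * (/ sqrt 3) ^ S d * (-2 + 0.3).
Proof.
intros Hh Hd Ha; set (k := S d) in *.
assert (H3 := sqrt3_sqr); assert (H3b := sqrt3_bounds); assert (HPI := PI_gt_3).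
assert (HC := lipconst_pos d).
set (t := sqrt 3 / 2); set (s := (t, 1 / 2) : C).
assert (HL := lipschitz_formula d s ltac:(lia) ltac:(simpl; unfold t; lra)
  ltac:(simpl; rewrite Rabs_pos_eq; lra)).
fold (nom s) in HL; unfold s in HL; rewrite nom_half in HL; fold s in HL.
unfold t in HL; fold rho_nome in HL.
set (w := (/ sqrt 3) ^ k).
assert (Hw : 0 < w) by (apply pow_lt, Rinv_0_lt_compat; lra).
assert (Hs : s = cis (PI / 6)).
{ unfold s, t, cis; rewrite cos_PI6, sin_PI6; reflexivity. }
assert (Hcis1 : (cis (PI / 6) ^ k)%C = cis (INR a * PI + PI / 2)).
{ rewrite cis_pow, Ha, plus_INR, mult_INR; simpl (INR 6); simpl (INR 3); f_equal; field. }
(* k pi / 6 is an odd multiple of pi / 2, so s^k is purely imaginary and opposite to its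
   conjugate. *)
assert (Hmain0 : (/ s ^ k + / (s - Ci) ^ k)%C = 0).
{ assert (E : (s - Ci)%C = Cconj s) by (unfold s, t; apply injective_projections; simpl; field).
  rewrite E, <- Cpow_conj, Hs, Hcis1.
  assert (Hn := cis_nz (INR a * PI + PI / 2)).
  set (c := cis (INR a * PI + PI / 2)) in *.
  assert (Ec : Cconj c = (- c)%C).
  { unfold c, cis; rewrite cos_shift_nat_PI, cos_PI2.
    apply injective_projections; simpl; ring. }
  rewrite Ec; field; auto. }
(* The deciding terms at s + i and s - 2 i: k pi / 3 is an odd multiple of pi, so both contribute
   the same negative number. *)
assert (Hsec : forall z, z = (RtoC (sqrt 3) * cis (PI / 3))%C \/ z = (RtoC (sqrt 3) * cis (- (PI / 3)))%C ->
  (/ z ^ k)%C = RtoC (- w)).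
{ assert (Hk3 : INR k * (PI / 3) = PI + 2 * INR a * PI).
  { rewrite Ha, plus_INR, mult_INR; simpl (INR 6); simpl (INR 3); field. }
  assert (Hs3 : RtoC (sqrt 3) <> 0) by (apply RtoC_neq; lra).
  assert (Hpow : forall c, c = (- (1))%C -> (/ (RtoC (sqrt 3) ^ k * c))%C = RtoC (- w)).
  { intros c ->; unfold w; rewrite RtoC_opp, RtoC_pow, RtoC_inv, Cpow_inv by (auto; lra).
    field; apply Cpow_nz; auto. }
  intros z [->| ->]; rewrite Cpow_mult_l, cis_pow; apply Hpow.
  - rewrite Hk3, cis_2PI; apply cis_PI.
  - rewrite Ropp_mult_distr_r_reverse, Hk3, cis_opp, cis_2PI, cis_PI.
    apply injective_projections; simpl; ring. }
assert (H1 : (/ (s + Ci) ^ k)%C = RtoC (- w)).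
{ apply Hsec; left; unfold s, t, cis; rewrite cos_PI3, sin_PI3.
  apply injective_projections; simpl; [field|].
  assert (E : sqrt 3 * sqrt 3 = 3) by (simpl in H3; lra).
  transitivity (sqrt 3 * sqrt 3 / 2); [rewrite E; field|field]. }
assert (H2 : (/ (s - Ci * RtoC 2) ^ k)%C = RtoC (- w)).
{ apply Hsec; right; rewrite cis_opp; unfold s, t, cis; rewrite cos_PI3, sin_PI3.
  apply injective_projections; simpl; [field|].
  assert (E : sqrt 3 * sqrt 3 = 3) by (simpl in H3; lra).
  transitivity (- (sqrt 3 * sqrt 3 / 2)); [rewrite E; field|field]. }
assert (Hmod : forall y, Cmod (s + Ci * RtoC y) ^ 2 = 3 / 4 + (y + 1 / 2) ^ 2).
{ intros y; rewrite Cmod2_alt; unfold s, t; simpl.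
  assert (E : sqrt 3 * sqrt 3 = 3) by (simpl in H3; lra); nra. }
assert (Hb : Cmod (pl d (RtoC rho_nome) - RtoC (lipconst d * (-2 * w))) <= lipconst d * (w * 0.3)).
{ apply (Ccv_bound _ _ _ _ 2 HL); intros [|[|L]] HL2; [lia|lia|]; clear HL2; cbv beta; fold k.
  rewrite RtoC_mult.
  replace (lipconst d * lipsum k s (S (S L)) - lipconst d * RtoC (-2 * w))%C with
    (lipconst d * (lipsum k s (S (S L)) - RtoC (-2 * w)))%C by ring.
  rewrite Cmod_mult, Cmod_R, Rabs_pos_eq by lra.
  apply Rmult_le_compat_l; [lra|].
  unfold lipsum; rewrite !csum_shift.
  change (INR 1) with 1; rewrite !Cmult_1_r.
  replace (INR 2) with 2 by (simpl; ring).
  set (R1 := csum _ L).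
  replace (/ s ^ k + (/ (s + Ci) ^ k + / (s - Ci) ^ k +
     (/ (s + Ci * 2) ^ k + / (s - Ci * 2) ^ k + R1)) - RtoC (-2 * w))%C with
    (/ (s + Ci * RtoC 2) ^ k + R1)%C.
  2: { rewrite H1, H2.
       transitivity ((/ s ^ k + / (s - Ci) ^ k) + (/ (s + Ci * 2) ^ k + R1)
         + (RtoC (- w) + RtoC (- w) - RtoC (-2 * w)))%C; [|ring].
       rewrite Hmain0; replace (RtoC (- w) + RtoC (- w) - RtoC (-2 * w))%C with (RtoC 0); [ring|].
       rewrite <- RtoC_plus, <- RtoC_minus; f_equal; ring. }
  eapply Rle_trans; [apply Cmod_triangle|].
  assert (Ha1 : Cmod (/ (s + Ci * RtoC 2) ^ k) <= w * 0.04).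
  { eapply Rle_trans; [apply (inv_pow_scaled _ h k); [rewrite Hmod; lra|lia]|].
    fold w; rewrite Hmod; apply Rmult_le_compat_l; [lra|].
    replace (3 / (3 / 4 + (2 + 1 / 2) ^ 2)) with (3 / 7) by field.
    eapply Rle_trans; [apply (pow_anti _ 4); [lra|auto]|]; lra. }
  assert (Ha2 : Cmod R1 <= w * (1 / 4)).
  { apply Rle_trans with (w * rsum (fun i => 2 * (3 / (3 / 4 + (INR (S (S (S i))) - 1 / 2) ^ 2)) ^ h) L).
    2: { apply Rmult_le_compat_l; [lra|apply rho_tail; auto]. }
    rewrite <- rsum_scal; unfold R1; apply Cmod_csum_le; intros i _; cbv beta.
    set (y := INR (S (S (S i)))).
    assert (Hy : 3 <= y) by (unfold y; apply (le_INR 3) || (replace 3 with (INR 3) by (simpl; ring); apply le_INR); lia).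
    eapply Rle_trans; [apply Cmod_triangle|].
    assert (Hden : 3 <= 3 / 4 + (y - 1 / 2) ^ 2) by nra.
    assert (G1 : Cmod (/ (s - Ci * RtoC y) ^ k) <= w * (3 / (3 / 4 + (y - 1 / 2) ^ 2)) ^ h).
    { replace (s - Ci * RtoC y)%C with (s + Ci * RtoC (- y))%C by (rewrite RtoC_opp; ring).
      assert (E : Cmod (s + Ci * RtoC (- y)) ^ 2 = 3 / 4 + (y - 1 / 2) ^ 2) by (rewrite Hmod; ring).
      rewrite <- E; apply inv_pow_scaled; [rewrite E; auto|lia]. }
    assert (G2 : Cmod (/ (s + Ci * RtoC y) ^ k) <= w * (3 / (3 / 4 + (y - 1 / 2) ^ 2)) ^ h).
    { eapply Rle_trans; [apply (inv_pow_scaled _ h k); [rewrite Hmod; nra|lia]|].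
      apply Rmult_le_compat_l; [left; apply Hw|].
      rewrite Hmod; apply pow_incr; split; [left; apply Rdiv_lt_0_compat; nra|].
      apply Rmult_le_compat_l; [lra|apply Rinv_le_contravar; nra]. }
    lra. }
  lra. }
assert (Hre := re_le_Cmod (pl d (RtoC rho_nome) - RtoC (lipconst d * (-2 * w)))%C).
unfold Cminus in Hre; rewrite re_plus, re_opp, re_RtoC in Hre.
apply Rabs_le_between in Hre; unfold Cminus in Hb; fold w; lra.
Qed.

(** In units of lipconst * 3^(-k/2), the value of [pl] is at most -1.7, its value at q^2 at most
    1.24, and the rest at most 0.2. *)
Lemma sign_at_rho_3 (a d h : nat) : (4 <= h)%nat -> (d = 2 * h)%nat -> (S d = 6 * a + 3)%nat ->
  gsr d rho_nome < 0.
Proof.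
intros Hh Hd Ha; assert (Hmain := pl_at_rho_3 a d h Hh Hd Ha).
assert (H3 := sqrt3_sqr); assert (H3b := sqrt3_bounds); assert (HPI := PI_gt_3); assert (HPI' := PI_lt_3_2).
assert (HC := lipconst_pos d).
assert (Hdel : 0 < PI / 6 <= 0.74) by lra.
destruct (height_facts _ Hdel) as [_ [_ [_ Hp]]]; rewrite height_PI6 in Hp.
unfold rho_nome in *; set (t := sqrt 3 / 2) in *; set (p := exp (- (2 * PI * t))) in *.
assert (Hp0 : 0 < p) by apply exp_pos.
assert (Hq : Cmod (RtoC (- p)) = p) by (rewrite Cmod_R, Rabs_Ropp, Rabs_pos_eq; lra).
assert (Hq1 : Cmod (RtoC (- p)) < 1) by lra.
assert (H := gs_minus_pl_2 d (RtoC (- p)) ltac:(lia) Hq1); rewrite Hq in H.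
assert (Ht : 0 < t) by (unfold t; lra).
assert (Hpl := plr_upper_unit t h d Ht ltac:(unfold t; nra) Hh ltac:(lia)); fold p in Hpl.
set (w := (/ sqrt 3) ^ S d) in *.
assert (Hw : 0 < w) by (apply pow_lt, Rinv_0_lt_compat; lra).
assert (Htk : t ^ S d * 2 ^ S d * w = 1).
{ unfold w; rewrite <- !Rpow_mult_distr; replace (t * 2 * / sqrt 3) with 1 by (unfold t; field; lra).
  apply pow1. }
assert (H2d : 0 < 2 ^ S d) by (apply pow_lt; lra).
assert (Htd : 0 < t ^ S d) by (apply pow_lt; auto).
set (P := plr d p) in *.
assert (HP : P <= lipconst d * 1.24 * (2 ^ S d * w)).
{ apply Rmult_le_reg_l with (t ^ S d); auto.
  replace (t ^ S d * (lipconst d * 1.24 * (2 ^ S d * w))) with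
    (lipconst d * 1.24 * (t ^ S d * 2 ^ S d * w)) by ring.
  rewrite Htk; lra. }
assert (HP0 : 0 <= P) by (apply plr_nonneg; lra).
(* The distribution relation of order 2 expresses the value at p^2 through those at p and -p, of
   which the second is negative. *)
assert (Hsq : Re (pl d (RtoC (- p) ^ 2)) * 2 ^ S d = P + Re (pl d (RtoC (- p)))).
{ assert (Hdist := pl_distribution d 1 (RtoC (- p)) Hq1).
  assert (Hc2 : cis (2 * PI / INR 2) = (- (1))%C).
  { replace (2 * PI / INR 2) with PI by (simpl; field); apply cis_PI. }
  cbn [csum] in Hdist; rewrite Hc2 in Hdist.
  replace ((- (1)) ^ 0 * RtoC (- p))%C with (RtoC (- p)) in Hdist by (simpl; ring).
  replace ((- (1)) ^ 1 * RtoC (- p))%C with (RtoC p) in Hdist by (rewrite RtoC_opp; simpl; ring).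
  replace (INR 2) with 2 in Hdist by (simpl; ring).
  apply (f_equal Re) in Hdist; rewrite !re_plus, re_RtoC, re_scal_l in Hdist.
  unfold P, plr; lra. }
set (F2 := Re (pl d (RtoC (- p) ^ 2))) in *.
set (F1 := Re (pl d (RtoC (- p)))) in *.
assert (HF1 : F1 <= lipconst d * w * -1.7) by lra.
assert (HF2 : F2 <= lipconst d * 1.24 * w).
{ apply Rmult_le_reg_r with (2 ^ S d); auto.
  assert (0 < lipconst d * w) by (apply Rmult_lt_0_compat; auto); lra. }
assert (HE : / 3 ^ d * P / (1 - p) <= lipconst d * w * 0.2).
{ assert (H3d : 0 < 3 ^ d) by (apply pow_lt; lra).
  assert (H23 : 2 ^ d <= 3 ^ d * 0.04).
  { assert (E : (2 / 3) ^ d <= 0.04).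
    { eapply Rle_trans; [apply (pow_anti _ 8); [lra|lia]|]; lra. }
    unfold Rdiv in E; rewrite Rpow_mult_distr, pow_inv in E.
    apply (Rmult_le_compat_r (3 ^ d)) in E; [|lra].
    rewrite Rmult_assoc, Rinv_l in E by lra; lra. }
  assert (E1 : / 3 ^ d * P <= lipconst d * w * 0.1).
  { apply Rmult_le_reg_l with (3 ^ d); auto.
    rewrite <- Rmult_assoc, Rinv_r, Rmult_1_l by lra.
    rewrite <- tech_pow_Rmult in HP.
    assert (0 < lipconst d * w) by (apply Rmult_lt_0_compat; auto); nra. }
  assert (E0 : 0 <= / 3 ^ d * P) by (apply Rmult_le_pos; auto; left; apply Rinv_0_lt_compat; auto).
  assert (E2 : / (1 - p) <= 8 / 7).
  { replace (8 / 7) with (/ (7 / 8)) by field; apply Rinv_le_contravar; lra. }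
  assert (0 < / (1 - p)) by (apply Rinv_0_lt_compat; lra).
  unfold Rdiv at 1; nra. }
assert (Hre := re_le_Cmod (gs d (RtoC (- p)) - (pl d (RtoC (- p)) + pl d (RtoC (- p) ^ 2)))%C).
unfold Cminus in Hre, H; rewrite re_plus, re_opp, re_plus in Hre; fold F1 F2 (gsr d (- p)) in Hre.
apply Rabs_le_between in Hre.
assert (0 < lipconst d * w) by (apply Rmult_lt_0_compat; auto); lra.
Qed.

(** With u = 1 / m the left side is the d-th root of the ratio of consecutive terms n^d p^n just
    after the peak n = m; [one_minus_exp] serves just before it. *)
Lemma one_plus_exp_neg (u : R) : 0 <= u <= 1 -> (1 + u) * exp (- u) <= exp (- (u ^ 2 / 4)).
Proof.
intros Hu.
assert (H := exp_ge_taylor u 3 ltac:(lra)); simpl in H.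
assert (He := exp_pos u).
assert (H1 : 1 + u <= (1 - u ^ 2 / 4) * exp u).
{ apply Rle_trans with ((1 - u ^ 2 / 4) * (1 + u + u ^ 2 / 2 + u ^ 3 / 6)).
  - assert (H2 : 0 <= u ^ 2 * (1 - u)) by (apply Rmult_le_pos; [apply pow2_ge_0|lra]).
    assert (H4 : 0 <= u ^ 3 * (1 - u)) by (apply Rmult_le_pos; [apply pow_le|]; lra).
    assert (H5 : 0 <= u ^ 4 * (1 - u)) by (apply Rmult_le_pos; [apply pow_le|]; lra).
    assert (H6 : 0 <= u ^ 2) by apply pow2_ge_0.
    nra.
  - apply Rmult_le_compat_l; [nra|]. eapply Rle_trans; [|exact H]; right; field. }
rewrite exp_Ropp; apply Rmult_le_reg_r with (exp u); auto.
rewrite Rmult_assoc, Rinv_l, Rmult_1_r by lra.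
eapply Rle_trans; [exact H1|]; apply Rmult_le_compat_r; [lra|].
assert (H2 := exp_ineq1_le (- (u ^ 2 / 4))); lra.
Qed.

Lemma one_minus_exp (u : R) : 0 <= u <= 1 -> (1 - u) * exp u <= exp (- (u ^ 2 / 4)).
Proof.
intros Hu.
assert (Hh : (1 - u / 2) ^ 2 * exp u <= 1).
{ assert (H := exp_ineq1_le (- (u / 2))).
  assert (H1 : (1 - u / 2) ^ 2 <= exp (- (u / 2)) ^ 2) by (apply pow_incr; lra).
  replace (exp (- (u / 2)) ^ 2) with (exp (- u)) in H1.
  2: { replace (- u) with (- (u / 2) + - (u / 2)) by field; rewrite exp_plus; ring. }
  apply Rle_trans with (exp (- u) * exp u).
  - apply Rmult_le_compat_r; [left; apply exp_pos|auto].
  - rewrite <- exp_plus, Rplus_opp_l, exp_0; lra. }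
assert (H2 := exp_ineq1_le (- (u ^ 2 / 4))).
assert (He := exp_pos u).
assert (H3 : 1 <= exp u) by (assert (H := exp_ineq1_le u); lra).
nra.
Qed.

(* The terms n^d p^n with p = e^{-d/m} peak at n = m, with geometric decay on both sides. *)
Lemma saddle_estimate (d m : nat) (q : C) : (8 <= d)%nat -> (1 <= m)%nat -> (8 * m * m <= S d)%nat ->
  Cmod q = exp (- (INR d / INR m)) ->
  Cmod (pl d q - INR m ^ d * q ^ m) <= 1 / 2 * Cmod (INR m ^ d * q ^ m).
Proof.
intros Hd Hm Hdm Hq.
assert (Hm0 : 1 <= INR m) by (apply (le_INR 1); lia).
assert (Hd0 : 8 <= INR d) by (apply (le_INR 8) in Hd; simpl in Hd; lra).
set (u := / INR m).
assert (Hu : 0 < u <= 1).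
{ unfold u; split; [apply Rinv_0_lt_compat; lra|]; rewrite <- Rinv_1; apply Rinv_le_contravar; lra. }
assert (Hmu : INR m * u = 1) by (unfold u; field; lra).
set (p := Cmod q) in *.
assert (Hp : p = exp (- u) ^ d).
{ rewrite Hq, <- Rpower_pow by apply exp_pos; unfold Rpower; rewrite ln_exp; f_equal; unfold u; field; lra. }
assert (Hp0 : 0 < p) by (rewrite Hq; apply exp_pos).
set (g := exp (- (u ^ 2 / 4))).
assert (Hg : 0 < g) by apply exp_pos.
set (x := g ^ d).
assert (Hx0 : 0 < x) by (apply pow_lt; auto).
(* Here the threshold 8 m^2 <= k enters: d / (4 m^2) >= (8 m^2 - 1) / (4 m^2) >= 1.75, and exp 1.75
   > 5. *)
assert (Hx : x <= 1 / 5).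
{ assert (E : x = exp (- (INR d * u ^ 2 / 4))).
  { unfold x, g; rewrite <- Rpower_pow by apply exp_pos; unfold Rpower; rewrite ln_exp; f_equal; field. }
  rewrite E, exp_Ropp; replace (1 / 5) with (/ 5) by field; apply Rinv_le_contravar; [lra|].
  assert (Hlow : 1.75 <= INR d * u ^ 2 / 4).
  { apply le_INR in Hdm; rewrite !mult_INR in Hdm; simpl (INR 8) in Hdm; rewrite S_INR in Hdm.
    assert (Hmm : 8 * (INR m * INR m) <= INR d + 1) by lra.
    apply Rmult_le_reg_r with (INR m * INR m); [nra|].
    replace (INR d * u ^ 2 / 4 * (INR m * INR m)) with (INR d / 4) by (unfold u; field; lra).
    nra. }
  apply Rle_trans with (exp 1.75).
  - assert (H := exp_ge_taylor 1.75 3 ltac:(lra)); simpl in H; lra.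
  - destruct (Req_dec 1.75 (INR d * u ^ 2 / 4)) as [<-|]; [lra|left; apply exp_increasing; lra]. }
set (f := fun n => (RtoC (INR n ^ d) * q ^ n)%C).
assert (Hf : forall n, Cmod (f n) = INR n ^ d * p ^ n).
{ intros n; unfold f; rewrite Cmod_mult, Cmod_R, Cmod_pow, Rabs_pos_eq; auto.
  apply pow_le, pos_INR. }
assert (Hup : forall n, (m <= n)%nat -> Cmod (f (S n)) <= x * Cmod (f n)).
{ intros n Hn; rewrite !Hf.
  assert (Hn1 : INR m <= INR n) by (apply le_INR; auto).
  assert (H1 : INR (S n) * exp (- u) <= g * INR n).
  { rewrite S_INR; apply Rle_trans with (((1 + u) * exp (- u)) * INR n).
    - assert (He := exp_pos (- u)).
      assert (1 <= u * INR n) by nra. nra.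
    - apply Rmult_le_compat_r; [lra|]; apply one_plus_exp_neg; lra. }
  assert (H2 : (INR (S n) * exp (- u)) ^ d <= (g * INR n) ^ d).
  { apply pow_incr; split; [apply Rmult_le_pos; [apply pos_INR|left; apply exp_pos]|auto]. }
  rewrite !Rpow_mult_distr, <- Hp in H2; fold x in H2.
  replace (INR (S n) ^ d * p ^ S n) with (INR (S n) ^ d * p * p ^ n) by (simpl pow; ring).
  rewrite <- Rmult_assoc; apply Rmult_le_compat_r; [apply pow_le; lra|auto]. }
assert (Hdown : forall n, (S n <= m)%nat -> Cmod (f n) <= x * Cmod (f (S n))).
{ intros n Hn; rewrite !Hf.
  assert (Hn1 : INR (S n) <= INR m) by (apply le_INR; auto).
  assert (Hn2 : 0 < INR (S n)) by (apply lt_0_INR; lia).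
  assert (H1 : INR n <= g * (INR (S n) * exp (- u))).
  { apply Rle_trans with ((1 - u) * INR (S n)).
    - rewrite S_INR in *; assert (u * (INR n + 1) <= 1) by nra; lra.
    - assert (H := one_minus_exp u ltac:(lra)); fold g in H.
      assert (He : exp u * exp (- u) = 1) by (rewrite <- exp_plus, Rplus_opp_r; apply exp_0).
      assert (He0 := exp_pos (- u)).
      assert (H2 : (1 - u) <= g * exp (- u)).
      { replace (1 - u) with ((1 - u) * exp u * exp (- u)) by (rewrite Rmult_assoc, He; ring).
        apply Rmult_le_compat_r; lra. }
      replace (g * (INR (S n) * exp (- u))) with ((g * exp (- u)) * INR (S n)) by ring.
      apply Rmult_le_compat_r; lra. }
  assert (H2 : INR n ^ d <= (g * (INR (S n) * exp (- u))) ^ d).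
  { apply pow_incr; split; [apply pos_INR|auto]. }
  rewrite !Rpow_mult_distr, <- Hp in H2; fold x in H2.
  replace (x * (INR (S n) ^ d * p ^ S n)) with (x * (INR (S n) ^ d * p) * p ^ n) by (simpl pow; ring).
  apply Rmult_le_compat_r; [apply pow_le; lra|auto]. }
(* On either side of the peak the geometric sum 1/5 + 1/25 + ... = 1/4 applies. *)
assert (Hlow : forall n, (n <= m)%nat -> rsum (fun i => Cmod (f i)) n <= Cmod (f n) / 4).
{ induction n as [|n IH]; intros Hn; [simpl; assert (H := Cmod_ge_0 (f 0%nat)); lra|].
  cbn [rsum]; specialize (IH ltac:(lia)); specialize (Hdown n Hn).
  assert (H := Cmod_ge_0 (f (S n))); nra. }
assert (Hhigh : forall i, Cmod (f (S m + i)%nat) <= Cmod (f m) * (1 / 5) * (1 / 5) ^ i).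
{ induction i as [|i IH].
  - rewrite Nat.add_0_r; specialize (Hup m (Nat.le_refl m)).
    assert (H := Cmod_ge_0 (f m)); simpl pow; nra.
  - rewrite Nat.add_succ_r; specialize (Hup (S m + i)%nat ltac:(lia)).
    assert (H := Cmod_ge_0 (f (S m + i)%nat)); simpl pow; nra. }
assert (Hq1 : Cmod q < 1).
{ fold p; rewrite Hq, <- exp_0; apply exp_increasing.
  assert (0 < INR d / INR m) by (apply Rdiv_lt_0_compat; lra); lra. }
apply (Ccv_bound _ _ _ _ (S m) (pl_Ccv d q Hq1)).
intros n Hn; replace n with (S m + (n - S m))%nat by lia.
fold f; rewrite csum_add; cbn [csum].
set (L := (n - S m)%nat).
match goal with |- Cmod (?a - ?b)%C <= _ => 
  replace (a - b)%C with (csum f m + csum (fun i => f (S m + i)%nat) L)%C end.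
2: { unfold f; rewrite RtoC_pow; ring. }
eapply Rle_trans; [apply Cmod_triangle|].
assert (H1 : Cmod (csum f m) <= Cmod (f m) / 4).
{ eapply Rle_trans; [apply Cmod_csum|apply Hlow; lia]. }
assert (H2 : Cmod (csum (fun i => f (S m + i)%nat) L) <= Cmod (f m) / 4).
{ eapply Rle_trans; [apply (Cmod_csum_le _ (fun i => Cmod (f m) * (1 / 5) * (1 / 5) ^ i)); intros; apply Hhigh|].
  rewrite rsum_scal; assert (H := rsum_geom (1 / 5) L ltac:(lra)).
  assert (H3 := Cmod_ge_0 (f m)).
  replace (/ (1 - 1 / 5)) with (5 / 4) in H by field.
  change (rsum (pow (1 / 5)) L) with (rsum (fun i => (1 / 5) ^ i) L); nra. }
assert (E : Cmod (f m) = Cmod (RtoC (INR m) ^ d * q ^ m)) by (unfold f; rewrite RtoC_pow; reflexivity).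
lra.
Qed.

Lemma sign_at_saddle (d m : nat) : (8 <= d)%nat -> (1 <= m)%nat -> (8 * m * m <= S d)%nat ->
  0 < (-1) ^ m * gsr d (- exp (- (INR d / INR m))).
Proof.
intros Hd Hm Hdm; set (p := exp (- (INR d / INR m))).
assert (Hp0 : 0 < p) by apply exp_pos.
assert (Hm0 : 1 <= INR m) by (apply (le_INR 1); lia).
assert (Hp : p <= 1 / 8).
{ unfold p; rewrite exp_Ropp; replace (1 / 8) with (/ 8) by field; apply Rinv_le_contravar; [lra|].
  assert (H7 : 7 <= INR d / INR m).
  { apply Rmult_le_reg_r with (INR m); [lra|].
    replace (INR d / INR m * INR m) with (INR d) by (field; lra).
    assert (H : (7 * m <= d)%nat) by nia.
    apply le_INR in H; rewrite mult_INR in H; simpl (INR 7) in H; lra. }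
  assert (H := exp_ineq1_le (INR d / INR m)); lra. }
assert (Hq1 : Cmod (RtoC (- p)) = p) by (rewrite Cmod_R, Rabs_Ropp, Rabs_pos_eq; lra).
assert (Hq2 : Cmod (RtoC p) = p) by (rewrite Cmod_R, Rabs_pos_eq; lra).
assert (H1 := saddle_estimate d m (RtoC (- p)) Hd Hm Hdm Hq1).
assert (H2 := saddle_estimate d m (RtoC p) Hd Hm Hdm Hq2).
assert (H3 := gs_minus_pl d (RtoC (- p)) ltac:(lia) ltac:(lra)); rewrite Hq1 in H3.
rewrite plr_eq in H2.
set (A := INR m ^ d * p ^ m).
assert (HA : 0 < A) by (apply Rmult_lt_0_compat; apply pow_lt; lra).
assert (E2 : (RtoC (INR m) ^ d * RtoC p ^ m)%C = RtoC A) by (unfold A; rewrite RtoC_mult, !RtoC_pow; reflexivity).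
assert (E1 : (RtoC (INR m) ^ d * RtoC (- p) ^ m)%C = RtoC ((-1) ^ m * A)).
{ rewrite <- !RtoC_pow, <- RtoC_mult; f_equal; unfold A.
  replace (- p) with (-1 * p) by ring; rewrite Rpow_mult_distr; ring. }
rewrite E2, <- RtoC_minus, !Cmod_R, (Rabs_pos_eq A) in H2 by lra.
rewrite E1, Cmod_R, Rabs_mult, pow_1_abs, (Rabs_pos_eq A) in H1 by lra.
apply Rabs_le_between in H2.
(* [plr d p] is at most 3/2 of the peak term [A], and d >= 8 makes 2^-d at most 1/256. *)
assert (HP : / 2 ^ d * plr d p / (1 - p) <= A * 0.1).
{ assert (H256 : / 2 ^ d <= 1 / 256).
  { replace (1 / 256) with (/ 2 ^ 8) by field; apply Rinv_le_contravar; [apply pow_lt; lra|].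
    apply Rle_pow; [lra|auto]. }
  assert (0 < / 2 ^ d) by (apply Rinv_0_lt_compat, pow_lt; lra).
  assert (E : / 2 ^ d * plr d p <= A * 0.01) by nra.
  assert (E0 : 0 <= / 2 ^ d * plr d p) by (apply Rmult_le_pos; lra).
  assert (Ei : / (1 - p) <= 8 / 7).
  { replace (8 / 7) with (/ (7 / 8)) by field; apply Rinv_le_contravar; lra. }
  assert (0 < / (1 - p)) by (apply Rinv_0_lt_compat; lra).
  unfold Rdiv at 1; nra. }
assert (H4 : Rabs (gsr d (- p) - (-1) ^ m * A) <= A * 0.6).
{ replace (gsr d (- p) - (-1) ^ m * A) with (Re ((gs d (RtoC (- p)) - pl d (RtoC (- p))) + (pl d (RtoC (- p)) - RtoC ((-1) ^ m * A)))%C).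
  - eapply Rle_trans; [apply re_le_Cmod|]; eapply Rle_trans; [apply Cmod_triangle|]; lra.
  - unfold gsr, Cminus; rewrite !re_plus, !re_opp, re_RtoC; ring. }
assert (E0 := pow_1_abs m).
assert (E : (-1) ^ m = 1 \/ (-1) ^ m = -1) by (unfold Rabs in E0; destruct (Rcase_abs ((-1) ^ m)); lra).
destruct E as [E|E]; rewrite E in *; apply Rabs_le_between in H4; lra.
Qed.

(** * Location of all zeros *)

(** The zero at q = 0, which is the cusp, is removed because [zero_count] asks for a nonzero
    constant term. *)
Definition gs1 (d : nat) (q : C) : C := PS (fun n => RtoC (divisor_sum d (S n))) q.

Lemma gs_gs1 (d : nat) (q : C) : Cmod q < 1 -> gs d q = (q * gs1 d q)%C.
Proof.
intros Hq; destruct (radius_exists (Cmod q)) as [r [Hr Hrq]].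
{ split; auto; apply Cmod_ge_0. }
destruct (divisor_sum_geo d r Hr) as [K HK].
assert (H := PS_head K r _ q HK ltac:(lra) Hrq); unfold gs, gs1; rewrite H.
cbv beta; rewrite divisor_sum_0; ring.
Qed.

Lemma fcont_pow (f : R -> C) (x : R) (n : nat) : fcont f x -> fcont (fun y => f y ^ n)%C x.
Proof.
intros Hf; induction n as [|n IH].
- split; apply continuity_pt_const; intros u v; reflexivity.
- exact (fcont_mult f (fun y => f y ^ n)%C x Hf IH).
Qed.

Lemma nom_circ (t x : R) : nom (t, - x) = circ (exp (- (2 * PI * t))) x.
Proof.
unfold nom, circ; rewrite Cexp_cis, re_opp, im_opp, re_scal_l, im_scal_l.
simpl Re; simpl Im; f_equal; f_equal; ring.
Qed.

Lemma circle_real_part (delta x : R) (h d M : nat) :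
  PI / 6 <= delta <= 0.74 -> INR (S d) * delta = INR M * PI -> - (1 / 2) <= x <= 1 / 2 ->
  (4 <= h)%nat -> (d = 2 * h)%nat ->
  0 < Re ((height delta, - x) ^ S d * gs d (circ (exp (- (2 * PI * height delta))) x)).
Proof.
intros Hd HM Hx Hh Hdh; rewrite <- nom_circ.
destruct (Rle_lt_dec x 0) as [H0|H0].
- apply (circle_real_part_half delta (- x) h d M); auto; lra.
- assert (H := circle_real_part_half delta x h d M Hd HM ltac:(lra) Hh Hdh).
  cbv zeta in H; rewrite <- re_conj, Cmult_conj, Cpow_conj, <- gs_conj, <- nom_conj in H.
  exact H.
Qed.

Lemma polar_modulus (z : C) (r a : R) : 0 <= r -> z = (RtoC r * cis a)%C -> z = (RtoC (Cmod z) * cis a)%C.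
Proof. intros Hr E; rewrite E at 2; rewrite Cmod_scal_cis by auto; exact E. Qed.

(** As gs1 q s^k = H has positive real part, arg gs1 = arg H - k arg s - 2 pi x. Along the circle
    arg s runs from delta to -delta, so the last two terms change by 2 k delta - 2 pi = 2 pi (M -
    1), and arg H changes by less than pi. *)
Lemma gs1_lift (delta : R) (h d M : nat) :
  PI / 6 <= delta <= 0.74 -> INR (S d) * delta = INR M * PI -> (1 <= M)%nat ->
  (4 <= h)%nat -> (d = 2 * h)%nat ->
  let R0 := exp (- (2 * PI * height delta)) in
  (forall x, - (1 / 2) <= x <= 1 / 2 -> gs1 d (circ R0 x) <> 0) /\
  exists al, lifts (fun x => gs1 d (circ R0 x)) (- (1 / 2)) (1 / 2) al /\
    Rabs (al (1 / 2) - al (- (1 / 2)) - 2 * PI * INR (M - 1)) < 2 * PI.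
Proof.
intros Hd HM HM1 Hh Hdh R0; assert (HPI := PI_gt_3).
assert (Hd0 : 0 < delta <= 0.74) by lra.
destruct (height_facts delta Hd0) as [Ht [_ [_ Hp]]]; fold R0 in Hp.
destruct (trig_bounds delta Hd0) as [_ [Hsin [Hcos _]]].
assert (HR0 : 0 < R0) by apply exp_pos.
set (t := height delta) in *.
set (s := fun x : R => (t, - x) : C).
set (H := fun x => (s x ^ S d * gs d (circ R0 x))%C).
assert (HH : forall x, - (1 / 2) <= x <= 1 / 2 -> 0 < Re (H x)).
{ intros x Hx; apply (circle_real_part delta x h d M); auto. }
assert (Hsre : forall x, 0 < Re (s x)) by (intros x; simpl; lra).
assert (Hsnz : forall x, s x <> 0).
{ intros x E; specialize (Hsre x); rewrite E in Hsre; simpl in Hsre; lra. }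
assert (Hcmod : forall x, Cmod (circ R0 x) = R0) by (intros x; apply Cmod_circ; lra).
assert (Hcnz : forall x, circ R0 x <> 0) by (intros x; apply Cmod_gt_0; rewrite Hcmod; auto).
assert (HG : forall x, (gs1 d (circ R0 x) * (circ R0 x * s x ^ S d) = H x)%C).
{ intros x; unfold H; rewrite gs_gs1 by (rewrite Hcmod; lra); ring. }
split.
{ intros x Hx E; specialize (HH x Hx); rewrite <- HG, E, Cmult_0_l in HH; simpl in HH; lra. }
set (be := fun x => atan (Im (H x) / Re (H x))).
set (th := fun x => atan (Im (s x) / Re (s x))).
exists (fun x => be x - INR (S d) * th x - 2 * PI * x).
assert (Hscont : forall x, fcont s x).
{ intros x; split.
  - apply continuity_pt_const; intros u v; reflexivity.
  - apply continuity_pt_opp, derivable_continuous_pt, derivable_pt_id. }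
split.
- intros x Hx; specialize (HH x Hx); split.
  + apply continuity_pt_minus; [apply continuity_pt_minus|].
    * apply fcont_atan; auto; unfold H; apply fcont_mult; [apply fcont_pow, Hscont|].
      destruct (divisor_sum_geo d 2 ltac:(lra)) as [K HK].
      apply (PS_circ_cont K 2); auto; lra.
    * apply continuity_pt_mult; [apply continuity_pt_const; intros u v; reflexivity|].
      apply (fcont_atan s x); auto.
    * apply continuity_pt_mult; [apply continuity_pt_const; intros u v; reflexivity|].
      apply derivable_continuous_pt, derivable_pt_id.
  + assert (Hbe := polar_of_Re_pos (H x) HH); fold (be x) in Hbe.
    assert (Hth := polar_of_Re_pos (s x) (Hsre x)); fold (th x) in Hth.
    assert (Hsm : 0 < Cmod (s x)) by (apply Cmod_gt_0, Hsnz).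
    assert (Hsk : 0 < Cmod (s x) ^ S d) by (apply pow_lt; auto).
    apply (polar_modulus _ (Cmod (H x) / (R0 * Cmod (s x) ^ S d))).
    { apply Rmult_le_pos; [apply Cmod_ge_0|left; apply Rinv_0_lt_compat, Rmult_lt_0_compat; auto]. }
    assert (Hnz : (circ R0 x * s x ^ S d)%C <> 0) by (apply Cmult_neq_0; [auto|apply Cpow_nz; auto]).
    transitivity (H x / (circ R0 x * s x ^ S d))%C; [rewrite <- HG; field; split; auto; apply Cpow_nz; auto|].
    assert (HskE : (s x ^ S d)%C = (RtoC (Cmod (s x) ^ S d) * cis (INR (S d) * th x))%C).
    { rewrite Hth at 1; rewrite Cpow_mult_l, cis_pow, RtoC_pow; reflexivity. }
    set (w := Cmod (s x) ^ S d) in *.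
    rewrite HskE; rewrite Hbe at 1; unfold circ.
    replace (be x - INR (S d) * th x - 2 * PI * x) with (be x + (- (INR (S d) * th x) + - (2 * PI * x))) by ring.
    rewrite !cis_plus, !cis_opp.
    set (c1 := cis (INR (S d) * th x)); set (c2 := cis (2 * PI * x)).
    assert (E1 : (c1 * Cconj c1 = 1)%C) by (unfold c1; rewrite <- cis_opp, <- cis_plus, Rplus_opp_r; apply cis_0).
    assert (E2 : (c2 * Cconj c2 = 1)%C) by (unfold c2; rewrite <- cis_opp, <- cis_plus, Rplus_opp_r; apply cis_0).
    assert (N1 : c1 <> 0) by apply cis_nz; assert (N2 : c2 <> 0) by apply cis_nz.
    assert (N3 : RtoC R0 <> 0) by (apply RtoC_neq; lra).
    assert (N4 : RtoC w <> 0) by (apply RtoC_neq; lra).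
    assert (F1 : Cconj c1 = (/ c1)%C).
    { transitivity (/ c1 * (c1 * Cconj c1))%C; [field; auto|rewrite E1; ring]. }
    assert (F2 : Cconj c2 = (/ c2)%C).
    { transitivity (/ c2 * (c2 * Cconj c2))%C; [field; auto|rewrite E2; ring]. }
    rewrite F1, F2, RtoC_div, RtoC_mult by nra.
    field; repeat split; auto.
- assert (Htan : 1 / (2 * t) = tan delta).
  { unfold t, height, tan; field; split; lra. }
  assert (Eth : th (1 / 2) = - delta).
  { unfold th; simpl; replace (- (1 / 2) / t) with (- (1 / (2 * t))) by (field; lra).
    rewrite Htan, <- tan_neg, atan_tan; lra. }
  assert (Eth' : th (- (1 / 2)) = delta).
  { unfold th; simpl; replace (- - (1 / 2) / t) with (1 / (2 * t)) by (field; lra).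
    rewrite Htan, atan_tan; lra. }
  rewrite Eth, Eth', minus_INR by auto; simpl (INR 1).
  assert (B1 := atan_bound (Im (H (1 / 2)) / Re (H (1 / 2)))); fold (be (1 / 2)) in B1.
  assert (B2 := atan_bound (Im (H (- (1 / 2))) / Re (H (- (1 / 2))))); fold (be (- (1 / 2))) in B2.
  replace (be (1 / 2) - INR (S d) * - delta - 2 * PI * (1 / 2) -
    (be (- (1 / 2)) - INR (S d) * delta - 2 * PI * - (1 / 2)) - 2 * PI * (INR M - 1)) with
    (be (1 / 2) - be (- (1 / 2)) + 2 * (INR (S d) * delta - INR M * PI)) by field.
  rewrite HM; apply Rabs_lt_between; lra.
Qed.

(** The radius r_m: the saddle point of m^d q^m below the threshold, and above it the height at
    which cos(m pi) makes the main term extremal. *)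
Definition sample (d m : nat) : R :=
  if (8 * m * m <=? S d)%nat then exp (- (INR d / INR m))
  else exp (- (2 * PI * height (INR m * PI / INR (S d)))).

Lemma sample_sign (d h m : nat) : (4 <= h)%nat -> (d = 2 * h)%nat -> (1 <= m)%nat ->
  (13 * m <= 3 * S d)%nat -> 0 < (-1) ^ m * gsr d (- sample d m).
Proof.
intros Hh Hd Hm Hm2; unfold sample; destruct (Nat.leb_spec (8 * m * m) (S d)).
- apply sign_at_saddle; auto; lia.
- apply (sign_at_extremum d h m); auto; lia.
Qed.

Lemma angle_bounds (k m : nat) : (1 <= m)%nat -> (13 * m <= 3 * k)%nat ->
  0 < INR m * PI / INR k <= 0.74.
Proof.
intros Hm Hm2; assert (HPI := PI_gt_3); assert (HPI' := PI_lt_3_2).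
assert (Hk0 : 0 < INR k) by (apply lt_0_INR; lia).
assert (Hm0 : 1 <= INR m) by (apply (le_INR 1); lia).
apply le_INR in Hm2; rewrite !mult_INR in Hm2; simpl (INR 13) in Hm2; simpl (INR 3) in Hm2.
split.
- apply Rdiv_lt_0_compat; auto; apply Rmult_lt_0_compat; lra.
- apply Rmult_le_reg_r with (INR k); auto.
  replace (INR m * PI / INR k * INR k) with (INR m * PI) by (field; lra); nra.
Qed.

Lemma height_decreasing (x y : R) : 0 < x < y -> y <= 0.74 -> height y < height x.
Proof.
intros Hxy Hy; assert (HPI := PI_gt_3); unfold height.
destruct (trig_bounds x ltac:(lra)) as [_ [Hx1 _]].
destruct (trig_bounds y ltac:(lra)) as [_ [Hy1 _]].
assert (H := sin_gt_0 (y - x) ltac:(lra) ltac:(lra)); rewrite sin_minus in H.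
apply Rmult_lt_reg_r with (2 * sin x * sin y); [nra|].
replace (cos y / (2 * sin y) * (2 * sin x * sin y)) with (cos y * sin x) by (field; lra).
replace (cos x / (2 * sin x) * (2 * sin x * sin y)) with (cos x * sin y) by (field; lra).
lra.
Qed.

(** This is tan x >= x; it compares extremal heights with saddle points where the two formulas for
    [sample] meet. *)
Lemma height_upper (x : R) : 0 < x <= 0.74 -> height x <= 1 / (2 * x).
Proof.
intros Hx; assert (HPI := PI_gt_3); unfold height.
destruct (trig_bounds x Hx) as [_ [Hs [Hc _]]].
apply Rmult_le_reg_r with (2 * sin x * x); [nra|].
replace (cos x / (2 * sin x) * (2 * sin x * x)) with (x * cos x) by (field; lra).
replace (1 / (2 * x) * (2 * sin x * x)) with (sin x) by (field; lra).
assert (H1 := sin_cubic_lower x ltac:(lra)).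
assert (H3 := one_minus_cos x).
assert (H5 := sin_cubic_lower (x / 2) ltac:(lra)).
assert (H6 : 0.45 * x <= sin (x / 2)).
{ eapply Rle_trans; [|exact H5]; assert (x ^ 2 <= 0.5476) by nra; simpl in *; nra. }
assert (H7 : (0.45 * x) ^ 2 <= sin (x / 2) ^ 2) by (apply pow_incr; lra).
assert (H8 : cos x <= 1 - 0.4 * x ^ 2) by nra.
assert (H9 : x * cos x <= x * (1 - 0.4 * x ^ 2)) by (apply Rmult_le_compat_l; lra).
assert (0 < x ^ 3) by (apply pow_lt; lra); simpl in *; nra.
Qed.

Lemma sample_increasing (d m : nat) : (8 <= d)%nat -> (1 <= m)%nat ->
  (13 * S m <= 3 * S d)%nat -> sample d m < sample d (S m).
Proof.
intros Hd Hm Hm2; assert (HPI := PI_gt_3).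
assert (Hm0 : 1 <= INR m) by (apply (le_INR 1); lia).
assert (Hd0 : 8 <= INR d) by (apply (le_INR 8) in Hd; simpl in Hd; lra).
assert (Hk0 : 0 < INR (S d)) by (apply lt_0_INR; lia).
unfold sample; destruct (Nat.leb_spec (8 * m * m) (S d)) as [H1|H1];
  destruct (Nat.leb_spec (8 * S m * S m) (S d)) as [H2|H2]; try nia;
  apply exp_increasing, Ropp_lt_contravar.
- rewrite S_INR; apply Rmult_lt_compat_l; [lra|]; apply Rinv_lt_contravar; nra.
(* The change of regime between m and m + 1: 2 pi times the height is at most k / (m + 1), which is
   below d / m because m + 1 < k. *)
- assert (Ha := angle_bounds (S d) (S m) ltac:(lia) Hm2).
  assert (Hu := height_upper _ Ha).
  apply Rle_lt_trans with (2 * PI * (1 / (2 * (INR (S m) * PI / INR (S d))))).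
  { apply Rmult_le_compat_l; lra. }
  replace (2 * PI * (1 / (2 * (INR (S m) * PI / INR (S d))))) with (INR (S d) / INR (S m)).
  2: { field; repeat split; try lra; rewrite S_INR; lra. }
  assert (Hlt : INR m + 1 < INR (S d)).
  { rewrite <- S_INR; apply lt_INR; lia. }
  apply Rmult_lt_reg_r with (INR m * INR (S m)); [rewrite S_INR; nra|].
  replace (INR (S d) / INR (S m) * (INR m * INR (S m))) with (INR (S d) * INR m)
    by (field; rewrite S_INR; lra).
  replace (INR d / INR m * (INR m * INR (S m))) with (INR d * INR (S m)) by (field; lra).
  rewrite !S_INR in *; nra.
- apply Rmult_lt_compat_l; [lra|].
  assert (Ha := angle_bounds (S d) (S m) ltac:(lia) Hm2).
  assert (Ha' := angle_bounds (S d) m ltac:(lia) ltac:(lia)).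
  apply height_decreasing; [|lra]; split; [lra|].
  unfold Rdiv; apply Rmult_lt_compat_r; [apply Rinv_0_lt_compat; auto|].
  rewrite S_INR; lra.
Qed.

Lemma gsr_continuous (d : nat) (x : R) : Rabs x <= 1 / 4 -> continuity_pt (gsr d) x.
Proof.
intros Hx e He.
destruct (divisor_sum_geo d 2 ltac:(lra)) as [K HK].
set (L := K * 2 / (1 - 2 * (3 / 8)) ^ 2).
assert (HL : 0 <= L).
{ assert (HK0 := geo_pos _ _ _ HK); apply Rmult_le_pos; [lra|].
  left; apply Rinv_0_lt_compat, pow_lt; lra. }
exists (Rmin (1 / 8) (e / (L + 1))); split.
- apply Rmin_glb_lt; [lra|apply Rdiv_lt_0_compat; lra].
- intros y [_ Hy]; simpl in *; unfold Rdist in *.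
  assert (H1 := Rmin_l (1 / 8) (e / (L + 1))); assert (H2 := Rmin_r (1 / 8) (e / (L + 1))).
  assert (Hy' : Rabs y <= 3 / 8).
  { replace y with ((y - x) + x) by ring; eapply Rle_trans; [apply Rabs_triang|lra]. }
  assert (Hl := PS_lip K 2 (3 / 8) _ (RtoC x) (RtoC y) HK ltac:(lra) ltac:(lra)).
  rewrite !Cmod_R in Hl; specialize (Hl ltac:(lra) ltac:(lra)).
  rewrite <- RtoC_minus, Cmod_R in Hl.
  fold (gs d (RtoC x)) (gs d (RtoC y)) L in Hl.
  rewrite !gs_real, <- RtoC_minus, Cmod_R in Hl.
  eapply Rle_lt_trans; [exact Hl|].
  apply Rle_lt_trans with ((L + 1) * Rabs (y - x)).
  { apply Rmult_le_compat_r; [apply Rabs_pos|unfold L; lra]. }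
  apply Rlt_le_trans with ((L + 1) * (e / (L + 1))); [apply Rmult_lt_compat_l; lra|].
  right; field; lra.
Qed.

Lemma gsr_zero_between (d : nat) (a b : R) : 0 < a < b -> b <= 1 / 4 ->
  gsr d (- a) * gsr d (- b) < 0 -> exists x, a < x < b /\ gsr d (- x) = 0.
Proof.
intros Hab Hb Hs.
assert (Hc : forall y, a <= y <= b -> continuity_pt (fun x => gsr d (- x)) y).
{ intros y Hy; apply (continuity_pt_comp (fun x => - x) (gsr d)).
  - apply continuity_pt_opp, derivable_continuous_pt, derivable_pt_id.
  - apply gsr_continuous; rewrite Rabs_Ropp, Rabs_pos_eq; lra. }
assert (Hfin : forall x, a <= x <= b -> gsr d (- x) = 0 -> a < x < b).
{ intros x Hx E; split.
  - destruct (Req_dec a x) as [->|]; [rewrite E in Hs|]; lra.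
  - destruct (Req_dec x b) as [->|]; [rewrite E in Hs|]; lra. }
destruct (Rlt_le_dec (gsr d (- a)) 0) as [H|H].
- assert (Hlt : a < b) by lra; assert (Hpos : 0 < gsr d (- b)) by nra.
  destruct (IVT_interv (fun x => gsr d (- x)) a b Hc Hlt H Hpos) as [x [Hx E]].
  exists x; auto.
- assert (Hlt : a < b) by lra; assert (Hpos : 0 < - gsr d (- b)) by nra.
  assert (Hneg : - gsr d (- a) < 0) by nra.
  assert (Hc' : forall y, a <= y <= b -> continuity_pt (fun x => - gsr d (- x)) y).
  { intros y Hy; apply (continuity_pt_opp (fun x => gsr d (- x))); auto. }
  destruct (IVT_interv (fun x => - gsr d (- x)) a b Hc' Hlt Hneg Hpos) as [x [Hx E]].
  exists x; split; [apply Hfin|]; lra.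
Qed.

Lemma lin_prod_perm (l l' : list C) (q : C) : Permutation l l' -> lin_prod l q = lin_prod l' q.
Proof.
induction 1 as [|g l l' _ IH|g g' l|l l' l'' _ IH1 _ IH2]; simpl; auto.
- rewrite IH; reflexivity.
- ring.
- rewrite IH1; exact IH2.
Qed.

Lemma lin_prod_0_In (l : list C) (q : C) : lin_prod l q = 0 -> In q l.
Proof.
intros H; destruct (classic (In q l)) as [|Hn]; auto.
exfalso; exact (lin_prod_nz l q Hn H).
Qed.

(** The sign changes give M - 1 distinct zeros and the winding number gives M - 1 linear factors in
    all; the two lists must agree. *)
Theorem gs_zeros (d h M : nat) : (4 <= h)%nat -> (d = 2 * h)%nat -> (S d < 8 * M * M)%nat ->
  (13 * M <= 3 * S d)%nat -> (S d <= 6 * M)%nat ->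
  exists (z : nat -> R) (b : nat -> C) (K : R),
    (forall m, (1 <= m < M)%nat -> sample d m < z m < sample d (S m)) /\
    geo K 2 b /\
    (forall q, Cmod q < 1 / 2 ->
       gs d q = (q * lin_prod (map (fun m => RtoC (- z m)) (seq 1 (M - 1))) q * PS b q)%C) /\
    (forall q, Cmod q <= sample d M -> PS b q <> 0).
Proof.
intros Hh Hd HM1 HM2 HM3; assert (HPI := PI_gt_3).
assert (HM0 : (1 <= M)%nat) by nia.
set (delta := INR M * PI / INR (S d)).
assert (Hk0 : 0 < INR (S d)) by (apply lt_0_INR; lia).
assert (Hdel := angle_bounds (S d) M HM0 HM2); fold delta in Hdel.
assert (Hdel6 : PI / 6 <= delta).
{ unfold delta; apply Rmult_le_reg_r with (INR (S d)); auto.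
  replace (INR M * PI / INR (S d) * INR (S d)) with (INR M * PI) by (field; lra).
  apply le_INR in HM3; rewrite mult_INR in HM3; simpl (INR 6) in HM3; nra. }
assert (HkM : INR (S d) * delta = INR M * PI) by (unfold delta; field; lra).
destruct (height_facts delta Hdel) as [_ [_ [_ HR8]]].
assert (Hsamp : sample d M = exp (- (2 * PI * height delta))).
{ unfold sample; destruct (Nat.leb_spec (8 * M * M) (S d)); [lia|reflexivity]. }
set (R0 := sample d M) in *; rewrite <- Hsamp in HR8.
assert (HR0 : 0 < R0) by (rewrite Hsamp; apply exp_pos).
assert (Hmono : forall i m, (1 <= m)%nat -> (m + i <= M)%nat -> sample d m <= sample d (m + i)).
{ induction i as [|i IH]; intros m Hm Hmi; [rewrite Nat.add_0_r; lra|].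
  rewrite Nat.add_succ_r; specialize (IH m Hm ltac:(lia)).
  assert (H := sample_increasing d (m + i) ltac:(lia) ltac:(lia) ltac:(lia)); lra. }
assert (HsR : forall m, (1 <= m <= M)%nat -> 0 < sample d m <= R0).
{ intros m Hm; split.
  - unfold sample; destruct (8 * m * m <=? S d)%nat; apply exp_pos.
  - unfold R0; replace M with (m + (M - m))%nat by lia; apply Hmono; lia. }
assert (Hex : forall m, exists x, (1 <= m < M)%nat ->
  sample d m < x < sample d (S m) /\ gsr d (- x) = 0).
{ intros m; destruct (classic (1 <= m < M)%nat) as [Hm|Hm]; [|exists 0; tauto].
  assert (H1 := HsR m ltac:(lia)); assert (H2 := HsR (S m) ltac:(lia)).
  assert (H3 := sample_increasing d m ltac:(lia) ltac:(lia) ltac:(lia)).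
  assert (S1 := sample_sign d h m Hh Hd ltac:(lia) ltac:(lia)).
  assert (S2 := sample_sign d h (S m) Hh Hd ltac:(lia) ltac:(lia)).
  destruct (gsr_zero_between d (sample d m) (sample d (S m))) as [x Hx]; try lra.
  - rewrite <- tech_pow_Rmult in S2.
    assert (E := pow_1_abs m); set (e := (-1) ^ m) in *.
    assert (He : e * e = 1).
    { unfold Rabs in E; destruct (Rcase_abs e); nra. }
    set (u := gsr d (- sample d m)) in *; set (v := gsr d (- sample d (S m))) in *.
    assert (0 < (e * u) * (-1 * e * v)) by (apply Rmult_lt_0_compat; auto).
    replace ((e * u) * (-1 * e * v)) with (- (e * e) * (u * v)) in H by ring.
    rewrite He in H; lra.
  - exists x; auto. }
set (z := fun m => proj1_sig (constructive_indefinite_description _ (Hex m))).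
assert (Hz : forall m, (1 <= m < M)%nat -> sample d m < z m < sample d (S m) /\ gsr d (- z m) = 0).
{ intros m; unfold z; destruct (constructive_indefinite_description _ (Hex m)); auto. }
destruct (divisor_sum_geo d 2 ltac:(lra)) as [K0 HK0].
destruct (gs1_lift delta h d M ltac:(lra) HkM HM0 Hh Hd) as [Hcirc [al [Hal HalW]]].
cbv zeta in Hcirc, Hal; rewrite <- Hsamp in Hcirc, Hal.
destruct (zero_count (K0 * 2 ^ 1) 2 R0 (fun n => RtoC (divisor_sum d (S n))) al (M - 1)
  (geo_tail K0 2 _ 1 HK0 ltac:(lra))) as [l [b [K [Hlen [Hb [_ [Hfac Hnz]]]]]]]; auto; try lra.
{ rewrite divisor_sum_1; apply RtoC_neq; lra. }
set (xs := map (fun m => RtoC (- z m)) (seq 1 (M - 1))).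
exists z, b, K; split; [intros m Hm; apply Hz, Hm|]; split; [exact Hb|]; split; [|exact Hnz].
assert (Hin : forall m, (1 <= m < M)%nat -> In (RtoC (- z m)) l).
{ intros m Hm; destruct (Hz m Hm) as [[Hz1 Hz2] Hz0].
  assert (H1 := HsR m ltac:(lia)); assert (H2 := HsR (S m) ltac:(lia)).
  assert (Hmod : Cmod (RtoC (- z m)) = z m) by (rewrite Cmod_R, Rabs_Ropp, Rabs_pos_eq; lra).
  apply lin_prod_0_In.
  assert (Hg : gs1 d (RtoC (- z m)) = 0).
  { assert (E := gs_gs1 d (RtoC (- z m)) ltac:(lra)); rewrite gs_real, Hz0 in E.
    destruct (Ceq_dec (gs1 d (RtoC (- z m))) 0) as [|Hne]; auto.
    exfalso; apply (Cmult_neq_0 (RtoC (- z m)) _) in Hne; [auto|apply RtoC_neq; lra]. }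
  unfold gs1 in Hg; rewrite Hfac in Hg by lra.
  destruct (Ceq_dec (lin_prod l (RtoC (- z m))) 0) as [|Hne]; auto.
  exfalso; apply (Cmult_neq_0 _ (PS b (RtoC (- z m)))) in Hne; [auto|].
  apply Hnz; lra. }
assert (Hzinc : forall m n, (1 <= m < n)%nat -> (n < M)%nat -> z m < z n).
{ intros m n Hmn Hn; destruct (Hz m ltac:(lia)) as [[_ H1] _]; destruct (Hz n ltac:(lia)) as [[H2 _] _].
  assert (H3 := Hmono (n - S m)%nat (S m) ltac:(lia) ltac:(lia)).
  replace (S m + (n - S m))%nat with n in H3 by lia; lra. }
assert (Hnd : NoDup xs).
{ assert (G : forall i j, (1 <= i)%nat -> (i + j <= M)%nat ->
    NoDup (map (fun m => RtoC (- z m)) (seq i j))).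
  { intros i j; revert i; induction j as [|j IH]; intros i Hi Hij; simpl; constructor.
    - intros H; apply in_map_iff in H; destruct H as [n [E Hn]]; apply in_seq in Hn.
      injection E; intros E'.
      assert (H := Hzinc i n ltac:(lia) ltac:(lia)); lra.
    - apply IH; lia. }
  apply G; lia. }
assert (Hincl : incl xs l).
{ intros x Hx; apply in_map_iff in Hx; destruct Hx as [m [<- Hm]]; apply in_seq in Hm; apply Hin; lia. }
assert (Hxlen : length xs = (M - 1)%nat) by (unfold xs; rewrite length_map, length_seq; reflexivity).
(* Both lists have length M - 1 and [xs] has no repetition, so inclusion already forces equality up
   to order. *)
assert (Hperm : Permutation l xs).
{ symmetry; apply NoDup_Permutation_bis; auto; rewrite Hlen, Hxlen; auto. }
intros q Hq; rewrite gs_gs1 by lra; unfold gs1; rewrite Hfac by lra.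
rewrite (lin_prod_perm _ _ q Hperm); unfold xs; ring.
Qed.

(** * Orders of vanishing *)

Definition Cd (f : C -> C) (z : C) : Prop := @ex_derive C_AbsRing C_NormedModule f z.

(* Coquelicot's product and chain rules are stated for the normed module attached to the absolute ring. *)
Lemma is_derive_AbsRing (f : C -> C) (z l : C) :
  @is_derive C_AbsRing C_NormedModule f z l <->
  @is_derive C_AbsRing (AbsRing_NormedModule C_AbsRing) f z l.
Proof. split; intros [[p s n] H]; (split; [split; [exact p|exact s|exact n]|exact H]). Qed.

Lemma Cd_mult (f g : C -> C) (z : C) : Cd f z -> Cd g z -> Cd (fun x => f x * g x)%C z.
Proof.
intros [a Ha] [b Hb]; exists (plus (mult a (g z)) (mult (f z) b)).
apply is_derive_AbsRing in Ha, Hb; apply is_derive_AbsRing.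
exact (@is_derive_mult C_AbsRing f g z a b Ha Hb Cmult_comm).
Qed.

Lemma Cd_comp (f g : C -> C) (z : C) : Cd f (g z) -> Cd g z -> Cd (fun x => f (g x)) z.
Proof.
intros [a Ha] [b Hb]; exists (scal b a).
apply is_derive_AbsRing in Hb.
exact (@is_derive_comp C_AbsRing C_NormedModule f g z a b Ha Hb).
Qed.

Lemma Cd_const (c z : C) : Cd (fun _ => c) z.
Proof. exists zero; apply (@is_derive_const C_AbsRing C_NormedModule). Qed.

Lemma Cd_id (z : C) : Cd (fun x => x) z.
Proof. exists one; apply is_derive_AbsRing; exact (@is_derive_id C_AbsRing z). Qed.

Lemma Cd_minus_const (c z : C) : Cd (fun x => x - c)%C z.
Proof.
destruct (Cd_id z) as [a Ha]; destruct (Cd_const c z) as [b Hb]; exists (minus a b).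
exact (@is_derive_minus C_AbsRing C_NormedModule (fun x => x) (fun _ => c) z a b Ha Hb).
Qed.

Lemma Cd_ext_loc (f g : C -> C) (z : C) :
  locally (T := C_UniformSpace) z (fun x => f x = g x) -> Cd f z -> Cd g z.
Proof.
intros H Hf; apply locally_C in H.
exact (@ex_derive_ext_loc C_AbsRing C_NormedModule f g z H Hf).
Qed.

Lemma locally_Cmod (z : C) (P : C -> Prop) (e : R) : 0 < e ->
  (forall w, Cmod (w - z) < e -> P w) -> locally (T := C_UniformSpace) z P.
Proof.
intros He H; apply locally_C; exists (mkposreal e He); intros w Hw; apply H, Hw.
Qed.

Lemma Cd_PS (K r : R) (a : nat -> C) (z : C) :
  geo K r a -> 0 < r -> r * Cmod z < 1 -> Cd (PS a) z.
Proof. intros Ha Hr Hz; eexists; apply (PS_is_derive K r); auto. Qed.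

(** * The exponential as a power series, and the nome as a local coordinate *)

Definition Rd (f f' : R -> C) : Prop := forall s,
  is_derive (fun s => Re (f s)) s (Re (f' s)) /\ is_derive (fun s => Im (f s)) s (Im (f' s)).

(** The first n Taylor terms of e^(s w) in the real parameter s, which reduces the remainder to real
    mean value estimates. *)
Definition exp_partial (w : C) (n : nat) (s : R) : C :=
  csum (fun j => w ^ j * RtoC (/ INR (fact j)) * RtoC (s ^ j))%C n.

Lemma Rd_exp_partial (w : C) (n : nat) :
  Rd (exp_partial w (S n)) (fun s => w * exp_partial w n s)%C.
Proof.
assert (Hpow : forall (c : R) j s, is_derive (fun s => c * s ^ S j) s (c * (INR (S j) * s ^ j))).
{ intros c j s; apply is_derive_Reals.
  apply (derivable_pt_lim_scal (fun s => s ^ S j)); apply (derivable_pt_lim_pow s (S j)). }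
induction n as [|n IH]; intros s.
- unfold exp_partial; cbn [csum]; rewrite Cmult_0_r; simpl Re; simpl Im.
  split; (eapply is_derive_ext; [|apply (@is_derive_const R_AbsRing R_NormedModule)]); reflexivity.
- destruct (IH s) as [H1 H2].
  set (c := (w ^ S n * RtoC (/ INR (fact (S n))))%C).
  assert (E : forall s, exp_partial w (S (S n)) s = (exp_partial w (S n) s + c * RtoC (s ^ S n))%C)
    by reflexivity.
  assert (E' : (w * exp_partial w (S n) s = w * exp_partial w n s + c * RtoC (INR (S n) * s ^ n))%C).
  { unfold exp_partial at 1; cbn [csum]; fold (exp_partial w n s); rewrite Cmult_plus_distr_l; f_equal.
    unfold c; rewrite RtoC_mult.
    assert (Hf := INR_fact_neq_0 n); assert (Hs : INR (S n) <> 0) by (apply not_0_INR; lia).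
    rewrite fact_simpl, mult_INR, !RtoC_inv, RtoC_mult by (auto; apply Rmult_integral_contrapositive; auto).
    assert (Hf' := RtoC_neq _ Hf); assert (Hs' := RtoC_neq _ Hs).
    rewrite Cpow_S; field; auto. }
  rewrite E', re_plus, im_plus, re_scal_r, im_scal_r; split.
  + apply (is_derive_ext (fun s => Re (exp_partial w (S n) s) + Re c * s ^ S n)).
    { intros x; rewrite E, re_plus, re_scal_r; reflexivity. }
    apply (@is_derive_plus R_AbsRing R_NormedModule); auto; apply Hpow.
  + apply (is_derive_ext (fun s => Im (exp_partial w (S n) s) + Im c * s ^ S n)).
    { intros x; rewrite E, im_plus, im_scal_r; reflexivity. }
    apply (@is_derive_plus R_AbsRing R_NormedModule); auto; apply Hpow.
Qed.

Lemma Rd_Cexp (w : C) : Rd (fun s => Cexp (RtoC s * w)) (fun s => w * Cexp (RtoC s * w))%C.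
Proof.
destruct w as [a b]; intros s; split.
- apply (is_derive_ext (fun s => exp (s * a) * cos (s * b))).
  { intros x; simpl; f_equal; f_equal; ring. }
  auto_derive; [exact I|]; simpl.
  replace (s * a - 0 * b) with (s * a) by ring; replace (s * b + 0 * a) with (s * b) by ring; ring.
- apply (is_derive_ext (fun s => exp (s * a) * sin (s * b))).
  { intros x; simpl; f_equal; f_equal; ring. }
  auto_derive; [exact I|]; simpl.
  replace (s * a - 0 * b) with (s * a) by ring; replace (s * b + 0 * a) with (s * b) by ring; ring.
Qed.

Lemma mean_value_bound (F F' : R -> R) (B s : R) : 0 <= s <= 1 -> F 0 = 0 -> 0 <= B ->
  (forall x, is_derive F x (F' x)) -> (forall x, 0 <= x <= 1 -> Rabs (F' x) <= B) -> Rabs (F s) <= B.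
Proof.
intros Hs H0 HB Hd Hb.
destruct (MVT_gen F 0 s F') as [c [Hc E]].
- intros x _; apply Hd.
- intros x _; apply derivable_continuous_pt; exists (F' x); apply is_derive_Reals, Hd.
- rewrite H0, !Rminus_0_r in E; rewrite E, Rabs_mult, (Rabs_pos_eq s) by lra.
  rewrite Rmin_left, Rmax_right in Hc by lra.
  specialize (Hb c ltac:(lra)); assert (H := Rabs_pos (F' c)); nra.
Qed.

Lemma Cmod_le_sum (z : C) : Cmod z <= Rabs (Re z) + Rabs (Im z).
Proof.
replace z with (RtoC (Re z) + Ci * RtoC (Im z))%C at 1
  by (destruct z; apply injective_projections; simpl; ring).
eapply Rle_trans; [apply Cmod_triangle|]; rewrite Cmod_mult, Cmod_Ci, !Cmod_R; lra.
Qed.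

(** The derivative in s of the remainder of order n + 1 is w times that of order n. Each integration
    costs |w|, and a factor 2 for passing from the two components to the modulus. *)
Lemma Cexp_remainder (w : C) (n : nat) (s : R) : 0 <= s <= 1 ->
  let r := (Cexp (RtoC s * w) - exp_partial w n s)%C in
  Rabs (Re r) <= exp (Cmod w) * (2 * Cmod w) ^ n /\ Rabs (Im r) <= exp (Cmod w) * (2 * Cmod w) ^ n.
Proof.
set (rem := fun n s => (Cexp (RtoC s * w) - exp_partial w n s)%C).
assert (Hw := Cmod_ge_0 w); assert (He := exp_pos (Cmod w)).
cut (Rabs (Re (rem n s)) <= exp (Cmod w) * (2 * Cmod w) ^ n /\
     Rabs (Im (rem n s)) <= exp (Cmod w) * (2 * Cmod w) ^ n \/ ~ (0 <= s <= 1)).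
{ intros [H|H] Hs; [exact H|tauto]. }
revert s; induction n as [|n IH]; intros s.
- destruct (classic (0 <= s <= 1)) as [Hs|Hs]; [left|right; auto].
  assert (H : Cmod (rem 0%nat s) <= exp (Cmod w) * (2 * Cmod w) ^ 0).
  { unfold rem, exp_partial; cbn [csum].
    replace (Cexp (RtoC s * w) - 0)%C with (Cexp (RtoC s * w)) by ring.
    rewrite Cmod_Cexp, re_scal_l; simpl pow; rewrite Rmult_1_r.
    assert (Hr := re_le_Cmod w); apply Rabs_le_between in Hr.
    destruct (Req_dec (s * Re w) (Cmod w)) as [->|]; [lra|].
    left; apply exp_increasing; nra. }
  split; [eapply Rle_trans; [apply re_le_Cmod|]|eapply Rle_trans; [apply im_le_Cmod|]]; exact H.
- destruct (classic (0 <= s <= 1)) as [Hs|Hs]; [left|right; auto].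
  set (B := exp (Cmod w) * (2 * Cmod w) ^ n) in *.
  assert (HB : 0 <= B) by (apply Rmult_le_pos; [lra|apply pow_le; lra]).
  assert (HwR : forall x, 0 <= x <= 1 -> Cmod (w * rem n x) <= 2 * Cmod w * B).
  { intros x Hx; rewrite Cmod_mult; destruct (IH x) as [[H1 H2]|]; [|tauto].
    assert (H3 := Cmod_le_sum (rem n x)); nra. }
  assert (H0 : rem (S n) 0 = 0).
  { unfold rem, exp_partial; rewrite csum_shift, csum_0.
    - rewrite Cmult_0_l, Cexp_0; simpl; rewrite Rinv_1; ring.
    - intros i _; rewrite pow_i by lia; ring. }
  assert (HB2 : 0 <= 2 * Cmod w * B) by (apply Rmult_le_pos; lra).
  replace (exp (Cmod w) * (2 * Cmod w) ^ S n) with (2 * Cmod w * B) by (unfold B; simpl; ring).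
  assert (HdR := Rd_Cexp w); assert (HdT := Rd_exp_partial w n).
  assert (Erem : forall x, (w * rem n x = w * Cexp (RtoC x * w) - w * exp_partial w n x)%C)
    by (intros x; unfold rem; ring).
  split.
  + apply (mean_value_bound (fun s => Re (rem (S n) s)) (fun x => Re (w * rem n x)) (2 * Cmod w * B) s); auto.
    * rewrite H0; reflexivity.
    * intros x; rewrite Erem; unfold Cminus; rewrite re_plus, re_opp.
      apply (is_derive_ext (fun x => Re (Cexp (RtoC x * w)) - Re (exp_partial w (S n) x))).
      { intros y; unfold rem, Cminus; rewrite re_plus, re_opp; reflexivity. }
      apply (@is_derive_minus R_AbsRing R_NormedModule); [apply HdR|apply HdT].
    * intros x Hx; eapply Rle_trans; [apply re_le_Cmod|apply HwR, Hx].
  + apply (mean_value_bound (fun s => Im (rem (S n) s)) (fun x => Im (w * rem n x)) (2 * Cmod w * B) s); auto.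
    * rewrite H0; reflexivity.
    * intros x; rewrite Erem; unfold Cminus; rewrite im_plus, im_opp.
      apply (is_derive_ext (fun x => Im (Cexp (RtoC x * w)) - Im (exp_partial w (S n) x))).
      { intros y; unfold rem, Cminus; rewrite im_plus, im_opp; reflexivity. }
      apply (@is_derive_minus R_AbsRing R_NormedModule); [apply HdR|apply HdT].
    * intros x Hx; eapply Rle_trans; [apply im_le_Cmod|apply HwR, Hx].
Qed.

Definition inv_fact (n : nat) : C := RtoC (/ INR (fact n)).

Lemma inv_fact_geo : geo 1 1 inv_fact.
Proof.
intros n; unfold inv_fact; rewrite Cmod_R, pow1, Rmult_1_r.
assert (H : 1 <= INR (fact n)) by (apply (le_INR 1); assert (Hf := lt_O_fact n); lia).
rewrite Rabs_pos_eq; [rewrite <- Rinv_1; apply Rinv_le_contravar; lra|].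
left; apply Rinv_0_lt_compat; lra.
Qed.

(** The radius 1/2 is what makes the factor (2 |w|)^n of the remainder tend to 0. *)
Lemma Cexp_PS (w : C) : Cmod w < 1 / 2 -> Cexp w = PS inv_fact w.
Proof.
intros Hw; symmetry; apply PS_unique.
assert (Hw0 := Cmod_ge_0 w).
apply (Ccv_squeeze _ _ (fun n => 2 * exp (Cmod w) * (2 * Cmod w) ^ n)).
- intros n; destruct (Cexp_remainder w n 1 ltac:(lra)) as [H1 H2].
  rewrite Cmult_1_l in H1, H2.
  assert (E : exp_partial w n 1 = csum (fun j => inv_fact j * w ^ j)%C n).
  { unfold exp_partial, inv_fact; apply csum_ext; intros i _; rewrite pow1; ring. }
  rewrite E in H1, H2; rewrite Cmod_minus_sym.
  eapply Rle_trans; [apply Cmod_le_sum|]; lra.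
- apply lim0_scal, pow_lim0; lra.
Qed.

Definition exp_quot (w : C) : C := PS (fun n => inv_fact (S n)) w.

Lemma Cexp_factor (w : C) : Cmod w < 1 / 2 -> Cexp w = (1 + w * exp_quot w)%C.
Proof.
intros Hw; rewrite Cexp_PS by auto.
rewrite (PS_head 1 1 inv_fact w inv_fact_geo) by lra.
unfold exp_quot, inv_fact at 1; simpl fact; simpl INR; rewrite Rinv_1; reflexivity.
Qed.

Lemma Cd_exp_quot (w : C) : Cmod w < 1 / 2 -> Cd exp_quot w.
Proof.
intros Hw; apply (Cd_PS (1 * 1 ^ 1) 1); try lra.
apply (geo_tail 1 1 inv_fact 1 inv_fact_geo); lra.
Qed.

Definition two_pi_i : C := (RtoC (2 * PI) * Ci)%C.

Lemma Cmod_two_pi_i : Cmod two_pi_i = 2 * PI.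
Proof.
assert (HPI := PI_gt_3); unfold two_pi_i; rewrite Cmod_mult, Cmod_Ci, Cmod_R, Rabs_pos_eq; lra.
Qed.

(** The divided difference of the nome at [tau]. It is holomorphic near [tau] and nonzero there, so
    orders of vanishing in z are orders in q. *)
Definition nome_quot (tau z : C) : C :=
  (nome tau * (two_pi_i * exp_quot (two_pi_i * (z - tau))))%C.

(** 2 pi / 16 < 1/2 brings the argument into the disc of [Cexp_factor]. *)
Lemma small_disc (tau z : C) : Cmod (z - tau) < 1 / 16 -> Cmod (two_pi_i * (z - tau)) < 1 / 2.
Proof.
intros H; assert (HPI := PI_lt_3_2); assert (HPI' := PI_gt_3).
rewrite Cmod_mult, Cmod_two_pi_i; assert (H0 := Cmod_ge_0 (z - tau)); nra.
Qed.

Lemma nome_factor (tau z : C) : Cmod (z - tau) < 1 / 16 ->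
  nome z = (nome tau + (z - tau) * nome_quot tau z)%C.
Proof.
intros H; assert (H1 := small_disc tau z H).
assert (E : nome z = (nome tau * Cexp (two_pi_i * (z - tau)))%C).
{ unfold nome, two_pi_i; rewrite <- Cexp_plus; f_equal; ring. }
rewrite E, Cexp_factor by auto; unfold nome_quot; ring.
Qed.

Lemma Cd_nome_quot (tau z : C) : Cmod (z - tau) < 1 / 16 -> Cd (nome_quot tau) z.
Proof.
intros H; apply Cd_mult; [apply Cd_const|]; apply Cd_mult; [apply Cd_const|].
apply (Cd_comp exp_quot (fun z => two_pi_i * (z - tau))%C).
- apply Cd_exp_quot, small_disc, H.
- apply Cd_mult; [apply Cd_const|apply Cd_minus_const].
Qed.

Lemma nome_nz (tau : C) : nome tau <> 0.
Proof. apply Cmod_gt_0; rewrite Cmod_nome; apply exp_pos. Qed.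

Lemma nome_quot_nz (tau : C) : nome_quot tau tau <> 0.
Proof.
unfold nome_quot; apply Cmult_neq_0; [apply nome_nz|]; apply Cmult_neq_0.
- apply Cmod_gt_0; rewrite Cmod_two_pi_i; assert (H := PI_gt_3); lra.
- replace (two_pi_i * (tau - tau))%C with (RtoC 0) by ring.
  unfold exp_quot; rewrite PS_0; unfold inv_fact; simpl fact; simpl INR; rewrite Rinv_1; apply C1_nz.
Qed.

Lemma Cd_nome (z : C) : Cd nome z.
Proof.
apply (Cd_ext_loc (fun x => (x - z) * nome_quot z x - - nome z)%C).
- apply (locally_Cmod _ _ (1 / 16)); [lra|]; intros w Hw; rewrite (nome_factor z w Hw); ring.
- apply (Cd_comp (fun y => y - - nome z)%C); [apply Cd_minus_const|].
  apply Cd_mult; [apply Cd_minus_const|apply Cd_nome_quot].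
  replace (z - z)%C with (RtoC 0) by ring; rewrite Cmod_0; lra.
Qed.

Lemma in_H_near (tau z : C) (e : R) : Cmod (z - tau) < e -> Im tau - e < Im z.
Proof.
intros H; assert (H1 := im_le_Cmod (z - tau)); unfold Cminus in H1; rewrite im_plus, im_opp in H1.
apply Rabs_le_between in H1; unfold Cminus in H; lra.
Qed.

Lemma Cd_gs_nome (d : nat) (z : C) : in_H z -> Cd (fun x => gs d (nome x)) z.
Proof.
intros Hz; apply (Cd_comp (gs d) nome); [|apply Cd_nome].
assert (Hq := Cmod_nome_lt _ Hz).
destruct (radius_exists (Cmod (nome z))) as [r [Hr Hrq]].
{ split; auto; apply Cmod_ge_0. }
destruct (divisor_sum_geo d r Hr) as [K HK]; apply (Cd_PS K r); auto; lra.
Qed.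

Lemma eisenstein_order_0 (k : nat) (tau : C) : (3 <= k)%nat -> Nat.Odd k -> in_H tau ->
  gs (k - 1) (nome tau) <> 0 -> is_order_at (eisenstein k) tau 0.
Proof.
intros Hk Hodd Ht Hnz; exists (fun z => gs (k - 1) (nome z)).
assert (Hloc : forall P : C -> Prop, (forall z, in_H z -> P z) -> locally (T := C_UniformSpace) tau P).
{ intros P HP; apply (locally_Cmod _ _ (Im tau)); [exact Ht|]; intros z Hz; apply HP.
  unfold in_H in *; assert (H := in_H_near tau z (Im tau) Hz); lra. }
repeat split; auto.
- apply Hloc; intros z Hz; apply Cd_gs_nome, Hz.
- apply Hloc; intros z Hz; rewrite eisenstein_gs by auto; simpl; ring.
Qed.

(** A simple factor q - nome tau becomes (z - tau) times [nome_quot], which is the factor needed by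
    the definition of the order. *)
Lemma eisenstein_order_1 (k : nat) (tau : C) (v : C -> C) : (3 <= k)%nat -> Nat.Odd k -> in_H tau ->
  Cmod (nome tau) <= 1 / 8 ->
  (forall q, Cmod q < 1 / 2 -> gs (k - 1) q = ((q - nome tau) * v q)%C /\ Cd v q) ->
  v (nome tau) <> 0 -> is_order_at (eisenstein k) tau 1.
Proof.
intros Hk Hodd Ht Hq Hv Hnz; exists (fun z => nome_quot tau z * v (nome z))%C.
assert (HPI := PI_lt_3_2); assert (HPI' := PI_gt_3).
assert (Hloc : forall P : C -> Prop,
  (forall z, in_H z -> Cmod (z - tau) < 1 / 16 -> Cmod (nome z) < 1 / 2 -> P z) ->
  locally (T := C_UniformSpace) tau P).
{ intros P HP; unfold in_H in *.
  apply (locally_Cmod _ _ (Rmin (Im tau) (1 / 16))); [apply Rmin_glb_lt; lra|]; intros z Hz.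
  assert (H1 := Rmin_l (Im tau) (1 / 16)); assert (H2 := Rmin_r (Im tau) (1 / 16)).
  assert (H3 := in_H_near tau z _ Hz).
  apply HP; try lra.
  rewrite Cmod_nome in *.
  replace (- (2 * PI) * Im z) with (- (2 * PI) * Im tau + 2 * PI * (Im tau - Im z)) by ring.
  rewrite exp_plus.
  (* The imaginary part drops by less than 1/16, so |nome z| is below 3 |nome tau| <= 3/8. *)
  assert (H4 : exp (2 * PI * (Im tau - Im z)) < 3).
  { apply Rlt_le_trans with (exp 1); [apply exp_increasing; nra|apply exp_le_3]. }
  assert (H5 := exp_pos (2 * PI * (Im tau - Im z))); assert (H6 := exp_pos (- (2 * PI) * Im tau)); nra. }
split; [|split].
- apply Hloc; intros z Hz Hz2 Hz3; apply Cd_mult; [apply Cd_nome_quot, Hz2|].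
  apply (Cd_comp v nome); [apply Hv, Hz3|apply Cd_nome].
- apply Cmult_neq_0; [apply nome_quot_nz|exact Hnz].
- apply Hloc; intros z Hz Hz2 Hz3; rewrite eisenstein_gs by auto.
  destruct (Hv _ Hz3) as [E _]; rewrite E; rewrite (nome_factor tau z Hz2) at 1; simpl; ring.
Qed.

Lemma eisenstein_order_cusp (k : nat) : (3 <= k)%nat -> Nat.Odd k -> is_order_cusp (eisenstein k) 1.
Proof.
intros Hk Hodd; exists (fun n => RtoC (divisor_sum (k - 1) n)); split; [|split].
- intros tau Ht; rewrite eisenstein_gs by auto.
  apply is_series_Ccv; assert (H := gs_Ccv (k - 1) _ (Cmod_nome_lt _ Ht)).
  eapply Ccv_ext; [|exact H]; intros n; apply csum_ext; intros i _.
  assert (E : forall j, @pow_n C_Ring (nome tau) j = (nome tau ^ j)%C).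
  { induction j as [|j IH]; [reflexivity|]; simpl; rewrite IH; reflexivity. }
  transitivity (nome tau ^ i * RtoC (divisor_sum (k - 1) i))%C; [ring|].
  rewrite <- E; reflexivity.
- rewrite divisor_sum_1; apply C1_nz.
- intros [|m] Hm; [reflexivity|lia].
Qed.

(** * Weighted counting *)

Lemma nome_polar (tau : C) : nome tau = (RtoC (exp (- (2 * PI * Im tau))) * cis (2 * PI * Re tau))%C.
Proof.
unfold nome; rewrite Cexp_cis; destruct tau as [x y]; simpl.
f_equal; f_equal; [f_equal|]; ring.
Qed.

(** For |Re tau| <= 1/2 the angle 2 pi Re tau lies between -pi and pi, where cos equals -1 only at
    the ends. *)
Lemma nome_negative (tau : C) (T : R) : - (1 / 2) <= Re tau <= 1 / 2 ->
  nome tau = RtoC (- exp (- (2 * PI * T))) ->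
  Im tau = T /\ (Re tau = 1 / 2 \/ Re tau = - (1 / 2)).
Proof.
intros Hx E; assert (HPI := PI_gt_3).
assert (HT := exp_pos (- (2 * PI * T))).
assert (Em : Im tau = T).
{ assert (Hm := Cmod_nome tau); rewrite E, Cmod_R, Rabs_Ropp, Rabs_pos_eq in Hm by lra.
  apply exp_inv in Hm; nra. }
split; auto.
rewrite nome_polar, Em in E; apply (f_equal Re) in E; rewrite re_scal_l, re_RtoC in E; simpl in E.
assert (Hc : cos (2 * PI * Re tau) = -1) by nra.
assert (Hc2 : cos (Rabs (2 * PI * Re tau)) = -1).
{ unfold Rabs; destruct (Rcase_abs _); [rewrite cos_neg|]; exact Hc. }
rewrite Rabs_mult, (Rabs_pos_eq (2 * PI)) in Hc2 by lra.
assert (Hb : Rabs (Re tau) <= 1 / 2) by (apply Rabs_le; lra).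
assert (Hb0 := Rabs_pos (Re tau)).
destruct (Req_dec (Rabs (Re tau)) (1 / 2)) as [Ha|Ha].
- unfold Rabs in Ha; destruct (Rcase_abs (Re tau)); lra.
- exfalso; assert (H := cos_decreasing_1 (2 * PI * Rabs (Re tau)) PI).
  rewrite cos_PI, Hc2 in H; apply (Rlt_irrefl (-1)), H; nra.
Qed.

Lemma nome_on_line (x T : R) : x = 1 / 2 \/ x = - (1 / 2) ->
  nome (x, T) = RtoC (- exp (- (2 * PI * T))).
Proof.
intros Hx; rewrite nome_polar; simpl Re; simpl Im.
assert (E : cis (2 * PI * x) = (- (1))%C).
{ destruct Hx as [-> | ->].
  - replace (2 * PI * (1 / 2)) with PI by field; apply cis_PI.
  - replace (2 * PI * - (1 / 2)) with (- PI) by field; rewrite cis_opp, cis_PI.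
    apply injective_projections; simpl; ring. }
rewrite E, RtoC_opp; ring.
Qed.

Lemma fund_fin_height (tau : C) : fund_fin tau -> sqrt 3 / 2 <= Im tau.
Proof.
intros [Hh [Hm Hx]]; unfold in_H in Hh.
assert (H3 := sqrt3_sqr); assert (H3b := sqrt3_bounds).
assert (Hm2 := Cmod2_alt tau).
assert (Hm3 : 1 <= Cmod tau ^ 2) by nra.
assert (Hx2 : Re tau ^ 2 <= 1 / 4) by nra.
destruct (Rle_lt_dec (sqrt 3 / 2) (Im tau)); auto; nra.
Qed.

Lemma fund_fin_line (x T : R) : x = 1 / 2 \/ x = - (1 / 2) -> sqrt 3 / 2 <= T -> fund_fin (x, T).
Proof.
intros Hx HT; assert (H3 := sqrt3_sqr); assert (H3b := sqrt3_bounds).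
split; [unfold in_H; simpl; lra|]; split; [|simpl; destruct Hx; lra].
assert (Hm2 := Cmod2_alt (x, T)); simpl Re in Hm2; simpl Im in Hm2.
assert (H0 := Cmod_ge_0 (x, T)).
assert (1 <= Cmod (x, T) ^ 2) by (rewrite Hm2; destruct Hx; subst; nra).
destruct (Rle_lt_dec 1 (Cmod (x, T))); auto; nra.
Qed.

(** Horizontal neighbours leave the strip, so the point is on the boundary; the strict inequality
    separates it from rho and rho + 1. *)
Lemma weight_line (x T : R) : x = 1 / 2 \/ x = - (1 / 2) -> sqrt 3 / 2 < T ->
  weight (Fin (x, T)) = 1 / 2.
Proof.
intros Hx HT; unfold weight.
destruct (excluded_middle_informative _) as [[E|E]|_].
- exfalso; apply (f_equal Im) in E; simpl in E; lra.
- exfalso; apply (f_equal Im) in E; simpl in E; lra.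
- destruct (excluded_middle_informative _) as [[e He]|_]; auto.
  exfalso; assert (He0 := cond_pos e).
  assert (G : forall y, Rabs (y - x) < e -> - (1 / 2) <= y <= 1 / 2).
  { intros y Hy; destruct (He (y, T)) as [_ [_ H]]; [|exact H].
    split; [exact Hy|apply ball_center]. }
  destruct Hx as [-> | ->].
  + specialize (G (1 / 2 + e / 2)); rewrite Rabs_pos_eq in G by lra.
    specialize (G ltac:(lra)); lra.
  + specialize (G (- (1 / 2) - e / 2)); rewrite Rabs_left in G by lra.
    specialize (G ltac:(lra)); lra.
Qed.

Lemma order_positive_zero (f : C -> C) (tau : C) (n : nat) : is_order_at f tau n -> (0 < n)%nat -> f tau = 0.
Proof.
intros [g [_ [_ H]]] Hn.
apply locally_singleton in H; rewrite H; destruct n as [|n]; [lia|].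
simpl; ring.
Qed.

Lemma order_0_nz (f : C -> C) (tau : C) : is_order_at f tau 0 -> f tau <> 0.
Proof.
intros [g [_ [Hg H]]] E; apply Hg.
apply locally_singleton in H; rewrite H in E; rewrite <- E; simpl; ring.
Qed.

(** A zero -e^(-2 pi t) of the q-series is seen at both points 1/2 + i t and -1/2 + i t, each of
    weight 1/2, so it counts once; the cusp adds 1. *)
Lemma weighted_count (k n : nat) (t : nat -> R) : (3 <= k)%nat -> Nat.Odd k ->
  (forall m, (1 <= m <= n)%nat -> sqrt 3 / 2 < t m) ->
  (forall i j, (1 <= i <= n)%nat -> (1 <= j <= n)%nat -> t i = t j -> i = j) ->
  (forall tau m, fund_fin tau -> (1 <= m <= n)%nat ->
     nome tau = RtoC (- exp (- (2 * PI * t m))) -> is_order_at (eisenstein k) tau 1) ->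
  (forall tau, fund_fin tau ->
     (exists m, (1 <= m <= n)%nat /\ nome tau = RtoC (- exp (- (2 * PI * t m)))) \/
     is_order_at (eisenstein k) tau 0) ->
  is_weighted_zeros (eisenstein k) (1 + INR n) /\
  (forall p, fund p -> is_zero_of (eisenstein k) p -> vertical_boundary p).
Proof.
intros Hk Hodd Ht Hinj Hone Hzero; split.
- set (P := fun tau => exists m, (1 <= m <= n)%nat /\ nome tau = RtoC (- exp (- (2 * PI * t m)))).
  set (nu := fun p => match p with
    | Cusp => 1%nat
    | Fin tau => if excluded_middle_informative (P tau) then 1%nat else 0%nat end).
  set (side := fun x => map (fun m => Fin (x, t m)) (seq 1 n)).
  assert (Hside : forall x p, In p (side x) <-> exists m, (1 <= m <= n)%nat /\ p = Fin (x, t m)).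
  { intros x p; unfold side; rewrite in_map_iff; split.
    - intros [m [<- Hm]]; apply in_seq in Hm; exists m; split; [lia|auto].
    - intros [m [Hm ->]]; exists m; split; auto; apply in_seq; lia. }
  assert (HsideP : forall x m, x = 1 / 2 \/ x = - (1 / 2) -> (1 <= m <= n)%nat ->
    fund_fin (x, t m) /\ P (x, t m)).
  { intros x m Hx Hm; split.
    - apply fund_fin_line; auto; left; apply Ht, Hm.
    - exists m; split; auto; apply nome_on_line, Hx. }
  exists nu, (Cusp :: side (1 / 2) ++ side (- (1 / 2))); split; [|split; [|split]].
  + intros [tau|] Hp; simpl.
    * destruct (excluded_middle_informative (P tau)) as [[m [Hm E]]|HnP].
      -- apply (Hone tau m); auto.
      -- destruct (Hzero tau Hp) as [H|H]; [exfalso; apply HnP, H|exact H].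
    * apply eisenstein_order_cusp; auto.
  + assert (Hnd : forall x, NoDup (side x)).
    { intros x; apply NoDup_map_NoDup_ForallPairs; [|apply seq_NoDup].
      intros i j Hi Hj E; apply in_seq in Hi, Hj; injection E; intros E'.
      apply Hinj; auto; lia. }
    constructor.
    * intros H; apply in_app_or in H; destruct H as [H|H]; apply Hside in H;
        destruct H as [m [_ H]]; discriminate.
    * apply NoDup_app; auto.
      intros p Hp Hp'; apply Hside in Hp, Hp'.
      destruct Hp as [m [_ ->]]; destruct Hp' as [m' [_ E]]; injection E; intros; lra.
  + intros p; split.
    * intros [<-|H]; [split; [exact I|discriminate]|].
      assert (G : exists x m, (x = 1 / 2 \/ x = - (1 / 2)) /\ (1 <= m <= n)%nat /\ p = Fin (x, t m)).
      { apply in_app_or in H; destruct H as [H|H]; apply Hside in H; destruct H as [m [Hm E]].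
        - exists (1 / 2), m; auto.
        - exists (- (1 / 2)), m; auto. }
      destruct G as [x [m [Hx [Hm ->]]]]; destruct (HsideP x m Hx Hm) as [H1 H2].
      split; [exact H1|]; simpl.
      destruct (excluded_middle_informative (P (x, t m))); [discriminate|tauto].
    * intros [Hp Hnu]; destruct p as [tau|]; [right|left; reflexivity].
      simpl in Hnu; destruct (excluded_middle_informative (P tau)) as [[m [Hm E]]|]; [|tauto].
      destruct (nome_negative tau (t m)) as [E1 E2]; auto; [apply Hp|].
      apply in_or_app; destruct tau as [x y]; simpl in E1, E2; subst y.
      destruct E2 as [-> | ->]; [left|right]; apply Hside; exists m; auto.
  + assert (Hsum : forall l, (forall p, In p l -> weight p * INR (nu p) = 1 / 2) ->
      fold_right Rplus 0 (map (fun p => weight p * INR (nu p)) l) = INR (length l) / 2).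
    { induction l as [|p l IH]; intros H; [simpl; field|].
      change (length (p :: l)) with (S (length l)); rewrite S_INR; cbn [map fold_right].
      rewrite IH, H; [field|left; auto|intros; apply H; right; auto]. }
    cbn [map fold_right]; rewrite Hsum.
    * rewrite length_app; unfold side; rewrite !length_map, length_seq, plus_INR; simpl; field.
    * intros p H.
      assert (G : exists x m, (x = 1 / 2 \/ x = - (1 / 2)) /\ (1 <= m <= n)%nat /\ p = Fin (x, t m)).
      { apply in_app_or in H; destruct H as [H|H]; apply Hside in H; destruct H as [m [Hm E]].
        - exists (1 / 2), m; auto.
        - exists (- (1 / 2)), m; auto. }
      destruct G as [x [m [Hx [Hm ->]]]]; destruct (HsideP x m Hx Hm) as [_ H2].
      rewrite weight_line by auto.
      unfold nu; destruct (excluded_middle_informative (P (x, t m))); [simpl; field|tauto].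
- intros [tau|] Hp Hz; [|exact I].
  destruct Hz as [j [Hj Hj0]].
  assert (E := order_positive_zero _ _ _ Hj Hj0).
  destruct (Hzero tau Hp) as [[m [Hm E2]]|H0]; [|exfalso; exact (order_0_nz _ _ H0 E)].
  destruct (nome_negative tau (t m)) as [E3 E4]; auto; [apply Hp|].
  split; auto; rewrite E3; left; apply Ht, Hm.
Qed.

(** * The image of the fundamental domain and the weights up to 7 *)

Lemma nome_small (tau : C) : fund_fin tau -> Cmod (nome tau) <= - rho_nome.
Proof.
intros H; apply fund_fin_height in H; assert (HPI := PI_gt_3).
rewrite Cmod_nome; unfold rho_nome; rewrite Ropp_involutive.
destruct (Req_dec (Im tau) (sqrt 3 / 2)) as [->|].
- right; f_equal; ring.
- left; apply exp_increasing; nra.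
Qed.

Lemma rho_nome_bound : 0 < - rho_nome <= 1 / 160.
Proof.
assert (H3 := sqrt3_sqr); assert (H3b := sqrt3_bounds); assert (HPI := PI_gt_3).
unfold rho_nome; rewrite Ropp_involutive; split; [apply exp_pos|].
rewrite exp_Ropp; replace (1 / 160) with (/ 160) by field; apply Rinv_le_contravar; [lra|].
(* exp(pi sqrt 3) >= (exp 1.73)^3 >= 5.45^3 > 160, as pi > 3. *)
assert (Hs : 1.73 <= sqrt 3) by nra.
assert (H := exp_ge_taylor 1.73 4 ltac:(lra)); simpl in H.
assert (H5 : 5.45 <= exp 1.73) by lra.
apply Rle_trans with (exp (1.73 + 1.73 + 1.73)).
- rewrite !exp_plus; nra.
- destruct (Req_dec (1.73 + 1.73 + 1.73) (2 * PI * (sqrt 3 / 2))) as [<-|]; [lra|].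
  left; apply exp_increasing; nra.
Qed.

(** From n = 2 on, consecutive terms n^6 p^n have ratio at most 1.5^6 / 160 < 0.08, and the term n =
    2 is at most 0.4 p. *)
Lemma pl_small_weight (d : nat) (q : C) : (1 <= d <= 6)%nat -> Cmod q <= 1 / 160 ->
  Cmod (pl d q - q) <= 0.45 * Cmod q.
Proof.
intros Hd Hq; assert (Hq0 := Cmod_ge_0 q); set (p := Cmod q) in *.
assert (Hterm : forall i, INR (S (S i)) ^ 6 * p ^ S (S i) <= 0.4 * p * 0.08 ^ i).
{ induction i as [|i IH]; [simpl; nra|].
  set (n := INR (S (S i))) in *.
  assert (Hn : 2 <= n) by (apply (le_INR 2); lia).
  replace (INR (S (S (S i)))) with (n + 1) by (unfold n; rewrite (S_INR (S (S i))); reflexivity).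
  assert (H6 : (n + 1) ^ 6 <= 1.5 ^ 6 * n ^ 6) by (rewrite <- Rpow_mult_distr; apply pow_incr; lra).
  assert (Hn6 : 0 < n ^ 6) by (apply pow_lt; lra).
  assert (Hpi : 0 <= p ^ S (S i)) by (apply pow_le; auto).
  replace (p ^ S (S (S i))) with (p ^ S (S i) * p) by (simpl; ring).
  replace (0.08 ^ S i) with (0.08 * 0.08 ^ i) by (simpl; ring).
  apply Rle_trans with (1.5 ^ 6 * n ^ 6 * (p ^ S (S i) * p)).
  - apply Rmult_le_compat_r; auto; apply Rmult_le_pos; auto.
  - assert (H1 : 1.5 ^ 6 * p <= 0.08) by lra.
    assert (H2 : 0 <= n ^ 6 * p ^ S (S i)) by (apply Rmult_le_pos; lra).
    nra. }
apply (Ccv_bound _ _ _ _ 2 (pl_Ccv d q ltac:(fold p; lra))).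
intros [|[|N]] HN; [lia|lia|]; clear HN.
rewrite !csum_shift.
assert (E0 : (RtoC (INR 0 ^ d) * q ^ 0)%C = 0) by (simpl INR; rewrite pow_i by lia; ring).
assert (E1 : (RtoC (INR 1 ^ d) * q ^ 1)%C = q) by (simpl INR; rewrite pow1; simpl; ring).
rewrite E0, E1; set (R1 := csum _ N).
replace (0 + (q + R1) - q)%C with R1 by ring.
apply Rle_trans with (rsum (fun i => 0.4 * p * 0.08 ^ i) N).
- apply Cmod_csum_le; intros i _.
  rewrite Cmod_mult, Cmod_R, Cmod_pow, Rabs_pos_eq by (apply pow_le, pos_INR); fold p.
  eapply Rle_trans; [|apply Hterm]; apply Rmult_le_compat_r; [apply pow_le; auto|].
  apply Rle_pow; [apply (le_INR 1)|]; lia.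
- rewrite rsum_scal; assert (H := rsum_geom 0.08 N ltac:(lra)).
  change (rsum (pow 0.08) N) with (rsum (fun i => 0.08 ^ i) N).
  assert (H2 : / (1 - 0.08) <= 1.1) by (apply Rmult_le_reg_r with (1 - 0.08); [lra|]; rewrite Rinv_l; lra).
  nra.
Qed.

(** The term q wins: the rest of [pl] is at most 0.45 |q| and the rest of the series at most 0.4
    |q|. *)
Lemma gs_small_weight (d : nat) (q : C) : (2 <= d <= 6)%nat -> 0 < Cmod q <= 1 / 160 -> gs d q <> 0.
Proof.
intros Hd Hq E; set (p := Cmod q) in *.
assert (H1 := pl_small_weight d q ltac:(lia) ltac:(apply Hq)); fold p in H1.
assert (Ep : Cmod (RtoC p) = p) by (rewrite Cmod_R, Rabs_pos_eq; lra).
assert (H2 := pl_small_weight d (RtoC p) ltac:(lia) ltac:(rewrite Ep; apply Hq)).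
rewrite Ep, plr_eq, <- RtoC_minus, Cmod_R in H2; apply Rabs_le_between in H2.
assert (H3 := gs_minus_pl d q ltac:(lia) ltac:(fold p; lra)); fold p in H3; rewrite E in H3.
assert (H4 : / 2 ^ d * plr d p / (1 - p) <= 0.4 * p).
{ assert (Hd4 : / 2 ^ d <= 1 / 4).
  { replace (1 / 4) with (/ 2 ^ 2) by field; apply Rinv_le_contravar; [lra|apply Rle_pow; [lra|lia]]. }
  assert (0 < / 2 ^ d) by (apply Rinv_0_lt_compat, pow_lt; lra).
  assert (E1 : / 2 ^ d * plr d p <= 0.3625 * p) by nra.
  assert (E0 : 0 <= / 2 ^ d * plr d p) by (apply Rmult_le_pos; lra).
  assert (Ei : / (1 - p) <= 1.01) by (apply Rmult_le_reg_r with (1 - p); [lra|]; rewrite Rinv_l; lra).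
  assert (0 < / (1 - p)) by (apply Rinv_0_lt_compat; lra).
  unfold Rdiv at 1; nra. }
assert (H5 := Cmod_triangle (- (pl d q - q)) (- (0 - pl d q))).
rewrite !Cmod_opp in H5.
replace (- (pl d q - q) + - (0 - pl d q))%C with q in H5 by ring; fold p in H5.
lra.
Qed.

Lemma count_small (k : nat) : (3 <= k <= 7)%nat -> Nat.Odd k ->
  is_weighted_zeros (eisenstein k) 1 /\
  (forall p, fund p -> is_zero_of (eisenstein k) p -> vertical_boundary p).
Proof.
intros Hk Hodd.
replace 1 with (1 + INR 0) at 1 by (simpl; ring).
apply (weighted_count k 0 (fun _ => 0)); auto; try lia; try (intros; lia).
intros tau Ht; right; apply eisenstein_order_0; auto; [lia|apply Ht|].
assert (Hn := nome_small tau Ht); assert (Hr := rho_nome_bound).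
apply gs_small_weight; [lia|]; split; [apply Cmod_gt_0, nome_nz|lra].
Qed.

(** * The weights from 9 on *)

Lemma Cd_lin_prod (l : list C) (q : C) : Cd (lin_prod l) q.
Proof.
induction l as [|g l IH]; [apply Cd_const|].
apply (Cd_mult (fun q => q - g)%C (lin_prod l)); [apply Cd_minus_const|exact IH].
Qed.

Lemma sample_pos (d m : nat) : 0 < sample d m.
Proof. unfold sample; destruct (8 * m * m <=? S d)%nat; apply exp_pos. Qed.

Lemma sample_mono (d i j : nat) : (8 <= d)%nat -> (1 <= i <= j)%nat -> (13 * j <= 3 * S d)%nat ->
  sample d i <= sample d j.
Proof.
intros Hd Hij Hj; replace j with (i + (j - i))%nat in * by lia.
induction (j - i)%nat as [|n IH]; [rewrite Nat.add_0_r; lra|].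
rewrite Nat.add_succ_r in *; specialize (IH ltac:(lia) ltac:(lia)).
assert (H := sample_increasing d (i + n) Hd ltac:(lia) Hj); lra.
Qed.

(** rho is the point of angle pi / 6, which lies between the angles a pi / k and (a + 1) pi / k. *)
Lemma rho_between (d a : nat) : (8 <= d)%nat -> (1 <= a)%nat -> (6 * a < S d < 6 * S a)%nat ->
  (13 * S a <= 3 * S d)%nat -> sample d a < - rho_nome < sample d (S a).
Proof.
intros Hd Ha Hk Hb.
assert (H3b := sqrt3_bounds); assert (HPI := PI_gt_3); assert (HPI' := PI_lt_3_2).
assert (Hk0 : 0 < INR (S d)) by (apply lt_0_INR; lia).
assert (E : forall m, (6 * m < S d)%nat -> INR m * PI / INR (S d) < PI / 6).
{ intros m Hm; apply lt_INR in Hm; rewrite mult_INR in Hm; simpl (INR 6) in Hm.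
  apply Rmult_lt_reg_r with (INR (S d)); auto.
  replace (INR m * PI / INR (S d) * INR (S d)) with (INR m * PI) by (field; lra); nra. }
assert (E' : PI / 6 < INR (S a) * PI / INR (S d)).
{ destruct Hk as [_ Hk]; apply lt_INR in Hk; rewrite mult_INR in Hk; simpl (INR 6) in Hk.
  apply Rmult_lt_reg_r with (INR (S d)); auto.
  replace (INR (S a) * PI / INR (S d) * INR (S d)) with (INR (S a) * PI) by (field; lra); nra. }
unfold rho_nome; rewrite Ropp_involutive, <- height_PI6.
assert (A1 := angle_bounds (S d) (S a) ltac:(lia) Hb).
assert (A2 := angle_bounds (S d) a Ha ltac:(lia)).
specialize (E a ltac:(lia)).
unfold sample; split.
- destruct (Nat.leb_spec (8 * a * a) (S d)) as [H|H]; apply exp_increasing, Ropp_lt_contravar.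
  (* The saddle formula can apply only to a = 1, because 8 a^2 <= k < 6 a + 6. *)
  + assert (a = 1)%nat by nia; subst a; rewrite height_PI6; simpl (INR 1).
    apply (le_INR 8) in Hd; simpl (INR 8) in Hd; unfold Rdiv at 2; rewrite Rinv_1; nra.
  + apply Rmult_lt_compat_l; [lra|]; apply height_decreasing; lra.
- destruct (Nat.leb_spec (8 * S a * S a) (S d)) as [H|H]; [nia|].
  apply exp_increasing, Ropp_lt_contravar, Rmult_lt_compat_l; [lra|].
  apply height_decreasing; lra.
Qed.

Lemma pow_m1_sqr (m : nat) : (-1) ^ m * (-1) ^ m = 1.
Proof. rewrite <- pow_add; replace (m + m)%nat with (2 * m)%nat by lia; apply pow_1_even. Qed.

(* The last zero lies between the last two sample points; the sign at rho tells on which side of rho. *)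
Lemma count_large (d h a n : nat) : (4 <= h)%nat -> (d = 2 * h)%nat -> (1 <= a)%nat ->
  (6 * a < S d < 6 * S a)%nat -> (13 * S a <= 3 * S d)%nat ->
  (n = a /\ 0 < (-1) ^ S a * gsr d rho_nome \/ S n = a /\ 0 < (-1) ^ a * gsr d rho_nome) ->
  is_weighted_zeros (eisenstein (S d)) (1 + INR n) /\
  (forall p, fund p -> is_zero_of (eisenstein (S d)) p -> vertical_boundary p).
Proof.
intros Hh Hd Ha Hk Hb Hsign; assert (HPI := PI_gt_3).
assert (Hk3 : (3 <= S d)%nat) by lia.
assert (Hodd : Nat.Odd (S d)) by (exists h; lia).
destruct (gs_zeros d h (S a) Hh Hd ltac:(nia) Hb ltac:(lia)) as [z [b [K [Hz [Hbg [Hfac Hnz]]]]]].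
destruct (rho_between d a ltac:(lia) Ha Hk Hb) as [Hr1 Hr2].
assert (Hr0 := rho_nome_bound); set (r0 := - rho_nome) in *.
replace (S a - 1)%nat with a in Hfac by lia.
set (zs := map (fun m => RtoC (- z m)) (seq 1 a)) in *.
assert (Hangle := angle_bounds (S d) (S a) ltac:(lia) Hb).
destruct (height_facts _ Hangle) as [_ [_ [_ HR8]]].
set (R0 := sample d (S a)) in *.
assert (HR0 : R0 <= 1 / 8).
{ unfold R0, sample; destruct (Nat.leb_spec (8 * S a * S a) (S d)); [nia|exact HR8]. }
assert (Hzpos : forall m, (1 <= m <= a)%nat -> 0 < z m < R0).
{ intros m Hm; destruct (Hz m ltac:(lia)) as [H1 H2].
  assert (H3 := sample_pos d m); assert (H4 := sample_mono d (S m) (S a) ltac:(lia) ltac:(lia) Hb).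
  fold R0 in H4; lra. }
assert (Hzmono : forall i j, (1 <= i < j)%nat -> (j <= a)%nat -> z i < z j).
{ intros i j Hij Hj.
  destruct (Hz i ltac:(lia)) as [_ H2]; destruct (Hz j ltac:(lia)) as [H1 _].
  assert (H4 := sample_mono d (S i) j ltac:(lia) ltac:(lia) ltac:(lia)); lra. }
assert (Hzinj : forall i j, (1 <= i <= a)%nat -> (1 <= j <= a)%nat -> z i = z j -> i = j).
{ intros i j Hi Hj E; destruct (Nat.lt_trichotomy i j) as [H|[H|H]]; auto; exfalso.
  - specialize (Hzmono i j ltac:(lia) ltac:(lia)); lra.
  - specialize (Hzmono j i ltac:(lia) ltac:(lia)); lra. }
assert (Hzs : forall q : C, In q zs <-> exists m, (1 <= m <= a)%nat /\ q = RtoC (- z m)).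
{ intros q; unfold zs; rewrite in_map_iff; split.
  - intros [m [<- Hm]]; apply in_seq in Hm; exists m; split; [lia|auto].
  - intros [m [Hm ->]]; exists m; split; auto; apply in_seq; lia. }
assert (Hroot : forall q : C, q <> RtoC 0 -> Cmod q <= R0 -> gs d q = RtoC 0 -> In q zs).
{ intros q Hq HqR E; rewrite Hfac in E by lra.
  destruct (classic (In q zs)) as [|Hn]; auto; exfalso.
  apply (Cmult_neq_0 (q * lin_prod zs q)%C (PS b q)); auto.
  apply Cmult_neq_0; auto; apply lin_prod_nz, Hn. }
assert (Hlow : forall m, (1 <= m < a)%nat -> z m < sample d a).
{ intros m Hm; destruct (Hz m ltac:(lia)) as [_ H2].
  assert (H4 := sample_mono d (S m) a ltac:(lia) ltac:(lia) ltac:(lia)); lra. }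
(* Uniqueness in the last gap: a sign change found on one side of rho then locates [z a] itself. *)
assert (Hlast : forall x, sample d a < x < R0 -> gsr d (- x) = 0 -> x = z a).
{ intros x Hx E; assert (Hsp := sample_pos d a).
  destruct (proj1 (Hzs (RtoC (- x)))) as [m [Hm Em]].
  - apply Hroot; [apply RtoC_neq; lra| |rewrite gs_real, E; reflexivity].
    rewrite Cmod_R, Rabs_Ropp, Rabs_pos_eq; lra.
  - injection Em; intros Em'.
    destruct (Nat.eq_dec m a) as [->|Hma]; [lra|].
    assert (H := Hlow m ltac:(lia)); lra. }
assert (Sa := sample_sign d h a Hh Hd Ha ltac:(lia)).
assert (SSa := sample_sign d h (S a) Hh Hd ltac:(lia) Hb); fold R0 in SSa.
assert (Hpm := pow_m1_sqr a).
assert (Hza : n = a /\ z a < r0 \/ S n = a /\ r0 < z a).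
{ rewrite <- tech_pow_Rmult in Hsign, SSa; set (e := (-1) ^ a) in *.
  assert (Hrn : rho_nome = - r0) by (unfold r0; ring); rewrite Hrn in Hsign.
  set (u := gsr d (- sample d a)) in *; set (v := gsr d (- R0)) in *; set (w := gsr d (- r0)) in *.
  destruct Hsign as [[Hn Hs]|[Hn Hs]]; [left|right]; split; auto.
  - destruct (gsr_zero_between d (sample d a) r0) as [x [Hx E]].
    + split; [apply sample_pos|exact Hr1].
    + lra.
    + fold u w; assert (H : 0 < (e * u) * (-1 * e * w)) by (apply Rmult_lt_0_compat; auto).
      replace ((e * u) * (-1 * e * w)) with (- (e * e) * (u * w)) in H by ring.
      rewrite Hpm in H; lra.
    + rewrite <- (Hlast x); auto; lra.
  - destruct (gsr_zero_between d r0 R0) as [x [Hx E]].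
    + lra.
    + lra.
    + fold v w; assert (H : 0 < (e * w) * (-1 * e * v)) by (apply Rmult_lt_0_compat; auto).
      replace ((e * w) * (-1 * e * v)) with (- (e * e) * (w * v)) in H by ring.
      rewrite Hpm in H; lra.
    + rewrite <- (Hlast x); auto; lra. }
(* The height on the two vertical lines at which the nome equals -z_m. *)
set (t := fun m => - ln (z m) / (2 * PI)).
assert (Ht : forall m, (1 <= m <= a)%nat -> exp (- (2 * PI * t m)) = z m).
{ intros m Hm; unfold t; replace (- (2 * PI * (- ln (z m) / (2 * PI)))) with (ln (z m)) by (field; lra).
  apply exp_ln, Hzpos, Hm. }
assert (Hna : (n <= a)%nat) by lia.
apply (weighted_count (S d) n t); auto.
- intros m Hm.
  assert (Hzm : z m < r0).
  { destruct (Nat.eq_dec m a) as [->|Hma]; [destruct Hza; [tauto|lia]|].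
    assert (H := Hlow m ltac:(lia)); lra. }
  apply Rnot_le_lt; intros Hle.
  rewrite <- (Ht m) in Hzm by lia; unfold r0, rho_nome in Hzm; rewrite Ropp_involutive in Hzm.
  apply exp_lt_inv in Hzm; nra.
- intros i j Hi Hj E; apply Hzinj; try lia.
  rewrite <- (Ht i), <- (Ht j), E by lia; reflexivity.
- intros tau m Hf Hm E; rewrite Ht in E by lia.
  destruct (Hzpos m ltac:(lia)) as [Hz1 Hz2].
  assert (Hq : Cmod (nome tau) = z m) by (rewrite E, Cmod_R, Rabs_Ropp, Rabs_pos_eq; lra).
  assert (Hin : In (nome tau) zs) by (apply Hzs; exists m; split; [lia|exact E]).
  assert (Hnd : NoDup zs).
  { unfold zs; apply NoDup_map_NoDup_ForallPairs; [|apply seq_NoDup].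
    intros i j Hi Hj Eij; apply in_seq in Hi, Hj; injection Eij; intros E'.
    apply Hzinj; lia || lra. }
  destruct (in_split _ _ Hin) as [l1 [l2 El]].
  rewrite El in Hnd; apply NoDup_remove_2 in Hnd.
  (* The quotient by q - nome tau keeps q, the other linear factors and the nonvanishing series; as
     the roots are distinct, none of these vanishes at nome tau. *)
  apply (eisenstein_order_1 (S d) tau (fun q => q * lin_prod (l1 ++ l2) q * PS b q)%C); auto.
  + apply Hf.
  + lra.
  + intros q Hq2; replace (S d - 1)%nat with d by lia; split.
    * rewrite Hfac, El by auto.
      rewrite (lin_prod_perm _ (nome tau :: l1 ++ l2)) by (symmetry; apply Permutation_middle).
      cbn [lin_prod]; ring.
    * apply Cd_mult; [apply (Cd_mult (fun q => q)); [apply Cd_id|apply Cd_lin_prod]|].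
      apply (Cd_PS K 2); auto; lra.
  + apply Cmult_neq_0; [apply Cmult_neq_0|].
    * apply nome_nz.
    * apply lin_prod_nz, Hnd.
    * apply Hnz; lra.
- intros tau Hf.
  assert (Hsm := nome_small tau Hf); fold r0 in Hsm.
  destruct (Ceq_dec (gs d (nome tau)) 0) as [E|E].
  + left; destruct (proj1 (Hzs (nome tau))) as [m [Hm Em]].
    { apply Hroot; auto; [apply nome_nz|lra]. }
    exists m; split; [|rewrite Ht; auto].
    destruct (Hzpos m Hm) as [Hz1 Hz2].
    rewrite Em, Cmod_R, Rabs_Ropp, Rabs_pos_eq in Hsm by lra.
    destruct (Nat.eq_dec m a) as [->|Hma]; [|lia].
    destruct Hza as [[-> _]|[_ H]]; [lia|lra].
  + right; apply eisenstein_order_0; auto; [apply Hf|].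
    replace (S d - 1)%nat with d by lia; exact E.
Qed.

(** [n] counts the zeros on the negative axis that lie above rho: with a = floor(k / 6) it is a if
    the last one does, and a - 1 otherwise. The cusp makes this the ceiling or the floor of k /
    6. *)
Lemma count_main (k : nat) : (3 <= k)%nat -> Nat.Odd k -> exists n : nat,
  is_weighted_zeros (eisenstein k) (1 + INR n) /\
  (forall p, fund p -> is_zero_of (eisenstein k) p -> vertical_boundary p) /\
  ((k mod 12 = 3 \/ k mod 12 = 5 \/ k mod 12 = 11)%nat -> (6 * n < k <= 6 * S n)%nat) /\
  ((k mod 12 = 1 \/ k mod 12 = 7 \/ k mod 12 = 9)%nat -> (6 * S n <= k < 6 * S (S n))%nat).
Proof.
intros Hk Hodd.
destruct (le_lt_dec k 7) as [H7|H7].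
(* Only the cusp counts: the ceiling of k / 6 for k = 3, 5 and its floor for k = 7 are both 1. *)
- destruct (count_small k ltac:(lia) Hodd) as [H1 H2]; exists 0%nat.
  replace (1 + INR 0) with 1 by (simpl; ring).
  assert (Hm : (k mod 12 = k)%nat) by (apply Nat.mod_small; lia).
  repeat split; auto; lia.
- destruct Hodd as [h Hh].
  assert (Hdiv := Nat.div_mod_eq k 6); assert (Hmod := Nat.mod_upper_bound k 6 ltac:(lia)).
  assert (Hdiv12 := Nat.div_mod_eq k 12); assert (Hmod12 := Nat.mod_upper_bound k 12 ltac:(lia)).
  set (a := (k / 6)%nat) in *; set (r := (k mod 6)%nat) in *.
  set (c := (k / 12)%nat) in *; set (r12 := (k mod 12)%nat) in *.
  destruct k as [|d]; [lia|].
  assert (Hd : (d = 2 * h)%nat) by lia.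
  assert (Hr : (r = 1 \/ r = 3 \/ r = 5)%nat) by lia.
  assert (Hsign : exists n, (n = a /\ 0 < (-1) ^ S a * gsr d rho_nome /\
      (r12 = 3 \/ r12 = 5 \/ r12 = 11)%nat) \/
    (S n = a /\ 0 < (-1) ^ a * gsr d rho_nome /\ (r12 = 1 \/ r12 = 7 \/ r12 = 9)%nat)).
  { destruct Hr as [Hr|[Hr|Hr]].
    - exists (a - 1)%nat; right; split; [lia|split; [|lia]].
      apply (sign_at_rho_1 a d h); lia.
    (* The sign at rho is negative whatever [a] is, so the parity of [a] decides; it separates 3
       from 9 modulo 12. *)
    - assert (Hneg := sign_at_rho_3 a d h ltac:(lia) Hd ltac:(lia)).
      destruct (Nat.Even_or_Odd a) as [[e He]|[e He]].
      + exists a; left; split; [auto|split; [|lia]].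
        rewrite <- tech_pow_Rmult, He, pow_1_even; lra.
      + exists (a - 1)%nat; right; split; [lia|split; [|lia]].
        replace a with (S (2 * e)) by lia; rewrite pow_1_odd; lra.
    - exists a; left; split; [auto|split; [|lia]].
      apply (sign_at_rho_5 a d h); lia. }
  destruct Hsign as [n Hn]; exists n.
  destruct (count_large d h a n) as [H1 H2]; try lia; try tauto.
  split; [exact H1|]; split; [exact H2|]; lia.
Qed.

Theorem theorem1p4 (k : nat) (hk3 : (3 <= k)%nat) (hkodd : Nat.Odd k) :
  ((k mod 12 = 3 \/ k mod 12 = 5 \/ k mod 12 = 11)%nat ->
     is_weighted_zeros (eisenstein k) (IZR (Zceil (INR k / 6)))) /\
  ((k mod 12 = 1 \/ k mod 12 = 7 \/ k mod 12 = 9)%nat ->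
     is_weighted_zeros (eisenstein k) (IZR (Zfloor (INR k / 6)))) /\
  (forall p : xpoint, fund p -> is_zero_of (eisenstein k) p ->
     vertical_boundary p).
Proof.
destruct (count_main k hk3 hkodd) as [n [H1 [H2 [Hceil Hfloor]]]].
assert (En : 1 + INR n = IZR (Z.of_nat (S n))) by (rewrite <- INR_IZR_INZ, S_INR; ring).
assert (H6 : forall m, INR (6 * m) = 6 * IZR (Z.of_nat m)).
{ intros m; rewrite mult_INR, <- INR_IZR_INZ; simpl (INR 6); ring. }
assert (HS : IZR (Z.of_nat (S n)) = IZR (Z.of_nat n) + 1) by (rewrite <- !INR_IZR_INZ, S_INR; ring).
split; [|split; [|exact H2]]; intros Hm.
- destruct (Hceil Hm) as [Ha Hb]; apply lt_INR in Ha; apply le_INR in Hb; rewrite H6 in Ha, Hb.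
  rewrite (Zceil_eq (Z.of_nat (S n))), <- En by lra; exact H1.
- destruct (Hfloor Hm) as [Ha Hb]; apply le_INR in Ha; apply lt_INR in Hb; rewrite H6 in Ha, Hb.
  assert (HSS : IZR (Z.of_nat (S (S n))) = IZR (Z.of_nat (S n)) + 1) by (rewrite <- !INR_IZR_INZ, !S_INR; ring).
  rewrite (Zfloor_eq (Z.of_nat (S n))), <- En by lra; exact H1.
Qed.
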